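(* For $j=1,2$ let $P^{(j)}=N_d(\mu_j,\Sigma_j)$ with $\Sigma_j$ positive definite and density $f_j$, let $\pi_1,\pi_2>0$ with $\pi_1+\pi_2=1$, and let $\delta\in(0,1/2)$. Then for every $x\in\mathbb{R}^d$, \[2\log\frac{\pi_1}{\mathrm{vol}_d(P^{(1)}_\delta)}-d_{\Sigma_1}(x,\mu_1)^2>2\log\frac{\pi_2}{\mathrm{vol}_d(P^{(2)}_\delta)}-d_{\Sigma_2}(x,\mu_2)^2\iff \pi_1f_1(x)>\pi_2f_2(x),\] i.e. the rule coincides with the classical quadratic discriminant (Bayes) rule. Moreover, if $P^{(j)}_n$ is the empirical measure of an i.i.d. sample of size $n$ from $P^{(j)}$, then for every bounded $K\subset\mathbb{R}^d$ and $j=1,2$, \[\sup_{x\in K}\Bigl|2\log\frac{\pi_j}{\mathrm{vol}_d(P^{(j)}_{n,\delta})}-M_\delta(x;P^{(j)}_n)^2-\Bigl(2\log\frac{\pi_j}{\mathrm{vol}_d(P^{(j)}_\delta)}-d_{\Sigma_j}(x,\mu_j)^2\Bigr)\Bigr|\to0\] in probability, where $M_\delta$ is computed with $F_n=\Phi$.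
   Context: $\Phi$ is the standard normal distribution function. $d_\Sigma(x,\mu)=\sqrt{(x-\mu)^\top\Sigma^{-1}(x-\mu)}$. $\mathrm{HD}(x;Q)=\inf_uQ(\{y\colon u^\top y\le u^\top x\})$, $Q_\delta=\{x\colon\mathrm{HD}(x;Q)\ge\delta\}$, $P^{(j)}_{n,\delta}=(P^{(j)}_n)_\delta$. $\mathrm{Ill}(x;K)=\mathrm{vol}_d(\mathrm{conv}(K\cup\{x\}))$. $g_d(t)=1+\frac{\Gamma(\frac d2+1)}{\sqrt\pi\Gamma(\frac{d+1}2)}\bigl(\frac td(1-t^{-2})^{\frac{d+1}2}-\int_0^{\arccos(1/t)}\sin^d s\,ds\bigr)$ on $[1,\infty)$ with inverse $g_d^{-1}$. $M_\delta(x;P_n)=\Phi^{-1}(1-\mathrm{HD}(x;P_n))$ if $\mathrm{HD}(x;P_n)\ge\delta$, and $M_\delta(x;P_n)=\Phi^{-1}(1-\delta)\,g_d^{-1}(\mathrm{Ill}(x;P_{n,\delta})/\mathrm{vol}_d(P_{n,\delta}))$ otherwise. *)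

(* Defs.v *)
From HB Require Import structures.
From mathcomp Require Import all_boot all_order all_algebra.
From mathcomp Require Import all_classical all_reals all_analysis.
From mathcomp Require Import normal_distribution.

Set Implicit Arguments.
Unset Strict Implicit.
Unset Printing Implicit Defensive.

Import Order.TTheory GRing.Theory Num.Theory.
Import numFieldNormedType.Exports.

Local Open Scope classical_set_scope.
Local Open Scope ring_scope.

Section Defs.
Context {R : realType} {d : nat}.

Local Notation V := 'rV[R]_d.

Definition dotv (u x : V) : R := \sum_(k < d) u ord0 k * x ord0 k.

Definition qform (A : 'M[R]_d) (v : V) : R := (v *m A *m v^T) ord0 ord0.

Definition posdef (S : 'M[R]_d) : Prop :=
  S^T = S /\ forall v : V, v != 0 -> 0 < qform S v.

Definition mahal (S : 'M[R]_d) (x mu : V) : R := Num.sqrt (qform (invmx S) (x - mu)).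

Definition gauss_density (mu : V) (S : 'M[R]_d) (x : V) : R :=
  (Num.sqrt ((pi *+ 2) ^+ d * \det S))^-1 * expR (- (mahal S x mu ^+ 2) / 2).

Definition borel_rV : set (set V) :=
  g_sigma_preimage (fun (k : 'I_d) (v : V) => v ord0 k).

Definition HD (x : V) (Q : set V -> R) : R :=
  inf [set Q [set y | dotv u y <= dotv u x] | u in [set: V]].

Definition depth_region (Q : set V -> R) (delta : R) : set V :=
  [set x | delta <= HD x Q].

Definition box (a b : V) : set V := [set x | forall k, a ord0 k <= x ord0 k <= b ord0 k].
Definition boxvol (a b : V) : R := \prod_(k < d) Num.max 0 (b ord0 k - a ord0 k).
Definition vol (A : set V) : \bar R :=
  ereal_inf [set s | exists a b : nat -> V,
     A `<=` \bigcup_n box (a n) (b n) /\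
     s = (\sum_(0 <= n <oo) (boxvol (a n) (b n))%:E)%E].

Definition conv_hull (S : set V) : set V :=
  [set y | exists n (w : 'I_n -> R) (p : 'I_n -> V),
     [/\ forall i, 0 <= w i, \sum_(i < n) w i = 1, forall i, S (p i)
       & y = \sum_(i < n) w i *: p i]].

Definition Ill (x : V) (K : set V) : \bar R := vol (conv_hull (K `|` [set x])).

Definition Phi (t : R) : R := fine (normal_prob 0 1 `]-oo, t]).
Definition Phi_inv (p : R) : R := xget 0 [set t | Phi t = p].

Definition Gamma (s : R) : R :=
  Rintegral lebesgue_measure `]0, +oo[ (fun t => powR t (s - 1) * expR (- t)).

Definition g_fun (t : R) : R :=
  1 + Gamma (d%:R / 2 + 1) / (Num.sqrt pi * Gamma ((d%:R + 1) / 2)) *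
      (t / d%:R * powR (1 - t ^- 2) ((d%:R + 1) / 2)
       - Rintegral lebesgue_measure `[0, acos (t^-1)] (fun s => sin s ^+ d)).
Definition g_inv (y : R) : R := xget 1 [set t | 1 <= t /\ g_fun t = y].

Definition Mdelta (delta : R) (x : V) (Q : set V -> R) : R :=
  if delta <= HD x Q then Phi_inv (1 - HD x Q)
  else Phi_inv (1 - delta) *
       g_inv (fine (Ill x (depth_region Q delta)) / fine (vol (depth_region Q delta))).

Definition empirical (n : nat) (X : nat -> V) : set V -> R :=
  fun A => n%:R^-1 * \sum_(i < n) \1_A (X i).

End Defs.

Section Prob.
Context {dT : measure_display} {T : measurableType dT} {R : realType} {d : nat}.
Local Notation V := 'rV[R]_d.

Definition random_vector (X : T -> V) : Prop :=
  forall k : 'I_d, measurable_fun setT (fun w => X w ord0 k).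

Definition law (P : probability T R) (X : T -> V) : set V -> R :=
  fun A => fine (P (X @^-1` A)).

Definition gaussian_rv (P : probability T R) (X : T -> V) (mu : V) (S : 'M[R]_d) : Prop :=
  random_vector X /\
  forall u : V, u != 0 -> forall B : set R, measurable B ->
    P (X @^-1` [set y | B (dotv u y)]) = normal_prob (dotv u mu) (Num.sqrt (qform S u)) B.

Definition mutually_independent (P : probability T R) (X : nat -> T -> V) : Prop :=
  forall (s : seq nat) (A : nat -> set V), uniq s -> (forall i, borel_rV (A i)) ->
    P (\big[setI/setT]_(i <- s) (X i @^-1` A i)) = (\prod_(i <- s) P (X i @^-1` A i))%E.

(** Z_n -> 0 in (outer) probability, Z_n > eps described by the event E n eps *)
Definition cvg_in_outer_prob (P : probability T R) (E : nat -> R -> set T) : Prop :=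
  forall eps : R, 0 < eps ->
    exists F : nat -> set T, (forall n, measurable (F n) /\ E n eps `<=` F n) /\
      (fun n => P (F n)) @ \oo --> 0%E.

End Prob.

(* Main.v *)
(** For [N(mu, S)] the halfspace depth of [x] is [Phi (- mahal S x mu)], so the depth
    region is the ellipsoid [mahal <= r] with [Phi r = 1 - delta], of volume
    [sqrt (det S)] times a constant that does not depend on the population; this turns
    the score into a monotone transform of the density.

    For the sample, a weak law of large numbers on a finite grid of halfspaces,
    followed by bracketing, makes the empirical depth uniformly close to the population
    depth.  The empirical region then lies between the ellipsoids of radii [r - rho] and
    [r + rho].  The illumination of a ball is [g_fun] times its volume, hence by affine
    invariance the ratio of illumination to volume of the empirical region lies within a
    factor [((r + rho) / (r - rho)) ^ d] of [g_fun (max 1 (mahal / r))], and the claim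
    follows from the uniform continuity of the inverse of [g_fun].

    Volume is the outer measure defined by covers with boxes, and is handled for
    arbitrary sets: upper bounds come from explicit covers, lower bounds from
    integrating the outer measures of the slices. *)

Require Import Defs.
From HB Require Import structures.
From mathcomp Require Import all_boot all_order all_algebra.
From mathcomp Require Import all_classical all_reals all_analysis.
From mathcomp Require Import normal_distribution measurable_realfun gauss_integral.
From mathcomp Require Import ring lra.

Import Order.TTheory GRing.Theory Num.Theory.
Import numFieldNormedType.Exports.
Local Open Scope classical_set_scope.
Local Open Scope ring_scope.

Set Implicit Arguments.
Unset Strict Implicit.
Unset Printing Implicit Defensive.

(** The shape of the proof is dictated by measurability. Empirical depth regions and their
    illumination bodies come without a measurability proof, and so does the supremum over [K].
    Volume is therefore used only through monotonicity, countable subadditivity and exact values on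
    ellipsoids and on hulls of an ellipsoid and a point; randomness is confined to a finite union of
    measurable bad events, off which every estimate is deterministic. The change of variables under
    a linear map rests on elementary matrices, whose images of boxes can be covered by hand. The
    Gamma quotient in [g_fun] is the reciprocal of a Wallis integral, that is, the quotient of unit
    ball volumes in consecutive dimensions; the two terms in its bracket come from the tangent cone
    and the cap it replaces. The angle [acos t^-1] locates the sphere of tangency, and in this
    variable all square roots disappear. A depth error becomes a radial error through a lower bound
    [c] for the normal density on [[-(r + 1), r + 1]]. *)

Section cover_volume.
Context {R : realType}.

(* Covers are indexed by sets of integers so that the empty set has volume [0] in
   dimension [0] too, where every box has volume [1]. *)
Definition cvol (d : nat) (A : set 'rV[R]_d) : \bar R :=
  ereal_inf [set s | exists (D : set nat) (a b : nat -> 'rV[R]_d),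
     A `<=` \bigcup_(n in D) box (a n) (b n) /\
     s = \esum_(n in D) (boxvol (a n) (b n))%:E].

Lemma boxvol_ge0 d (a b : 'rV[R]_d) : 0 <= boxvol a b.
Proof. by apply: prodr_ge0 => k _; rewrite le_max lexx. Qed.

Lemma cvol_ge0 d (A : set 'rV[R]_d) : (0 <= cvol A)%E.
Proof.
apply: le_ereal_inf_tmp => _ [D [a [b [_ ->]]]].
by apply: esum_ge0 => n _; rewrite lee_fin boxvol_ge0.
Qed.

Lemma le_cvol d (A B : set 'rV[R]_d) : A `<=` B -> (cvol A <= cvol B)%E.
Proof.
move=> AB; apply: ereal_inf_le_tmp => _ [D [a [b [BD ->]]]].
by exists D, a, b; split => //; exact: subset_trans BD.
Qed.

(** [pickle] embeds any countable index type in the integers, so later covers can be indexed by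
    ordinals or pairs without renumbering. *)
Lemma cvol_le_cover d (I : countType) (D : set I) (a b : I -> 'rV[R]_d)
    (A : set 'rV[R]_d) : A `<=` \bigcup_(n in D) box (a n) (b n) ->
  (cvol A <= \esum_(n in D) (boxvol (a n) (b n))%:E)%E.
Proof.
move=> AD; apply: ereal_inf_lbound.
exists (pickle @` D), (fun n => oapp a 0 (unpickle n)),
  (fun n => oapp b 0 (unpickle n)); split.
  move=> x /AD[i Di xi]; exists (pickle i); first by exists i.
  by rewrite pickleK.
rewrite esum_image; last by move=> i j _ _; exact: (pcan_inj pickleK).
by apply: eq_esum => i _; rewrite pickleK.
Qed.

(** Near-optimal covers of the [A i], with slacks [e / 2 ^ (pickle i).+1] of total at most [e], are
    merged into one cover indexed by pairs. *)
Lemma cvol_bigcup d (I : countType) (D : set I) (A : I -> set 'rV[R]_d) :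
  (cvol (\bigcup_(i in D) A i) <= \esum_(i in D) cvol (A i))%E.
Proof.
have [[i Di ioo]|Aoo] := pselect (exists2 i, D i & cvol (A i) = +oo%E).
  apply: (@le_trans _ _ +oo%E); first exact: leey.
  rewrite -ioo; apply: esum_ge; exists [set i]; last by rewrite fsbig_set1.
  by split; [exact: finite_set1|move=> _ ->].
apply/lee_addgt0Pr => e e0.
have [f Pf] : {f : I -> set nat * (nat -> 'rV[R]_d) * (nat -> 'rV[R]_d) &
    forall i, D i -> A i `<=` \bigcup_(n in (f i).1.1) box ((f i).1.2 n) ((f i).2 n) /\
    (\esum_(n in (f i).1.1) (boxvol ((f i).1.2 n) ((f i).2 n))%:E <=
      cvol (A i) + (e / (2 ^ (pickle i).+1)%:R)%:E)%E}.
  apply: (@choice _ _ (fun i p => D i -> A i `<=` \bigcup_(n in p.1.1) box (p.1.2 n) (p.2 n) /\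
    (\esum_(n in p.1.1) (boxvol (p.1.2 n) (p.2 n))%:E <=
      cvol (A i) + (e / (2 ^ (pickle i).+1)%:R)%:E)%E)) => i.
  have [Di|nDi] := pselect (D i); last by exists (set0, fun=> 0, fun=> 0).
  have fi : cvol (A i) \is a fin_num.
    rewrite ge0_fin_numE ?cvol_ge0// ltey; apply/eqP => h; apply: Aoo; by exists i.
  have ei : 0 < e / (2 ^ (pickle i).+1)%:R by rewrite divr_gt0// ltr0n expn_gt0.
  have [_ [D' [a [b [AD ->]]]] /ltW lee] := lb_ereal_inf_adherent ei fi.
  by exists (D', a, b).
have cov : \bigcup_(i in D) A i `<=` \bigcup_(p in D `*`` (fun i => (f i).1.1))
    box ((f p.1).1.2 p.2) ((f p.1).2 p.2).
  move=> x [i Di Aix]; have [/(_ _ Aix)[n Dn xn] _] := Pf i Di.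
  by exists (i, n).
apply: le_trans (cvol_le_cover cov) _.
rewrite -(@esum_esum _ _ _ D (fun i => (f i).1.1)
   (fun i n => (boxvol ((f i).1.2 n) ((f i).2 n))%:E)); last first.
  by move=> i j _ _; rewrite lee_fin boxvol_ge0.
apply: le_trans (le_esum _) _; first by move=> i Di; exact: (Pf i Di).2.
rewrite esumD; last 2 first.
  by move=> i _; exact: cvol_ge0.
  by move=> i _; rewrite lee_fin divr_ge0// ltW.
apply: leeD2l.
pose F n : \bar R := (e / (2 ^ n.+1)%:R)%:E.
have F0 n : (0 <= F n)%E by rewrite lee_fin divr_ge0// ltW.
rewrite -(@esum_image _ _ _ D pickle F); last first.
  by move=> i j _ _; exact: (pcan_inj pickleK).
apply: (@le_trans _ _ (\esum_(n in setT) F n)%E).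
  rewrite esum_mkcond; apply: le_esum => n _.
  by case: ifP.
rewrite -nneseries_esumT//.
exact: (epsilon_trick0 xpredT (ltW e0)).
Qed.

Lemma esum_ord (n : nat) (f : 'I_n -> \bar R) : (forall i, 0 <= f i)%E ->
  (\esum_(i in setT) f i = \sum_(i < n) f i)%E.
Proof.
move=> f0; rewrite esum_fset//; last exact: finite_finset.
rewrite [RHS]fsbig_seq ?index_enum_uniq//; apply: eq_fsbigl.
by apply/seteqP; split => // i _; rewrite /= mem_index_enum.
Qed.

Lemma cvol_setU d (A B : set 'rV[R]_d) : (cvol (A `|` B) <= cvol A + cvol B)%E.
Proof.
pose F (i : 'I_2) := if i == 0 then A else B.
have -> : A `|` B = \bigcup_(i in setT) F i.
  apply/seteqP; split => [x [Ax|Bx]|x [i _]]; first by exists 0.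
    by exists 1.
  by rewrite /F; case: ifP => _ ?; [left|right].
apply: le_trans (cvol_bigcup _ _) _; rewrite esum_ord; last first.
  by move=> i; exact: cvol_ge0.
by rewrite big_ord_recl big_ord1.
Qed.

Lemma cvol_box_le d (a b : 'rV[R]_d) : (cvol (box a b) <= (boxvol a b)%:E)%E.
Proof.
have : box a b `<=` \bigcup_(n in [set: 'I_1]) box a b by move=> x ?; exists ord0.
move/(@cvol_le_cover d 'I_1 setT (fun=> a) (fun=> b)) => /le_trans; apply.
by rewrite esum_ord ?big_ord1// => _; rewrite lee_fin boxvol_ge0.
Qed.

Lemma cvol0 d : cvol (@set0 'rV[R]_d) = 0%E.
Proof.
apply/eqP; rewrite eq_le cvol_ge0 andbT.
have : @set0 'rV[R]_d `<=` \bigcup_(n in (@set0 nat)) box 0 0 by [].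
by move/(@cvol_le_cover d nat set0 (fun=> 0) (fun=> 0)); rewrite esum_set0.
Qed.

(** Indices outside [D] are filled with [box 0 0], whose volume is 0 because the dimension is
    positive. *)
Lemma volE d (A : set 'rV[R]_d.+1) : vol A = cvol A.
Proof.
apply/eqP; rewrite eq_le; apply/andP; split.
  apply: ereal_inf_le_tmp => _ [D [a [b [AD ->]]]].
  exists (fun n => if n \in D then a n else 0), (fun n => if n \in D then b n else 0).
  split; first by move=> x /AD[n Dn xn]; exists n => //; rewrite mem_set.
  rewrite nneseries_esumT; last by move=> n; rewrite lee_fin boxvol_ge0.
  rewrite [LHS]esum_mkcond; apply: eq_esum => n _; case: ifPn => // _.
  by rewrite /boxvol big_ord_recl mxE subrr maxxx mul0r.
apply: ereal_inf_le_tmp => _ [a [b [AD ->]]].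
exists setT, a, b; split => //.
by rewrite nneseries_esumT// => n; rewrite lee_fin boxvol_ge0.
Qed.

End cover_volume.

(** * Slices and cylinders for the outer volume *)

Section slices.
Context {R : realType}.

Lemma le_muleinf (c : R) (x : \bar R) (S : set (\bar R)) : 0 < c ->
  (forall s, S s -> (x <= c%:E * s)%E) -> (x <= c%:E * ereal_inf S)%E.
Proof.
move=> c0 xS; rewrite -lee_pdivrMl//; apply: le_ereal_inf_tmp => s Ss.
by rewrite lee_pdivrMl//; exact: xS.
Qed.

Lemma esum_natE (D : set nat) (f : nat -> \bar R) : (forall n, 0 <= f n)%E ->
  (\esum_(n in D) f n = \sum_(n <oo | n \in D) f n)%E.
Proof.
move=> f0; rewrite nneseries_esum//; congr (esum _ _).
by apply/seteqP; split => n /=; rewrite inE.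
Qed.

Lemma esum_natZl (D : set nat) (c : R) (f : nat -> R) :
  0 <= c -> (forall n, 0 <= f n) ->
  (\esum_(n in D) (c * f n)%:E = c%:E * \esum_(n in D) (f n)%:E)%E.
Proof.
move=> c0 f0; rewrite !esum_natE; last 2 first.
  by move=> n; rewrite lee_fin.
  by move=> n; rewrite lee_fin mulr_ge0.
rewrite -nneseriesZl; last by move=> n _; rewrite lee_fin.
by apply: eq_eseriesr => n _; rewrite EFinM.
Qed.

Definition consv d (t : R) (y : 'rV[R]_d) : 'rV[R]_d.+1 :=
  \row_k oapp (y ord0) t (unlift ord0 k).
Definition tailv d (x : 'rV[R]_d.+1) : 'rV[R]_d := \row_k x ord0 (lift ord0 k).

Lemma consv0 d t (y : 'rV[R]_d) : consv t y ord0 ord0 = t.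
Proof. by rewrite mxE unlift_none. Qed.

Lemma consvS d t (y : 'rV[R]_d) k : consv t y ord0 (lift ord0 k) = y ord0 k.
Proof. by rewrite mxE liftK. Qed.

Lemma tailvE d (x : 'rV[R]_d.+1) k : tailv x ord0 k = x ord0 (lift ord0 k).
Proof. by rewrite mxE. Qed.

Lemma tail_consv d t (y : 'rV[R]_d) : tailv (consv t y) = y.
Proof. by apply/rowP => k; rewrite tailvE consvS. Qed.

Lemma consv_head_tail d (x : 'rV[R]_d.+1) : consv (x ord0 ord0) (tailv x) = x.
Proof.
apply/rowP => k; case: (unliftP ord0 k) => [j ->|->]; last by rewrite consv0.
by rewrite consvS tailvE.
Qed.

Lemma box_head_tail d (a b x : 'rV[R]_d.+1) : box a b x <->
  a ord0 ord0 <= x ord0 ord0 <= b ord0 ord0 /\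
  box (tailv a) (tailv b) (tailv x).
Proof.
split=> [abx|[ab0 abx] k].
  by split => [|k]; [exact: abx|rewrite !tailvE; exact: abx].
case: (unliftP ord0 k) => [j ->|-> //].
by have := abx j; rewrite !tailvE.
Qed.

Lemma boxvol_head_tail d (a b : 'rV[R]_d.+1) : boxvol a b =
  Num.max 0 (b ord0 ord0 - a ord0 ord0) * boxvol (tailv a) (tailv b).
Proof.
by rewrite /boxvol big_ord_recl; congr (_ * _); apply: eq_bigr => k _; rewrite !tailvE.
Qed.

(* One inequality of Fubini's theorem, valid for arbitrary sets: slicing a
   cover by boxes covers the slices. *)
Lemma integral_slices_le_cvol d (A : set 'rV[R]_d.+1) (f : R -> \bar R) :
  measurable_fun setT f -> (forall t, (0 <= f t)%E) ->
  (forall t, (f t <= cvol [set y | A (consv t y)])%E) ->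
  (\int[lebesgue_measure]_t f t <= cvol A)%E.
Proof.
move=> mf f0 fA; apply: le_ereal_inf_tmp => _ [D [a [b [AD ->]]]].
pose I n : set R := `[a n ord0 ord0, b n ord0 ord0]%classic.
pose v n := if n \in D then boxvol (tailv (a n)) (tailv (b n)) else 0.
have v0 n : 0 <= v n by rewrite /v; case: ifP => // _; exact: boxvol_ge0.
pose h n t : \bar R := ((v n)%:E * (\1_(I n) t)%:E)%E.
have h0 n t : (0 <= h n t)%E by rewrite mule_ge0// lee_fin.
have mI n : measurable (I n) by exact: measurable_itv.
have m1 n : measurable_fun setT (fun t => (\1_(I n) t)%:E : \bar R).
  by apply/measurable_EFinP; exact: measurable_indic.
have mh n : measurable_fun setT (h n) by exact: measurable_funeM.
have fh t : (f t <= \sum_(n <oo) h n t)%E.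
  apply: le_trans (fA t) _.
  pose Dt := D `&` [set n | I n t].
  have cov : [set y | A (consv t y)] `<=`
      \bigcup_(n in Dt) box (tailv (a n)) (tailv (b n)).
    move=> y /AD[n Dn]; move/box_head_tail; rewrite consv0 tail_consv => -[It by_].
    by exists n => //; split => //; rewrite /= /I /= in_itv.
  apply: le_trans (cvol_le_cover cov) _.
  rewrite nneseries_esumT// esum_mkcond; apply: le_esum => n _.
  case: ifPn => [|_]; last exact: h0.
  by rewrite inE => -[Dn It]; rewrite /h /v indicE mem_set// mem_set// mule1.
have : (\int[lebesgue_measure]_t f t <=
    \int[lebesgue_measure]_t (\sum_(n <oo) h n t))%E.
  apply: ge0_le_integral => //.
  by apply: (@ge0_emeasurable_sum _ _ _ _ h xpredT).
move=> /le_trans; apply.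
rewrite integral_nneseries// esum_mkcond -nneseries_esumT; last first.
  by move=> n; case: ifP => // _; rewrite lee_fin boxvol_ge0.
apply: lee_nneseries => [n _ _|n _].
  by apply: integral_ge0 => t _; exact: h0.
rewrite /h ge0_integralZl//; last 2 first.
- exact: m1.
- by rewrite lee_fin.
rewrite integral_indic//; last exact: mI.
rewrite setIT boxvol_head_tail /v.
case: ifPn => _; last by rewrite mul0e.
rewrite muleC EFinM; apply: lee_pmul => //; first by rewrite lee_fin boxvol_ge0.
rewrite [leLHS](lebesgue_measure_itv `[a n ord0 ord0, b n ord0 ord0]) /= lte_fin.
by case: ifPn => ab; rewrite -?EFinD lee_fin le_max ?lexx ?orbT.
Qed.

Definition cylinder d (a b : R) (C : set 'rV[R]_d) : set 'rV[R]_d.+1 :=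
  [set x : 'rV[R]_d.+1 | a <= x ord0 ord0 <= b /\ C (tailv x)].

Lemma cvol_cylinder_le d (a b : R) (C : set 'rV[R]_d) : a < b ->
  (cvol (cylinder a b C) <= (b - a)%:E * cvol C)%E.
Proof.
move=> ab; apply: le_muleinf; first by rewrite subr_gt0.
move=> _ [D [a' [b' [CD ->]]]].
rewrite -esum_natZl ?subr_ge0 ?(ltW ab)//; last by move=> n; exact: boxvol_ge0.
have cov : cylinder a b C `<=` \bigcup_(n in D) box (consv a (a' n)) (consv b (b' n)).
  move=> x [ax /CD[n Dn xn]]; exists n => //.
  by apply/box_head_tail; rewrite !consv0 !tail_consv.
apply: le_trans (cvol_le_cover cov) _; apply: le_esum => n _.
rewrite boxvol_head_tail !consv0 !tail_consv lee_fin.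
by rewrite max_r// subr_ge0 ltW.
Qed.

(** An infimum over covers by boxes inherits any bound that holds box by box; elementary matrices
    and translations are handled through this reduction. *)
Lemma cvol_image_le d d' (f : 'rV[R]_d -> 'rV[R]_d') (c : R) : 0 < c ->
  (forall a b, (cvol (f @` box a b) <= c%:E * (boxvol a b)%:E)%E) ->
  forall S, (cvol (f @` S) <= c%:E * cvol S)%E.
Proof.
move=> c0 fbox S; apply: le_muleinf => // _ [D [a [b [SD ->]]]].
rewrite -esum_natZl ?(ltW c0)//; last by move=> n; exact: boxvol_ge0.
have : f @` S `<=` \bigcup_(n in D) (f @` box (a n) (b n)).
  by move=> _ [x /SD[n Dn xn] <-]; exists n => //; exists x.
move/le_cvol/le_trans; apply.
apply: le_trans (cvol_bigcup _ _) _; apply: le_esum => n _.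
by rewrite EFinM.
Qed.

End slices.

(** * Volume under elementary matrices *)

Section linear_maps.
Context {R : realType}.

Lemma grid_cell (N : nat) (a b t : R) : a <= t <= b ->
  exists m : 'I_N.+1, a + m%:R * ((b - a) / N.+1%:R) <= t
                      <= a + m.+1%:R * ((b - a) / N.+1%:R).
Proof.
move=> /andP[at_ tb]; set h := (b - a) / _.
suff H k : (k <= N)%N -> t <= a + k.+1%:R * h ->
    exists m : 'I_N.+1, a + m%:R * h <= t <= a + m.+1%:R * h.
  apply: (H N) => //; rewrite /h mulrC -mulrA mulVf ?mulr1 ?pnatr_eq0//.
  by rewrite addrC subrK.
elim: k => [|k IH] kN tk.
  by exists ord0; rewrite mul0r addr0 at_.
have [tk'|/ltW tk'] := lerP t (a + k.+1%:R * h); first exact: (IH (ltnW kN)).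
by exists (@Ordinal N.+1 k.+1 kN); rewrite /= tk' tk.
Qed.

Lemma lee_addinvnP (x y : \bar R) (C : R) : 0 <= C ->
  (forall N : nat, (x <= y + (C / N.+1%:R)%:E)%E) -> (x <= y)%E.
Proof.
move=> C0 xy; apply/lee_addgt0Pr => e e0.
pose N := Num.truncn (C / e).
apply: le_trans (xy N) _; apply: leeD2l; rewrite lee_fin.
rewrite ler_pdivrMr ?ltr0n// mulrC -ler_pdivrMr//.
by apply: ltW; rewrite truncnS_gt// divr_ge0// ltW.
Qed.

(** A transvection for [i != j], the scaling of coordinate [i] by [1 + c] for [i = j]; vectors being
    rows, it acts from the right. *)
Definition elem_mx d (i j : 'I_d) (c : R) : 'M[R]_d := 1%:M + c *: delta_mx i j.

Lemma mul_elem_mx d (i j : 'I_d) c (x : 'rV[R]_d) k :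
  (x *m elem_mx i j c) ord0 k = x ord0 k + c * x ord0 i *+ (k == j).
Proof.
rewrite mulmxDr mulmx1 -scalemxAr !mxE (bigD1 i)//= big1 => [|l li].
  rewrite !mxE eqxx /= addr0; congr (_ + _).
  by case: (k == j); rewrite ?mulr1 ?mulr0 ?mulr1n ?mulr0n.
by rewrite !mxE (negbTE li) mulr0.
Qed.

Lemma det_elem_mx d (i j : 'I_d) c : \det (elem_mx i j c) = 1 + c *+ (i == j).
Proof.
suff H (i' j' : 'I_d) : (j' <= i')%N ->
    \det (elem_mx i' j' c) = 1 + c *+ (i' == j').
  case: (leqP j i) => [/H//|/ltnW/H]; rewrite eq_sym => <-.
  rewrite -det_tr; congr (\det _).
  by rewrite /elem_mx linearD /= linearZ /= trmx1 trmx_delta.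
move=> ji; rewrite det_trig; last first.
  apply/is_trig_mxP => k l kl; rewrite !mxE (_ : k == l = false); last first.
    by apply/negbTE; rewrite neq_ltn kl.
  rewrite add0r; case: eqP => [ki|_]; last by rewrite mulr0.
  case: eqP => [lj|_]; last by rewrite mulr0.
  by move: kl; rewrite lj ki => /leq_trans/(_ ji); rewrite ltnn.
rewrite (bigD1 i')//= big1 => [|k ki]; last by rewrite !mxE eqxx (negbTE ki) mulr0 addr0.
by rewrite !mxE !eqxx mulr1 /=; case: eqP => _; rewrite ?mulr1 ?mulr0.
Qed.

Lemma cvol_scale_box_le d (i : 'I_d) (c : R) (a b : 'rV[R]_d) : 1 + c != 0 ->
  (cvol ((fun x => x *m elem_mx i i c) @` box a b) <= `|1 + c|%:E * (boxvol a b)%:E)%E.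
Proof.
move=> c0; set s := 1 + c.
pose a' : 'rV[R]_d := \row_k if k == i then s * (if 0 <= s then a ord0 i else b ord0 i) else a ord0 k.
pose b' : 'rV[R]_d := \row_k if k == i then s * (if 0 <= s then b ord0 i else a ord0 i) else b ord0 k.
have sub : (fun x => x *m elem_mx i i c) @` box a b `<=` box a' b'.
  move=> _ [x abx <-] k; rewrite mul_elem_mx !mxE.
  case: eqP => [->|_]; last by rewrite addr0; exact: abx.
  have -> : x ord0 i + c * x ord0 i *+ true = s * x ord0 i by rewrite /s mulrDl mul1r.
  case: (lerP 0 s) => [s0|s0]; first by rewrite !ler_wpM2l//; case/andP: (abx i).
  by rewrite !ler_wnM2l ?(ltW s0)//; case/andP: (abx i).
apply: le_trans (le_cvol sub) _; apply: le_trans (cvol_box_le _ _) _.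
rewrite -EFinM lee_fin /boxvol (bigD1 i)//= [in leRHS](bigD1 i)//= !mxE eqxx mulrA.
rewrite (eq_bigr (fun k => Num.max 0 (b ord0 k - a ord0 k))); last first.
  by move=> k ki; rewrite !mxE (negbTE ki).
rewrite ler_wpM2r//; first by apply: prodr_ge0 => k _; rewrite le_max lexx.
case: (lerP 0 s) => s0; rewrite -mulrBr ge_max mulr_ge0 ?le_max ?lexx//=.
  by rewrite ger0_norm// ler_wpM2l// le_max lexx orbT.
rewrite ltr0_norm// -(opprB (b _ _)) mulrN -mulNr.
by rewrite ler_wpM2l ?oppr_ge0 ?(ltW s0)// le_max lexx orbT.
Qed.

(** The box is cut into [N.+1] slabs of thickness [h] along coordinate [i]. On one slab the shift of
    coordinate [j] varies by at most [|c| * h], so the sheared slab fits in a box lengthened by that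
    amount at both ends. *)
Lemma cvol_shear_box_le d (i j : 'I_d) (c : R) (a b : 'rV[R]_d) : i != j ->
  (cvol ((fun x => x *m elem_mx i j c) @` box a b) <= (boxvol a b)%:E)%E.
Proof.
(* An empty box is treated apart, since its edges [b - a] may be negative. *)
move=> ij; have [[x0 x0ab]|abN] := pselect (exists x, box a b x); last first.
  rewrite (_ : _ @` _ = set0) ?cvol0 ?lee_fin ?boxvol_ge0//.
  by apply/seteqP; split => // y [x abx _]; case: abN; exists x.
have wge0 k : 0 <= b ord0 k - a ord0 k.
  by rewrite subr_ge0; have /andP[] := x0ab k; exact: le_trans.
set w := b ord0 i - a ord0 i.
have w0 : 0 <= w by exact: wge0.
pose K := \prod_(k < d | (k != i) && (k != j)) Num.max 0 (b ord0 k - a ord0 k).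
have K0 : 0 <= K by apply: prodr_ge0 => k _; rewrite le_max lexx.
have volE : boxvol a b = w * ((b ord0 j - a ord0 j) * K).
  by rewrite /boxvol (bigD1 i)//= (bigD1 j) 1?eq_sym//= !max_r.
(* The excess of the [N.+1] slabs is [w * (2 * |c| * h) * K] in total, and [h = w / N.+1]. *)
apply: (@lee_addinvnP _ _ (2 * `|c| * w * w * K)).
  by rewrite !mulr_ge0.
move=> N; set h := w / N.+1%:R.
have h0 : 0 <= h by rewrite divr_ge0.
pose lo (m : 'I_N.+1) := a ord0 i + m%:R * h.
pose a' (m : 'I_N.+1) : 'rV[R]_d := \row_k if k == i then lo m else
  if k == j then a ord0 j + c * lo m - `|c| * h else a ord0 k.
pose b' (m : 'I_N.+1) : 'rV[R]_d := \row_k if k == i then lo m + h else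
  if k == j then b ord0 j + c * lo m + `|c| * h else b ord0 k.
have cov : (fun x => x *m elem_mx i j c) @` box a b `<=`
    \bigcup_(m in setT) box (a' m) (b' m).
  move=> _ [x abx <-]; have [m /andP[m1 m2]] := grid_cell N (abx i).
  rewrite -/w -/h -/(lo m) in m1 m2.
  have {}m2 : x ord0 i <= lo m + h by apply: le_trans m2 _; rewrite /lo -natr1 mulrDl mul1r addrA.
  exists m => // k; rewrite mul_elem_mx !mxE.
  case: (eqVneq k i) => [->|ki]; first by rewrite (negbTE ij) addr0 m1 m2.
  case: (eqVneq k j) => [->|kj]; last by rewrite addr0; exact: abx.
  rewrite mulr1n; have /andP[aj bj] := abx j.
  have : `|c * (x ord0 i - lo m)| <= `|c| * h.
    by rewrite normrM ler_wpM2l// ger0_norm; lra.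
  rewrite ler_norml mulrBr => /andP[h1 h2]; apply/andP; split; lra.
apply: le_trans (cvol_le_cover cov) _.
rewrite esum_ord; last by move=> m; rewrite lee_fin boxvol_ge0.
rewrite (eq_bigr (fun=> (h * ((b ord0 j - a ord0 j + 2 * `|c| * h) * K))%:E)); last first.
  move=> m _; congr (_%:E).
  rewrite /boxvol (bigD1 i)//= (bigD1 j) 1?eq_sym//= !mxE !eqxx eq_sym (negbTE ij).
  congr (_ * (_ * _)).
  - by rewrite addrC addKr max_r.
  - rewrite (_ : _ - _ = b ord0 j - a ord0 j + 2 * `|c| * h); last by ring.
    by rewrite max_r// addr_ge0// !mulr_ge0.
  - by apply: eq_bigr => k /andP[ki kj]; rewrite !mxE (negbTE ki) (negbTE kj).
rewrite sumEFin sumr_const card_ord -EFinD lee_fin volE /h -[leLHS]mulr_natl.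
have n0 : N.+1%:R != 0 :> R by rewrite pnatr_eq0.
by rewrite le_eqVlt; apply/orP; left; apply/eqP; field; rewrite addrC natr1.
Qed.

Lemma cvol_elem_mx_le d (i j : 'I_d) (c : R) (S : set 'rV[R]_d) :
  \det (elem_mx i j c) != 0 ->
  (cvol ((fun x => x *m elem_mx i j c) @` S) <= `|\det (elem_mx i j c)|%:E * cvol S)%E.
Proof.
move=> det0; apply: cvol_image_le; first by rewrite normr_gt0.
move=> a b; move: det0; rewrite det_elem_mx; case: (eqVneq i j) => [<-|ij] det0.
  exact: cvol_scale_box_le.
by rewrite addr0 normr1 mul1e; exact: cvol_shear_box_le.
Qed.

End linear_maps.

(** * Elementary matrices generate the invertible ones; the determinant formula *)

Section unitmx_generation.
Context {R : realType}.

(** Gaussian elimination by induction on the dimension. [PU], [PL], [Pa] and [PD] provide the block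
    factors of a matrix with nonzero corner entry; a zero corner is first repaired by a row
    operation. *)
Lemma unitmx_elem_ind d (P : 'M[R]_d -> Prop) :
  P 1%:M -> (forall A B, P A -> P B -> P (A *m B)) ->
  (forall i j c, \det (elem_mx i j c) != 0 -> P (elem_mx i j c)) ->
  forall A, A \in unitmx -> P A.
Proof.
elim: d P => [|d IH].
  by move=> P P1 _ _ A _; rewrite (_ : A = 1%:M)//; apply/matrixP => -[].
change d.+1 with (1 + d)%N => P P1 PM Pe A uA.
have PU (b : 'rV[R]_d) : P (block_mx (1%:M : 'M[R]_1) b 0 (1%:M : 'M[R]_d)).
  rewrite [b]row_sum_delta.
  apply: (big_ind (fun b => P (block_mx (1%:M : 'M[R]_1) b 0 (1%:M : 'M[R]_d)))).
  - by rewrite -scalar_mx_block.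
  - move=> b1 b2 Pb1 Pb2; have := PM _ _ Pb2 Pb1.
    by rewrite (@mulmx_block _ 1 d 1 d 1 d) !mulmx0 !mul0mx !mul1mx !mulmx1 !addr0 !add0r.
  - move=> k _; have := Pe (@lshift 1 d ord0) (@rshift 1 d k) (b ord0 k).
    rewrite det_elem_mx eq_lrshift addr0 oner_eq0 => /(_ isT).
    rewrite (_ : elem_mx _ _ _ = block_mx 1%:M (b ord0 k *: delta_mx 0 k) 0 1%:M)//.
    rewrite /elem_mx (@scalar_mx_block _ 1 d).
    rewrite (_ : delta_mx _ _ = block_mx (0 : 'M[R]_1) (delta_mx 0 k) 0 (0 : 'M[R]_d)).
      by rewrite scale_block_mx add_block_mx !scaler0 !addr0 add0r.
    apply/matrixP => x y; rewrite !mxE.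
    case: splitP => x' xx'; rewrite !mxE; case: splitP => y' yy'; rewrite !mxE -?val_eqE /= ?xx' ?yy';
      by rewrite ?ord1 /= ?add1n ?eqSS ?andbF.
have PL (b : 'cV[R]_d) : P (block_mx (1%:M : 'M[R]_1) 0 b (1%:M : 'M[R]_d)).
  have -> : b = (\sum_k b k ord0 *: delta_mx k 0).
    apply/colP => k; rewrite summxE (bigD1 k)//= big1 => [|l lk]; rewrite !mxE ?eqxx ?mulr1 ?addr0//.
    by rewrite eq_sym (negbTE lk) mulr0.
  apply: (big_ind (fun b => P (block_mx (1%:M : 'M[R]_1) 0 b (1%:M : 'M[R]_d)))).
  - by rewrite -scalar_mx_block.
  - move=> b1 b2 Pb1 Pb2; have := PM _ _ Pb1 Pb2.
    by rewrite (@mulmx_block _ 1 d 1 d 1 d) !mulmx0 !mul0mx !mul1mx !mulmx1 !addr0 !add0r.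
  - move=> k _; have := Pe (@rshift 1 d k) (@lshift 1 d ord0) (b k ord0).
    rewrite det_elem_mx eq_rlshift addr0 oner_eq0 => /(_ isT).
    rewrite (_ : elem_mx _ _ _ = block_mx 1%:M 0 (b k ord0 *: delta_mx k 0) 1%:M)//.
    rewrite /elem_mx (@scalar_mx_block _ 1 d).
    rewrite (_ : delta_mx _ _ = block_mx (0 : 'M[R]_1) 0 (delta_mx k 0) (0 : 'M[R]_d)).
      by rewrite scale_block_mx add_block_mx !scaler0 !addr0 add0r.
    apply/matrixP => x y; rewrite !mxE.
    case: splitP => x' xx'; rewrite !mxE; case: splitP => y' yy'; rewrite !mxE -?val_eqE /= ?xx' ?yy';
      by rewrite ?ord1 /= ?add1n ?eqSS ?andbF.
have Pa (a : R) : a != 0 -> P (block_mx (a%:M : 'M[R]_1) 0 0 (1%:M : 'M[R]_d)).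
  move=> a0; have := Pe (@lshift 1 d ord0) (@lshift 1 d ord0) (a - 1).
  rewrite det_elem_mx eqxx addrC subrK => /(_ a0).
  rewrite (_ : elem_mx _ _ _ = block_mx a%:M 0 0 1%:M)//.
  rewrite /elem_mx (@scalar_mx_block _ 1 d).
  rewrite (_ : delta_mx _ _ = block_mx (1%:M : 'M[R]_1) 0 0 (0 : 'M[R]_d)).
    rewrite scale_block_mx add_block_mx !scaler0 !addr0.
    by rewrite scalemx1 -raddfD addrC subrK.
  apply/matrixP => x y; rewrite !mxE.
  case: splitP => x' xx'; rewrite !mxE; case: splitP => y' yy'; rewrite !mxE -?val_eqE /= ?xx' ?yy';
    by rewrite ?ord1 /= ?add1n ?eqSS ?andbF.
have PD (D : 'M[R]_d) : D \in unitmx -> P (block_mx (1%:M : 'M[R]_1) 0 0 D).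
  apply: (IH (fun D => P (block_mx (1%:M : 'M[R]_1) 0 0 D))) => [|A1 B1 PA1 PB1|i j c].
  - by rewrite -scalar_mx_block.
  - have := PM _ _ PA1 PB1.
    by rewrite (@mulmx_block _ 1 d 1 d 1 d) !mulmx0 !mul0mx !mul1mx !addr0 !add0r.
  - rewrite det_elem_mx => ijc; have := Pe (@rshift 1 d i) (@rshift 1 d j) c.
    rewrite det_elem_mx eq_rshift => /(_ ijc).
    rewrite (_ : elem_mx (@rshift 1 d i) _ _ = block_mx 1%:M 0 0 (elem_mx i j c))//.
    rewrite /elem_mx (@scalar_mx_block _ 1 d).
    rewrite (_ : delta_mx (@rshift 1 d i) _ = block_mx (0 : 'M[R]_1) 0 0 (delta_mx i j : 'M[R]_d)).
      by rewrite scale_block_mx add_block_mx !scaler0 !addr0.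
    apply/matrixP => x y; rewrite !mxE.
    case: splitP => x' xx'; rewrite !mxE; case: splitP => y' yy'; rewrite !mxE -?val_eqE /= ?xx' ?yy';
      by rewrite ?ord1 /= ?add1n ?eqSS ?andbF.
have Pnz (B : 'M[R]_(1 + d)) : B \in unitmx -> B ord0 ord0 != 0 -> P B.
  move=> uB b0; set a := B ord0 ord0.
  rewrite -(submxK B); set b := ursubmx B; set c := dlsubmx B; set D := drsubmx B.
  have -> : ulsubmx B = a%:M.
    apply/matrixP => i j; rewrite !ord1 !mxE eqxx mulr1n.
    by congr (B _ _); apply/val_inj.
  (* Block LDU factorisation. Its last block is the Schur complement of the corner, invertible
     because [\det B] is [a] times its determinant. *)
  have BE : block_mx a%:M b c D =
      block_mx 1%:M 0 (a^-1 *: c) 1%:M *m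
      (block_mx a%:M 0 0 1%:M *m block_mx 1%:M 0 0 (D - a^-1 *: (c *m b))) *m
      block_mx 1%:M (a^-1 *: b) 0 1%:M.
    rewrite !(@mulmx_block _ 1 d 1 d 1 d) !mulmx0 !mul0mx !mul1mx !mulmx1 !addr0 !add0r.
    rewrite !mul_scalar_mx !mul_mx_scalar !scalerA mulfV// !scale1r.
    by rewrite mulmx0 add0r -scalemxAr addrC subrK.
  have uD : (D - a^-1 *: (c *m b)) \in unitmx.
    move: uB; rewrite -(submxK B) -/b -/c -/D.
    rewrite unitmxE.
    have -> : ulsubmx B = a%:M.
      apply/matrixP => i j; rewrite !ord1 !mxE eqxx mulr1n.
      by congr (B _ _); apply/val_inj.
    rewrite BE !det_mulmx !det_lblock !det_ublock !det1 !mul1r !mulr1 det_scalar1.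
    by rewrite unitrM => /andP[_]; rewrite -unitmxE.
  rewrite BE; apply: (PM _ _ _ (PU _)); apply: (PM _ _ (PL _)).
  by apply: PM; [exact: Pa|exact: PD].
have [a0|a0] := eqVneq (A ord0 ord0) 0; last exact: Pnz.
have [i Ai] : exists i, A i ord0 != 0.
  apply/existsP; apply: contraT; rewrite negb_exists => /forallP A0.
  have : A *m delta_mx ord0 (ord0 : 'I_1) = 0.
    rewrite -colE; apply/colP => i; rewrite !mxE.
    by have := A0 i; rewrite negbK => /eqP.
  move/(congr1 (mulmx (invmx A))); rewrite mulmxA mulVmx// mul1mx mulmx0.
  by move/matrixP/(_ ord0 ord0); rewrite !mxE !eqxx => /eqP; rewrite oner_eq0.
have i0 : ord0 != i by apply: contraNneq Ai => <-; rewrite a0.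
have Ei (c : R) : elem_mx ord0 i c \in unitmx by rewrite unitmxE det_elem_mx (negbTE i0) addr0 unitr1.
(* Adding row [i] to the first row turns the zero corner into [A i ord0], which is nonzero. *)
have -> : A = elem_mx ord0 i (-1) *m (elem_mx ord0 i 1 *m A).
  rewrite mulmxA (_ : _ *m _ = 1%:M) ?mul1mx//.
  rewrite /elem_mx scale1r scaleN1r mulmxBl mul1mx mulmxDr mulmx1.
  by rewrite mul_delta_mx_0 1?eq_sym// addr0 addrK.
apply: PM; first by apply: Pe; rewrite det_elem_mx (negbTE i0) addr0 oner_eq0.
apply: Pnz; first by rewrite unitmx_mul Ei.
rewrite /elem_mx mulmxDl mul1mx -scalemxAl scale1r mxE a0 add0r.
by rewrite mxE (bigD1 i)//= big1 => [|k ki]; rewrite !mxE ?eqxx ?mul1r ?addr0// (negbTE ki) mul0r.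
Qed.

Lemma cvol_mulmx_le d (A : 'M[R]_d) : A \in unitmx -> forall S : set 'rV[R]_d,
  (cvol ((fun x => x *m A) @` S) <= `|\det A|%:E * cvol S)%E.
Proof.
move: A; apply: unitmx_elem_ind => [S|A B PA PB S|i j c det0 S].
- rewrite det1 normr1 mul1e; apply: le_cvol => _ [x Sx <-].
  by rewrite mulmx1.
- have -> : (fun x => x *m (A *m B)) @` S =
      (fun x => x *m B) @` ((fun x => x *m A) @` S).
    rewrite image_comp; apply: eq_imagel => x _; exact: mulmxA.
  apply: le_trans (PB _) _; rewrite det_mulmx mulrC normrM EFinM -muleA.
  exact: lee_wpmul2l.
- exact: cvol_elem_mx_le.
Qed.

(** The reverse inequality is the same bound for [invmx A], applied to the image of [S]. *)
Lemma cvol_mulmx d (A : 'M[R]_d) (S : set 'rV[R]_d) : A \in unitmx ->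
  cvol ((fun x => x *m A) @` S) = (`|\det A|%:E * cvol S)%E.
Proof.
move=> uA; apply/eqP; rewrite eq_le cvol_mulmx_le//=.
have dA : 0 < `|\det A| by rewrite normr_gt0 -unitfE -unitmxE.
rewrite -lee_pdivlMl//; have uA' : invmx A \in unitmx by rewrite unitmx_inv.
have := cvol_mulmx_le uA' ((fun x => x *m A) @` S).
rewrite image_comp (_ : _ \o _ = id).
  by rewrite image_id det_inv normrV// -unitmxE.
by apply/funext => x /=; rewrite mulmxK.
Qed.

Lemma cvol_translate d (v : 'rV[R]_d) (S : set 'rV[R]_d) :
  cvol ((fun x => x + v) @` S) = cvol S.
Proof.
have H (u : 'rV[R]_d) S' : (cvol ((fun x => x + u)%R @` S') <= cvol S')%E.
  rewrite -[leRHS]mul1e; apply: cvol_image_le => // a b; rewrite mul1e.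
  apply: le_trans (le_cvol _) (le_trans (cvol_box_le (a + u) (b + u)) _).
    by move=> _ [x abx <-] k; rewrite !mxE !lerD2r; exact: abx.
  rewrite lee_fin le_eqVlt; apply/orP; left; apply/eqP; apply: eq_bigr => k _.
  by rewrite !mxE; congr Num.max; ring.
apply/eqP; rewrite eq_le H /=.
have := H (- v) ((fun x => x + v) @` S).
rewrite image_comp (_ : _ \o _ = id) ?image_id//.
by apply/funext => x /=; rewrite addrK.
Qed.

End unitmx_generation.

(** * Euclidean norm, Cholesky factors and reflections *)

Section factorization.
Context {R : realType}.

Lemma dotvE d (u x : 'rV[R]_d) : dotv u x = (u *m x^T) ord0 ord0.
Proof. by rewrite mxE; apply: eq_bigr => k _; rewrite mxE. Qed.

Lemma dotv_mulmx d (u x : 'rV[R]_d) (A : 'M[R]_d) :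
  dotv (u *m A) x = dotv u (x *m A^T).
Proof. by rewrite !dotvE trmx_mul trmxK mulmxA. Qed.

Lemma dotvC d (u x : 'rV[R]_d) : dotv u x = dotv x u.
Proof. by apply: eq_bigr => k _; rewrite mulrC. Qed.

Lemma dotvDl d (u v x : 'rV[R]_d) : dotv (u + v) x = dotv u x + dotv v x.
Proof. by rewrite !dotvE mulmxDl mxE. Qed.

Lemma dotvDr d (u v x : 'rV[R]_d) : dotv x (u + v) = dotv x u + dotv x v.
Proof. by rewrite !(dotvC x) dotvDl. Qed.

Lemma dotvZl d c (u x : 'rV[R]_d) : dotv (c *: u) x = c * dotv u x.
Proof. by rewrite !dotvE -scalemxAl mxE. Qed.

Lemma dotvZr d c (u x : 'rV[R]_d) : dotv x (c *: u) = c * dotv x u.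
Proof. by rewrite !(dotvC x) dotvZl. Qed.

Lemma dotvNl d (u x : 'rV[R]_d) : dotv (- u) x = - dotv u x.
Proof. by rewrite -scaleN1r dotvZl mulN1r. Qed.

Lemma dotvNr d (u x : 'rV[R]_d) : dotv x (- u) = - dotv x u.
Proof. by rewrite !(dotvC x) dotvNl. Qed.

Lemma dotvv_ge0 d (x : 'rV[R]_d) : 0 <= dotv x x.
Proof. by apply: sumr_ge0 => k _; rewrite -expr2 sqr_ge0. Qed.

Lemma dotvv_eq0 d (x : 'rV[R]_d) : (dotv x x == 0) = (x == 0).
Proof.
apply/idP/eqP => [|->]; last by rewrite /dotv big1// => k _; rewrite mxE mul0r.
rewrite psumr_eq0 => [/allP x0|k _]; last by rewrite -expr2 sqr_ge0.
apply/rowP => k; rewrite mxE; have := x0 k; rewrite mem_index_enum => /(_ isT).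
by rewrite mulf_eq0 orbb => /eqP.
Qed.

Definition nrm d (x : 'rV[R]_d) : R := Num.sqrt (dotv x x).

Lemma nrm_ge0 d (x : 'rV[R]_d) : 0 <= nrm x. Proof. exact: sqrtr_ge0. Qed.

Lemma nrm_sqr d (x : 'rV[R]_d) : nrm x ^+ 2 = dotv x x.
Proof. by rewrite sqr_sqrtr// dotvv_ge0. Qed.

Lemma nrmZ d c (x : 'rV[R]_d) : nrm (c *: x) = `|c| * nrm x.
Proof. by rewrite /nrm dotvZl dotvZr mulrA -expr2 sqrtrM ?sqr_ge0// sqrtr_sqr. Qed.

Lemma nrm_eq0 d (x : 'rV[R]_d) : (nrm x == 0) = (x == 0).
Proof. by rewrite sqrtr_eq0 -dotvv_eq0 eq_le dotvv_ge0 andbT. Qed.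

Lemma dotv_cauchy_schwarz d (x y : 'rV[R]_d) : `|dotv x y| <= nrm x * nrm y.
Proof.
rewrite -sqrtrM ?dotvv_ge0// -sqrtr_sqr ler_wsqrtr//.
have [->|y0] := eqVneq y 0.
  by rewrite dotvC -[0]/(0%R : 'rV[R]_d) -(scale0r 0) !dotvZl !mul0r expr0n mulr0.
have yy : 0 < dotv y y by rewrite lt_def dotvv_eq0 y0 dotvv_ge0.
have := dotvv_ge0 (dotv y y *: x - dotv x y *: y).
rewrite !dotvDl !dotvDr !dotvNl !dotvNr !dotvZl !dotvZr (dotvC y x).
rewrite (_ : _ + _ = dotv y y * (dotv x x * dotv y y - dotv x y ^+ 2)); last by ring.
by rewrite pmulr_rge0// subr_ge0.
Qed.

Lemma nrmD d (x y : 'rV[R]_d) : nrm (x + y) <= nrm x + nrm y.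
Proof.
rewrite -(@ler_pXn2r _ 2)// ?nnegrE ?addr_ge0 ?nrm_ge0//.
rewrite sqrrD !nrm_sqr dotvDl !dotvDr (dotvC y x).
have := le_trans (ler_norm _) (dotv_cauchy_schwarz x y); lra.
Qed.

Lemma qform_gram d (L : 'M[R]_d) (v : 'rV[R]_d) :
  qform (L *m L^T) v = dotv (v *m L) (v *m L).
Proof. by rewrite dotvE trmx_mul /qform !mulmxA. Qed.

(** The Schur complement [C'] of the corner entry is again positive definite, and its factor is the
    lower right block of [L]. *)
Lemma cholesky d (S : 'M[R]_d) : posdef S ->
  exists2 L : 'M[R]_d, L \in unitmx & S = L^T *m L.
Proof.
elim: d S => [|d IH].
  by move=> S _; exists 1%:M; [exact: unitmx1|apply/matrixP => -[]].
change d.+1 with (1 + d)%N => S [Ssym Spos].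
set a := S ord0 ord0; set b := ursubmx S; set C := drsubmx S.
have Sul : ulsubmx S = a%:M.
  apply/matrixP => i j; rewrite !ord1 !mxE eqxx mulr1n.
  by congr (S _ _); apply/val_inj.
have Sdl : dlsubmx S = b^T by rewrite /b trmx_ursub Ssym.
have CT : C^T = C by rewrite /C trmx_drsub Ssym.
have SE : S = block_mx a%:M b b^T C by rewrite -[LHS]submxK Sul Sdl.
have qS (x : 'rV[R]_1) (v : 'rV[R]_d) : qform S (row_mx x v) =
    (x *m a%:M *m x^T + v *m b^T *m x^T + (x *m b *m v^T + v *m C *m v^T)) ord0 ord0.
  rewrite /qform SE tr_row_mx (@mul_row_block _ 1 1 d 1 d) mul_row_col.
  by rewrite !mulmxDl.
have a0 : 0 < a.
  have /Spos : row_mx (1%:M : 'M[R]_1) (0 : 'rV[R]_d) != 0.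
    apply: contraTneq isT => /matrixP/(_ ord0 (lshift d ord0)).
    by rewrite row_mxEl !mxE eqxx => /eqP; rewrite oner_eq0.
  by rewrite qS !mul0mx !trmx0 !mulmx0 !addr0 trmx1 mulmx1 mul1mx mxE eqxx mulr1n.
pose C' := C - a^-1 *: (b^T *m b).
have [L uL LE] : exists2 L : 'M[R]_d, L \in unitmx & C' = L^T *m L.
  apply: IH; split.
    by rewrite /C' linearB /= linearZ /= trmx_mul trmxK CT.
  move=> v v0.
  (* For fixed [v] this first coordinate minimises the quadratic form of [S], and the minimum is
     [qform C' v]. *)
  have /Spos : row_mx (- a^-1 *: (v *m b^T)) v != 0.
    apply: contraNneq v0 => /eqP; rewrite -row_mx0 => /eqP/eq_row_mx[_ ->].
    by rewrite eqxx.
  congr (_ < _); rewrite qS /qform; congr ((_ : 'M[R]_1) ord0 ord0).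
  rewrite [in RHS]/C' mulmxBr mulmxBl -scalemxAr -scalemxAl mulmxA -!mulmxA.
  set s := b *m v^T; rewrite !mulmxA.
  have sE : (v *m b^T)^T = s by rewrite trmx_mul trmxK.
  rewrite linearZ /= sE -!scalemxAl -!scalemxAr mul_mx_scalar -!scalemxAl !scalerA.
  rewrite mulrA mulrNN -mulrA mulVf ?gt_eqF// mulr1.
  by rewrite scaleNr subrr add0r addrC scaleNr.
have sa : Num.sqrt a * Num.sqrt a = a by rewrite -expr2 sqr_sqrtr// ltW.
have sa0 : Num.sqrt a != 0 by rewrite gt_eqF// sqrtr_gt0.
exists (block_mx (Num.sqrt a)%:M ((Num.sqrt a)^-1 *: b) 0 L).
  rewrite unitmxE det_ublock det_scalar1 unitrM unitfE sa0 /=.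
  by rewrite -unitmxE.
rewrite SE (@tr_block_mx _ 1 d 1 d) (@mulmx_block _ 1 d 1 d 1 d) trmx0 !mul0mx !mulmx0 !addr0.
rewrite tr_scalar_mx -scalar_mxM sa mul_scalar_mx scalerA mulfV// scale1r.
rewrite linearZ /= mul_mx_scalar scalerA mulfV// scale1r.
rewrite -scalemxAl -scalemxAr scalerA -invfM sa -LE /C'.
by rewrite addrC subrK.
Qed.

Lemma det_posdef_gt0 d (S : 'M[R]_d) : posdef S -> 0 < \det S.
Proof.
move=> /cholesky[L uL ->]; rewrite det_mulmx det_tr -expr2 lt_def sqr_ge0 andbT.
by rewrite sqrf_eq0 -unitfE -unitmxE.
Qed.

Lemma mahal_factor d (L : 'M[R]_d) (x mu : 'rV[R]_d) : L \in unitmx ->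
  mahal (L^T *m L) x mu = nrm ((x - mu) *m invmx L).
Proof.
move=> uL; rewrite /mahal /nrm -qform_gram; congr (Num.sqrt (qform _ _)).
have uLT : L^T \in unitmx by rewrite unitmx_tr.
rewrite trmx_inv; set B := invmx L *m _.
have LB : L^T *m L *m B = 1%:M.
  by rewrite /B mulmxA -(mulmxA L^T) mulmxV// mulmx1 mulmxV.
by rewrite -[LHS]mulmx1 -LB mulKmx// unitmx_mul uLT.
Qed.

(** The reflection in the hyperplane orthogonal to [u = w - nrm w *: e] exchanges these two vectors
    of equal norm; when they coincide, the identity is taken. *)
Lemma householder d (w : 'rV[R]_d.+1) : exists2 Q : 'M[R]_d.+1,
  Q^T *m Q = 1%:M & (nrm w *: delta_mx ord0 ord0) *m Q = w.
Proof.
set e : 'rV[R]_d.+1 := delta_mx ord0 ord0.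
have [u uE] : exists u, u = w - nrm w *: e by exists (w - nrm w *: e).
have ee : dotv e e = 1.
  by rewrite /dotv (bigD1 ord0)//= big1 => [|k k0]; rewrite !mxE eqxx ?mulr1 ?addr0// (negbTE k0) mulr0.
have [u0|u0] := eqVneq u 0.
  exists 1%:M; first by rewrite trmx1 mulmx1.
  by rewrite mulmx1; apply/esym/eqP; rewrite -subr_eq0 -uE u0.
have uu : dotv u u != 0 by rewrite dotvv_eq0.
pose c := 2 / dotv u u.
have uuT : u *m u^T = (dotv u u)%:M.
  by rewrite dotvE; apply/matrixP => i j; rewrite !ord1 [in RHS]mxE eqxx mulr1n.
have uTu : u^T *m u *m (u^T *m u) = dotv u u *: (u^T *m u).
  by rewrite mulmxA -(mulmxA u^T) uuT mul_mx_scalar scalemxAl.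
exists (1%:M - c *: (u^T *m u)).
  have -> : (1%:M - c *: (u^T *m u))^T = 1%:M - c *: (u^T *m u).
    by rewrite linearB linearZ /= trmx1 trmx_mul trmxK.
  rewrite mulmxBl mul1mx mulmxBr mulmx1 -scalemxAl -scalemxAr uTu !scalerA.
  rewrite -addrA -[X in _ + X]opprD addrA -scalerDl -scalerBl.
  rewrite (_ : c + c - _ = 0) ?scale0r ?subr0//.
  by rewrite /c; field.
rewrite mulmxBr mulmx1 -scalemxAr mulmxA.
have -> : nrm w *: e *m u^T = (dotv (nrm w *: e) u)%:M.
  by rewrite dotvE; apply/matrixP => i j; rewrite !ord1 [in RHS]mxE eqxx mulr1n.
rewrite mul_scalar_mx scalerA.
have -> : c * dotv (nrm w *: e) u = -1.
  (* This is where the equality of the norms of [w] and [nrm w *: e] enters: it makes the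
     coefficient exactly -1. *)
  have uuE : dotv u u = - 2 * dotv (nrm w *: e) u.
    rewrite uE !dotvDl !dotvDr !dotvNl !dotvNr !dotvZl !dotvZr ee.
    by rewrite (dotvC e w) -nrm_sqr; ring.
  move: uu; rewrite /c uuE mulf_eq0 negb_or => /andP[_ ?]; by field.
by rewrite scaleN1r opprK uE addrC subrK.
Qed.

(** [L] may be multiplied on the left by an orthogonal matrix. This freedom is spent on moving the
    whitened [v] onto the first axis, where the hull of a ball and a point is computed. *)
Lemma posdef_factor d (S : 'M[R]_d.+1) (v : 'rV[R]_d.+1) : posdef S ->
  exists L : 'M[R]_d.+1, [/\ L \in unitmx, S = L^T *m L &
    v = (nrm (v *m invmx L) *: delta_mx ord0 ord0) *m L].
Proof.
move=> /cholesky[L uL ->].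
have [Q QQ Qw] := householder (v *m invmx L).
have uQ : Q \in unitmx by apply: (mulmx1_unit QQ).2.
have uQL : Q *m L \in unitmx by rewrite unitmx_mul uQ.
exists (Q *m L); split => //.
  by rewrite trmx_mul mulmxA -(mulmxA L^T) QQ mulmx1.
rewrite mulmxA -{1}[v](mulmxKV uL) -{1}Qw; congr ((_ *: _) *m _ *m _).
have := mahal_factor v 0 uQL; rewrite subr0 => <-.
have := mahal_factor v 0 uL; rewrite subr0 => <-.
by rewrite trmx_mul mulmxA -(mulmxA L^T) QQ mulmx1.
Qed.

End factorization.

(** * Calculus on intervals and Gaussian moments on the half-line *)

Section real_analysis.
Context {R : realType}.
Notation mu := (@lebesgue_measure R).

Lemma within_itv_continuous (f : R -> R) (a b : R) :
  (forall x, a <= x <= b -> {for x, continuous f}) ->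
  {within `[a, b], continuous f}.
Proof.
move=> cf; apply: continuous_in_subspaceT => x.
by rewrite inE /= in_itv /=; exact: cf.
Qed.

Lemma itv_continuous_integrable (f : R -> R) (a b : R) :
  (forall x, a <= x <= b -> {for x, continuous f}) ->
  mu.-integrable `[a, b] (EFin \o f).
Proof.
move=> cf; apply: continuous_compact_integrable; first exact: segment_compact.
exact: within_itv_continuous.
Qed.

Lemma is_derive_continuous (F : R -> R) (x l : R) :
  is_derive x 1 F l -> {for x, continuous F}.
Proof. by move=> [/derivable1_diffP/differentiable_continuous]. Qed.

Lemma is_derive1E (F : R -> R) (x l : R) : is_derive x 1 F l -> derive1 F x = l.
Proof. by move=> [dF DF]; rewrite derive1E. Qed.

Lemma is_derive_LRcontinuous (F f : R -> R) (a b : R) :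
  (forall x, a <= x <= b -> is_derive x 1 F (f x)) -> a < b ->
  derivable_oo_LRcontinuous F a b.
Proof.
move=> dF ab; have abx x : x \in `]a, b[ -> a <= x <= b.
  by rewrite in_itv /= => /andP[/ltW-> /ltW->].
split.
- by move=> x /abx /dF[].
- apply: cvg_at_right_filter.
  by apply: is_derive_continuous (dF a _); rewrite lexx ltW.
- apply: cvg_at_left_filter.
  by apply: is_derive_continuous (dF b _); rewrite lexx ltW.
Qed.

Lemma Rintegral_derive (F f : R -> R) (a b : R) : a <= b ->
  (forall x, a <= x <= b -> is_derive x 1 F (f x)) ->
  (forall x, a <= x <= b -> {for x, continuous f}) ->
  Rintegral mu `[a, b] f = F b - F a.
Proof.
rewrite le_eqVlt => /predU1P[<-|ab] dF cf.
  by rewrite set_itv1 Rintegral_set1 subrr.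
rewrite /Rintegral (@continuous_FTC2 _ f F)//.
- exact: within_itv_continuous.
- exact: is_derive_LRcontinuous dF ab.
move=> x; rewrite in_itv /= => /andP[/ltW ax /ltW xb].
by apply: is_derive1E; apply: dF; rewrite ax.
Qed.

(** Monotone convergence along an exhaustion. The endpoints [a n] are left free because the
    substitution of a square turns [n] into [n ^ 2]. *)
Lemma cvg_integral_itv0y (f : R -> R) (a : nat -> R) :
  continuous f -> (forall x, 0 <= x -> 0 <= f x) ->
  {homo a : m n / (m <= n)%N >-> m <= n} -> (forall x : R, exists n, x <= a n) ->
  (\int[mu]_(x in `[0%R, a n]) (f x)%:E)%E @[n --> \oo] -->
  (\int[mu]_(x in `[0%R, +oo[) (f x)%:E)%E.
Proof.
move=> cf f0 nda ay.
have -> : `[0%R, +oo[%classic = \bigcup_n `[0%R, a n]%classic.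
  apply/seteqP; split => x /=.
    rewrite in_itv /= andbT => x0; have [n xn] := ay x.
    by exists n => //=; rewrite in_itv /= x0.
  by move=> [n _] /=; rewrite !in_itv /= => /andP[-> _].
apply: ge0_nondecreasing_set_cvg_integral.
- move=> m n mn; apply/subsetPset => x /=; rewrite !in_itv /= => /andP[->] /=.
  by move=> /le_trans; apply; exact: nda.
- by move=> n; exact: measurable_itv.
- move=> n; apply/measurable_EFinP; apply: measurable_funTS.
  exact: continuous_measurable_fun.
- by move=> n x /=; rewrite in_itv /= => /andP[x0 _]; rewrite lee_fin f0.
Qed.

Definition gauss_moment (k : nat) (u : R) : R := u ^+ k * expR (- u ^+ 2).

Lemma continuous_gauss_moment k : continuous (gauss_moment k).
Proof.
by move=> x; apply: cvgM; [exact: exprn_continuous|exact: continuous_gauss_fun].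
Qed.

Lemma gauss_moment_ge0 k u : 0 <= u -> 0 <= gauss_moment k u.
Proof. by move=> u0; rewrite mulr_ge0 ?exprn_ge0 ?expR_ge0. Qed.

#[global] Instance is_derive_pow (f : R -> R) (k : nat) (x df : R) :
  is_derive x 1 f df -> is_derive x 1 (fun y => f y ^+ k) (k%:R * f x ^+ k.-1 * df).
Proof.
move=> dfx; have := is_deriveX k dfx; congr is_derive.
by apply/funext => y; rewrite exprfctE.
Qed.

Lemma is_derive_gauss_moment k (u : R) :
  is_derive u 1 (fun u => - gauss_moment k.+1 u)
   (2 * gauss_moment k.+2 u - k.+1%:R * gauss_moment k u).
Proof.
rewrite /gauss_moment; apply: is_derive_eq.
rewrite /GRing.scale /= !exprS expr0; ring.
Qed.

(** For [n >= 1], [expR (- n ^ 2)] is at most [1 / expR n], and [expR n] is at least [n ^ k.+1] over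
    the factorial of [k.+1]. The factor 2 in the bound pays for [n.+1] instead of [n] in the
    denominator. *)
Lemma cvg_gauss_moment k : (gauss_moment k n%:R) @[n --> \oo] --> (0 : R).
Proof.
apply: (@squeeze_cvgr _ _ _ _ (fun=> 0) (fun n => (k.+1)`!%:R * n.+1%:R^-1 * 2)).
- near=> n; rewrite gauss_moment_ge0//=.
  have n0 : (0 < n)%N by near: n; exact: nbhs_infty_gt.
  have n1 : 1 <= n%:R :> R by rewrite ler1n.
  rewrite /gauss_moment.
  have E1 : expR (- n%:R ^+ 2) <= (expR n%:R)^-1 :> R.
    by rewrite -expRN ler_expR lerN2 -[leLHS]mulr1 expr2 ler_wpM2l.
  have E2 : n%:R ^+ k.+1 / k.+1`!%:R <= expR n%:R :> R.
    by apply: le_trans (expR_ge1Dxn k (ler0n _ _)); rewrite lerDr.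
  apply: le_trans (ler_wpM2l _ E1) _; first by rewrite exprn_ge0.
  rewrite ler_pdivrMr ?expR_gt0//.
  apply: le_trans (ler_wpM2l _ E2); last by rewrite !mulr_ge0// invr_ge0.
  have f0 : (k.+1)`!%:R != 0 :> R by rewrite pnatr_eq0 -lt0n fact_gt0.
  have -> : (k.+1)`!%:R / n.+1%:R * 2 * (n%:R ^+ k.+1 / (k.+1)`!%:R) =
            n%:R ^+ k * (2 * n%:R / n.+1%:R) :> R.
    by rewrite exprS; field; rewrite f0 addrC natr1 pnatr_eq0.
  rewrite -[leLHS]mulr1 ler_wpM2l ?exprn_ge0// ler_pdivlMr ?ltr0n// mul1r.
  by rewrite -natr1; lra.
- exact: cvg_cst.
- rewrite (_ : 0 = (k.+1)`!%:R * 0 * 2 :> R); last by rewrite mulr0 mul0r.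
  apply: cvgMl; apply: cvgMr; exact: cvg_harmonic.
Unshelve. all: by end_near.
Qed.

Fixpoint gauss_moment_int (k : nat) : R :=
  match k with
  | 0 => Num.sqrt pi / 2
  | 1 => 1 / 2
  | k'.+2 => k'.+1%:R / 2 * gauss_moment_int k'
  end.

Lemma nat_ray_homo : {homo (fun n : nat => n%:R : R) : m n / (m <= n)%N >-> m <= n}.
Proof. by move=> m n mn; rewrite ler_nat. Qed.

Lemma nat_ray_unbounded (x : R) : exists n : nat, x <= n%:R.
Proof.
exists (Num.truncn `|x|).+1.
by apply: ltW; apply: le_lt_trans (ler_norm _) _; exact: truncnS_gt.
Qed.

(** Integration by parts on [[0, n]], where the boundary term [gauss_moment k.+1 n] tends to 0,
    gives the recursion; cases 0 and 1 are the Gaussian integral and an explicit primitive. *)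
Lemma integral_gauss_moment k :
  (\int[mu]_(u in `[0%R, +oo[) (gauss_moment k u)%:E = (gauss_moment_int k)%:E)%E.
Proof.
have cvgJ k' := cvg_integral_itv0y (@continuous_gauss_moment k')
  (@gauss_moment_ge0 k') nat_ray_homo nat_ray_unbounded.
have JR k' n : (\int[mu]_(u in `[0%R, n%:R]) (gauss_moment k' u)%:E =
    (Rintegral mu `[0%R, n%:R] (gauss_moment k'))%:E)%E.
  rewrite fineK//; apply: integrable_fin_num => //.
  by apply: itv_continuous_integrable => x _; exact: continuous_gauss_moment.
elim/ltn_ind: k => -[|[|k]] IH.
- rewrite /= -integral0y_gauss; apply: eq_integral => u _.
  by rewrite /gauss_moment expr0 mul1r.
- have := cvgJ 1%N; under eq_fun do rewrite JR.
  have -> : (fun n : nat => (Rintegral mu `[0%R, n%:R] (gauss_moment 1))%:E) =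
      EFin \o (fun n : nat => (1 - gauss_moment 0 n%:R) / 2).
    apply/funext => n /=; congr EFin.
    have dF (x : R) : is_derive x 1 (fun u => - (gauss_moment 0 u * (1 / 2))) (gauss_moment 1 x).
      rewrite /gauss_moment; apply: is_derive_eq.
      rewrite /GRing.scale /= expr0 expr1; lra.
    rewrite (Rintegral_derive (ler0n _ _) (fun x _ => dF x)
      (fun x _ => @continuous_gauss_moment 1 x)).
    rewrite /gauss_moment !expr0 expr0n /= oppr0 expR0; lra.
  move=> /cvg_unique; apply => //.
  apply: cvg_EFin => //; first by near=> n.
  have : (1 - gauss_moment 0 n%:R) / 2 @[n --> \oo] --> (1 - 0 : R) / 2.
    apply: cvgMl; apply: cvgB; [exact: cvg_cst|exact: cvg_gauss_moment].
  by rewrite subr0.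
- have := cvgJ k.+2; under eq_fun do rewrite JR.
  have -> : (fun n : nat => (Rintegral mu `[0%R, n%:R] (gauss_moment k.+2))%:E) =
      EFin \o (fun n : nat => (k.+1%:R * Rintegral mu `[0%R, n%:R] (gauss_moment k) - gauss_moment k.+1 n%:R) / 2).
    apply/funext => n /=; congr EFin.
    have := @Rintegral_derive _ _ 0 n%:R (ler0n _ _) (fun x _ => is_derive_gauss_moment k x).
    have c1 x : {for x, continuous (fun u => 2 * gauss_moment k.+2 u)}.
      by apply: cvgMr; exact: continuous_gauss_moment.
    have c2 x : {for x, continuous (fun u => k.+1%:R * gauss_moment k u)}.
      by apply: cvgMr; exact: continuous_gauss_moment.
    have c3 x : {for x, continuous
        (fun u => 2 * gauss_moment k.+2 u - k.+1%:R * gauss_moment k u)}.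
      by apply: cvgB; [exact: c1|exact: c2].
    have ig k' : mu.-integrable `[0, n%:R] (EFin \o gauss_moment k').
      by apply: itv_continuous_integrable => x _; exact: continuous_gauss_moment.
    rewrite RintegralB//; last 2 first.
      by apply: itv_continuous_integrable.
      by apply: itv_continuous_integrable.
    rewrite !RintegralZl// => H.
    have {}H := H (fun x _ => c3 x).
    have g0 : gauss_moment k.+1 0 = 0 by rewrite /gauss_moment expr0n mul0r.
    by move: H; rewrite g0; lra.
  move=> /cvg_unique; apply => //.
  apply: cvg_EFin => //; first by near=> n.
  have : (k.+1%:R * Rintegral mu `[0%R, n%:R] (gauss_moment k) -
      gauss_moment k.+1 n%:R) / 2 @[n --> \oo] -->
      (k.+1%:R * gauss_moment_int k - 0) / 2.
    apply: cvgMl; apply: cvgB; last exact: cvg_gauss_moment.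
    apply: cvgMr; have := cvgJ k; rewrite (IH k)//; under eq_fun do rewrite JR.
    exact: fine_cvg.
  by rewrite subr0 mulrAC.
Unshelve. all: by end_near.
Qed.

End real_analysis.

(** * Gamma at half-integers and Wallis integrals *)

Section gamma_wallis.
Context {R : realType}.
Notation mu := (@lebesgue_measure R).

(** The substitution [t = u ^ 2] produces [2 * u ^ k.+1 * expR (- u ^ 2)]. Starting at [2 / 2] keeps
    the exponent [k / 2] of [t] nonnegative, so the integrand extends continuously to 0. *)
Lemma Gamma_half (k : nat) : Gamma (k.+2%:R / 2) = 2 * gauss_moment_int k.+1 :> R.
Proof.
pose G (t : R) := (Num.sqrt t) ^+ k * expR (- t).
have cG : continuous G.
  move=> t; apply: cvgM.
    apply: (@continuous_comp _ _ _ Num.sqrt (fun x => x ^+ k)).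
      exact: sqrt_continuous.
    exact: exprn_continuous.
  apply: (@continuous_comp _ _ _ -%R expR); first exact: opp_continuous.
  exact: continuous_expR.
have G0 t : 0 <= t -> 0 <= G t by move=> _; rewrite mulr_ge0 ?exprn_ge0 ?expR_ge0 ?sqrtr_ge0.
have GE (t : R) : 0 <= t -> t `^ (k.+2%:R / 2 - 1) * expR (- t) = G t.
  move=> t0; congr (_ * _).
  rewrite (_ : _ - 1 = 2^-1 * k%:R); last by rewrite -natr1 -natr1; field.
  by rewrite powRrM powR12_sqrt// powR_mulrn// sqrtr_ge0.
rewrite /Gamma /Rintegral.
have -> : (\int[mu]_(x in `]0%R, +oo[) (x `^ (k.+2%:R / 2 - 1) * expR (- x))%:E =
    \int[mu]_(x in `[0%R, +oo[) (G x)%:E)%E.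
  rewrite -(@integral_itv_obnd_cbnd _ _ _ (fun x => (G x)%:E))//; last first.
    apply/measurable_EFinP; apply: measurable_funTS.
    exact: continuous_measurable_fun.
  apply: eq_integral => x; rewrite inE /= in_itv /= andbT => /ltW x0.
  by rewrite GE.
suff -> : (\int[mu]_(x in `[0%R, +oo[) (G x)%:E = (2 * gauss_moment_int k.+1)%:E)%E by [].
have hsq : {homo (fun n : nat => n%:R ^+ 2 : R) : m n / (m <= n)%N >-> m <= n}.
  by move=> m n mn; rewrite -!natrX ler_nat leq_exp2r.
have usq (x : R) : exists n : nat, x <= n%:R ^+ 2.
  have [n xn] := nat_ray_unbounded x; exists n; apply: le_trans xn _.
  by rewrite -natrX ler_nat; case: n => // n; rewrite -{1}(expn1 n.+1) leq_pexp2l.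
have := cvg_integral_itv0y cG G0 hsq usq.
have sub (n : nat) : (\int[mu]_(x in `[0%R, (n%:R ^+ 2)%R]) (G x)%:E =
    2%:E * \int[mu]_(x in `[0%R, n%:R]) (gauss_moment k.+1 x)%:E)%E.
  pose F (u : R) := u ^+ 2.
  have dF (u : R) : is_derive u 1 F (2 * u).
    by rewrite /F; apply: is_derive_eq; rewrite /GRing.scale /=; lra.
  have F'E : derive1 F = fun u => 2 * u.
    by apply/funext => u; exact: is_derive1E.
  have cF' : continuous (fun u : R => 2 * u).
    by move=> u; apply: cvgMr; exact: cvg_id.
  have pt (x : R) : 0 <= x -> G (F x) * (2 * x) = 2 * gauss_moment k.+1 x.
    move=> x0; rewrite /G /F /gauss_moment sqrtr_sqr ger0_norm//.
    by rewrite (exprSr x k); ring.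
  have F0 : 0 = F 0 by rewrite /F expr0n.
  rewrite [in LHS]F0 -/(F n%:R).
  have := @integration_by_substitution_increasing R F G 0 n%:R (ler0n _ _).
  rewrite F'E => -> //.
  - have mgm : measurable_fun (`[0, n%:R]%classic : set R)
        (fun x : R => (gauss_moment k.+1 x)%:E).
      apply/measurable_EFinP; apply: measurable_funTS.
      exact: (continuous_measurable_fun (@continuous_gauss_moment _ _)).
    rewrite -ge0_integralZl//=; last first.
      move=> x; rewrite in_itv /= => /andP[x0 _].
      by rewrite lee_fin; apply: gauss_moment_ge0.
    apply: eq_integral => x; rewrite inE /= in_itv /= => /andP[x0 _].
    by rewrite -EFinM -pt.
  - move=> x y; rewrite !in_itv /= => /andP[x0 _] /andP[y0 _] xy.
    by rewrite /F ltr_pXn2r// nnegrE.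

  - apply: cvgP; apply: cvg_at_right_filter; exact: cF'.
  - apply: cvgP; apply: cvg_at_left_filter; exact: cF'.
  - have [n0|n0] := ltP 0 (n%:R : R); first exact: is_derive_LRcontinuous (fun x _ => dF x) n0.
    split.
    + by move=> x; rewrite in_itv /= => /andP[x0 xn]; have := lt_le_trans (lt_trans x0 xn) n0; rewrite ltxx.
    + apply: cvg_at_right_filter; exact: is_derive_continuous (dF _).
    + apply: cvg_at_left_filter; exact: is_derive_continuous (dF _).
  - exact: continuous_subspaceT.
under eq_fun do rewrite sub.
move=> /cvg_unique; apply => //.
rewrite EFinM; apply: cvgeZl => //.
rewrite -integral_gauss_moment.
exact: (cvg_integral_itv0y (@continuous_gauss_moment _ _)
  (@gauss_moment_ge0 _ _) nat_ray_homo nat_ray_unbounded).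
Qed.

Definition wallis (d : nat) : R := Rintegral mu `[0, pi] (fun s => sin s ^+ d).

Lemma continuous_sinX d : continuous (fun s : R => sin s ^+ d).
Proof.
move=> s; apply: (@continuous_comp _ _ _ sin (fun x => x ^+ d)).
  exact: continuous_sin.
exact: exprn_continuous.
Qed.

Lemma wallis0 : wallis 0 = pi.
Proof.
rewrite /wallis; under eq_Rintegral do rewrite expr0.
rewrite (@Rintegral_derive _ id (fun=> 1)) ?pi_ge0// ?subr0// => x _.
exact: cvg_cst.
Qed.

Lemma wallis1 : wallis 1 = 2.
Proof.
have dF (x : R) : is_derive x 1 (fun s => - cos s) (sin x ^+ 1).
  by apply: is_derive_eq; rewrite opprK expr1.
rewrite /wallis (Rintegral_derive (pi_ge0 R) (fun x _ => dF x)).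
  by rewrite cospi cos0; lra.
by move=> x _; exact: continuous_sinX.
Qed.

(** The difference of the two integrands is the derivative of [- cos * sin ^ d.+1], which vanishes
    at 0 and at [pi]. *)
Lemma wallisSS d : d.+2%:R * wallis d.+2 = d.+1%:R * wallis d.
Proof.
have ig k : mu.-integrable `[0, pi] (EFin \o (fun s : R => sin s ^+ k)).
  by apply: itv_continuous_integrable => x _; exact: continuous_sinX.
rewrite /wallis -!RintegralZl//; apply/eqP; rewrite -subr_eq0; apply/eqP.
rewrite -RintegralB//; last 2 first.
- by apply: itv_continuous_integrable => x _; apply: cvgMr; exact: continuous_sinX.
- by apply: itv_continuous_integrable => x _; apply: cvgMr; exact: continuous_sinX.
have dF (x : R) : is_derive x 1 (fun s => - (cos s * sin s ^+ d.+1))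
    (d.+2%:R * sin x ^+ d.+2 - d.+1%:R * sin x ^+ d).
  apply: is_derive_eq; rewrite /GRing.scale /= !exprS.
  have c2 : cos x * cos x = 1 - sin x * sin x.
    by have := cos2Dsin2 x; rewrite !expr2; lra.
  transitivity (sin x ^+ d * (sin x * sin x) - d.+1%:R * sin x ^+ d * (cos x * cos x)).
    by ring.
  rewrite c2 -[d.+2%:R]natr1; ring.
rewrite (Rintegral_derive (pi_ge0 R) (fun x _ => dF x)).
  by rewrite sinpi sin0 expr0n /= !mulr0 subrr.
by move=> x _; apply: cvgB; apply: cvgMr; exact: continuous_sinX.
Qed.

Lemma gauss_moment_intSS k :
  gauss_moment_int k.+2 = k.+1%:R / 2 * gauss_moment_int k :> R.
Proof. by []. Qed.

Lemma gauss_moment_int_gt0 k : 0 < gauss_moment_int k :> R.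
Proof.
elim/ltn_ind: k => -[|[|k]] IH /=; first by rewrite divr_gt0// sqrtr_gt0 pi_gt0.
  by rewrite divr_gt0.
by rewrite mulr_gt0 ?divr_gt0// IH.
Qed.

(** Raising [d] by 2 multiplies both sides by [d.+1 / 2]. *)
Lemma wallis_gauss_moment d :
  wallis d * gauss_moment_int d.+1 = Num.sqrt pi * gauss_moment_int d.
Proof.
elim/ltn_ind: d => -[|[|d]] IH.
- rewrite wallis0 /= mulrA mulrA -expr2 sqr_sqrtr ?pi_ge0//; lra.
- by rewrite wallis1 /=; lra.
- have W := wallisSS d; have IHd := IH d (leqnSn _).
  have d2 : d.+2%:R != 0 :> R by rewrite pnatr_eq0.
  rewrite (gauss_moment_intSS d.+1) (gauss_moment_intSS d).
  have -> : wallis d.+2 = d.+1%:R * wallis d / d.+2%:R.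
    by rewrite -W mulrC mulKf.
  transitivity (d.+1%:R / 2 * (wallis d * gauss_moment_int d.+1)); last by rewrite IHd; ring.
  move: (gauss_moment_int d.+1) (wallis d) => a b.
  move: (d.+2%:R) d2 (d.+1%:R) => u u0 v; by field.
Qed.

(** This identifies the normalising factor of [g_fun] with the quotient of the unit ball volumes of
    dimensions [d] and [d.+1]. *)
Lemma Gamma_ratio d :
  Gamma (d.+1%:R / 2 + 1) / (Num.sqrt pi * Gamma ((d.+1%:R + 1) / 2)) =
  (wallis d.+1)^-1 :> R.
Proof.
have -> : d.+1%:R / 2 + 1 = d.+3%:R / 2 :> R by rewrite -[d.+3%:R]natr1 -[d.+2%:R]natr1; lra.
have -> : d.+1%:R + 1 = d.+2%:R :> R by rewrite natr1.
rewrite !Gamma_half.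
have := wallis_gauss_moment d.+1.
have := gauss_moment_int_gt0 d.+2; have := gauss_moment_int_gt0 d.+1.
move: (gauss_moment_int d.+2) (gauss_moment_int d.+1) => a b b0 a0 E.
have sp : 0 < Num.sqrt pi :> R by rewrite sqrtr_gt0 pi_gt0.
rewrite mulrCA -E; field.
have w0 : wallis d.+1 != 0.
  apply: contraTneq (mulr_gt0 sp b0) => w0.
  by rewrite -E w0 mul0r ltxx.
by rewrite w0 gt_eqF.
Qed.

End gamma_wallis.

(** * Growth, stability and inversion of the illumination function *)

Section illumination_profile.
Context {R : realType}.
Notation mu := (@lebesgue_measure R).

Lemma derive_ge0_le (F f : R -> R) (a b : R) : a <= b ->
  (forall x, a <= x <= b -> is_derive x 1 F (f x)) ->
  (forall x, a <= x <= b -> 0 <= f x) -> F a <= F b.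
Proof.
move=> ab dF f0.
have abx (x : R) : x \in `]a, b[ -> a <= x <= b.
  by rewrite in_itv /= => /andP[/ltW-> /ltW->].
apply: (@ger0_derive1_ndecr _ F a b) => //.
- by move=> x /abx/dF[].
- by move=> x /abx xab; rewrite (is_derive1E (dF x xab)) f0.
- by apply: within_itv_continuous => x /dF; exact: is_derive_continuous.
Qed.

(** The classical reduction formula for a primitive of [sin ^ d]. It is not normalised to vanish at
    0, so only differences are meaningful. *)
Fixpoint sin_prim (d : nat) : R -> R :=
  match d with
  | 0 => id
  | 1 => fun s => - cos s
  | d'.+2 => fun s =>
      (d'.+2%:R)^-1 * (d'.+1%:R * sin_prim d' s - cos s * sin s ^+ d'.+1)
  end.

Lemma is_derive_sin_prim d (x : R) : is_derive x 1 (sin_prim d) (sin x ^+ d).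
Proof.
elim/ltn_ind: d => -[|[|d]] IH.
- by rewrite expr0; exact: is_derive_id.
- by rewrite /=; apply: is_derive_eq; rewrite opprK expr1.
- have dd := IH d (leqnSn _); rewrite /=.
  have d2 : d.+2%:R != 0 :> R by rewrite pnatr_eq0.
  apply: is_derive_eq; rewrite /GRing.scale /=.
  have c2 : cos x * cos x = 1 - sin x * sin x.
    by have := cos2Dsin2 x; rewrite !expr2; lra.
  apply: (mulfI d2); rewrite ?mulr0 ?addr0 mulrA mulfV// mul1r.
  transitivity (sin x ^+ d * (d.+1%:R * (1 - cos x * cos x) + sin x * sin x)).
    by rewrite !exprS; ring.
  rewrite c2 -[d.+2%:R]natr1 !exprS; ring.
Qed.

Lemma Rintegral_sinX d (a b : R) : a <= b ->
  Rintegral mu `[a, b] (fun s => sin s ^+ d) = sin_prim d b - sin_prim d a.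
Proof.
move=> ab; apply: (Rintegral_derive ab (fun x _ => is_derive_sin_prim d x)).
by move=> x _; exact: continuous_sinX.
Qed.

Lemma wallis_gt0 d : 0 < wallis d :> R.
Proof.
have H := wallis_gauss_moment d.
have : 0 < wallis d * gauss_moment_int d.+1 :> R.
  by rewrite H mulr_gt0 ?gauss_moment_int_gt0// sqrtr_gt0 pi_gt0.
by rewrite pmulr_lgt0// gauss_moment_int_gt0.
Qed.

(** The bracket of [g_fun] at [t = 1 / cos th], up to an additive constant. *)
Definition ill_angle (d : nat) (th : R) : R :=
  sin th ^+ d.+1 / (d%:R * cos th) - sin_prim d th.

Lemma is_derive_ill_angle d (th : R) : cos th != 0 ->
  is_derive th 1 (ill_angle d.+1) (sin th ^+ d.+1 / (d.+1%:R * cos th ^+ 2)).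
Proof.
move=> c0; have ds := is_derive_sin_prim d.+1 th.
have d0 : d.+1%:R != 0 :> R by rewrite pnatr_eq0.
have dc : is_derive th 1 (fun th => (d.+1%:R * cos th)^-1)
    (- (d.+1%:R * cos th) ^- 2 *: (d.+1%:R * - sin th)).
  apply: is_deriveV; first by rewrite mulf_neq0.
apply: is_derive_eq; rewrite /GRing.scale /=.
have c2 : sin th * sin th = 1 - cos th * cos th.
  by have := cos2Dsin2 th; rewrite !expr2; lra.
transitivity (sin th ^+ d.+1 * ((d.+2%:R * (cos th * cos th) + sin th * sin th) /
    (d.+1%:R * (cos th * cos th)) - 1)).
  by rewrite !exprS; field; rewrite ?nat1r c0 d0.
rewrite c2 -[d.+2%:R]natr1; field; by rewrite ?nat1r c0 d0.
Qed.

Lemma acos_invr (t : R) : 1 <= t ->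
  [/\ 0 <= acos t^-1, acos t^-1 < pi / 2, cos (acos t^-1) = t^-1 &
      sin (acos t^-1) = Num.sqrt (1 - t ^- 2)].
Proof.
move=> t1; have t0 : 0 < t by rewrite (lt_le_trans _ t1).
have it : -1 <= t^-1 <= 1.
  rewrite invf_le1// t1 andbT (@le_trans _ _ 0)// ?invr_ge0 ?(ltW t0)//.
have [/andP[a0 api] ca] := acos_def it.
split => //; last by rewrite sin_acos// exprVn.
have pi0 := pi_gt0 R.
rewrite -ltr_cos ?in_itv /=; last 2 first.
- by rewrite ?a0 ?api //; apply/andP; split; lra.
- by rewrite ?in_itv /= ?a0 ?api //; apply/andP; split; lra.
by rewrite cos_pihalf ca invr_gt0.
Qed.

Lemma g_fun_angle d (t : R) : 1 <= t -> @g_fun R d.+1 t =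
  1 + (wallis d.+1)^-1 * (ill_angle d.+1 (acos t^-1) - ill_angle d.+1 0).
Proof.
move=> t1; have [th0 _ ct st] := acos_invr t1.
have t0 : 0 < t by rewrite (lt_le_trans _ t1).
have s0 : 0 <= 1 - t ^- 2 by rewrite subr_ge0 invf_le1 ?exprn_gt0// exprn_ege1.
rewrite /g_fun Gamma_ratio Rintegral_sinX//; congr (1 + _ * _).
rewrite /ill_angle sin0 cos0 expr0n /= mul0r sub0r opprK ct.
rewrite (_ : (d.+1%:R + 1) / 2 = 2^-1 * d.+2%:R); last by rewrite -[d.+2%:R]natr1 mulrC.
rewrite powRrM powR12_sqrt// powR_mulrn ?sqrtr_ge0// -st.
rewrite invfM invrK; ring.
Qed.

Lemma g_fun1 d : @g_fun R d.+1 1 = 1.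
Proof. by rewrite g_fun_angle// invr1 acos1 subrr mulr0 addr0. Qed.

(** The derivative of [ill_angle d.+1] is [sin ^ d / d.+1] times that of [1 / cos], and [sin ^ d]
    stays between [sin a ^ d] and 1. Comparing with [1 / cos = t] bounds the slope of [g_fun]. *)
Lemma ill_angle_incr d (a b : R) : 0 <= a -> a <= b -> b < pi / 2 ->
  sin a ^+ d / d.+1%:R * ((cos b)^-1 - (cos a)^-1) <=
    ill_angle d.+1 b - ill_angle d.+1 a <=
  d.+1%:R^-1 * ((cos b)^-1 - (cos a)^-1).
Proof.
move=> a0 ab bpi; have pi0 := pi_gt0 R.
have cx (x : R) : a <= x <= b -> 0 < cos x.
  by move=> /andP[ax xb]; apply: cos_gt0_pihalf; apply/andP; split; lra.
have ix (x : R) : a <= x <= b -> x \in `[(- (pi / 2)), pi / 2].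
  by move=> /andP[ax xb]; rewrite in_itv /=; apply/andP; split; lra.
have sx (x : R) : a <= x <= b -> sin a <= sin x.
  move=> axb; have /andP[ax xb] := axb.
  move: ax; rewrite le_eqVlt => /predU1P[->//|ax].
  by apply: ltW; rewrite ltr_sin// ix// lexx ltW// (lt_le_trans ax).
have sa0 : 0 <= sin a by apply: sin_ge0_pi; apply/andP; split; lra.
have dinv (x : R) : a <= x <= b -> is_derive x 1 (fun y => (cos y)^-1) (sin x / cos x ^+ 2).
  move=> /cx/lt0r_neq0 cx0.
  have := @is_deriveV R cos x _ _ cx0 (is_derive_cos x).
  by congr is_derive; rewrite /GRing.scale /= mulrNN mulrC.
have dill (x : R) (axb : a <= x <= b) := is_derive_ill_angle d (lt0r_neq0 (cx x axb)).
have d0 : 0 < d.+1%:R :> R by rewrite ltr0n.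
apply/andP; split.
  have H : ill_angle d.+1 a - (sin a ^+ d / d.+1%:R) * (cos a)^-1 <=
         ill_angle d.+1 b - (sin a ^+ d / d.+1%:R) * (cos b)^-1.
    apply: (@derive_ge0_le (fun x => ill_angle d.+1 x - (sin a ^+ d / d.+1%:R) * (cos x)^-1)
      (fun x => (sin x / (d.+1%:R * cos x ^+ 2)) * (sin x ^+ d - sin a ^+ d))) => //.
      move=> x axb; have := dill x axb; have := dinv x axb => di1 di2.
      apply: is_derive_eq; rewrite /GRing.scale /= (exprS (sin x) d); field.
      by rewrite ?nat1r (lt0r_neq0 (cx x axb)) (lt0r_neq0 d0).
    move=> x axb; rewrite mulr_ge0//.
      rewrite divr_ge0// ?(le_trans sa0 (sx x axb))// mulr_ge0 ?exprn_ge0 ?(ltW (cx x axb))//.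
    rewrite subr_ge0; apply: lerXn2r; rewrite ?nnegrE ?(le_trans sa0) ?sx// ?lexx ?ab//.
  rewrite mulrBr; move: (sin a ^+ d / d.+1%:R / cos a) (sin a ^+ d / d.+1%:R / cos b) H => u v.
  by lra.
have H : d.+1%:R^-1 * (cos a)^-1 - ill_angle d.+1 a <=
         d.+1%:R^-1 * (cos b)^-1 - ill_angle d.+1 b.
  apply: (@derive_ge0_le (fun x => d.+1%:R^-1 * (cos x)^-1 - ill_angle d.+1 x)
    (fun x => (sin x / (d.+1%:R * cos x ^+ 2)) * (1 - sin x ^+ d))) => //.
    move=> x axb; have := dill x axb; have := dinv x axb => di1 di2.
    apply: is_derive_eq; rewrite /GRing.scale /= (exprS (sin x) d); field.
    by rewrite ?nat1r (lt0r_neq0 (cx x axb)) (lt0r_neq0 d0).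
  move=> x axb; have s0 := le_trans sa0 (sx x axb); rewrite mulr_ge0//.
    rewrite divr_ge0// mulr_ge0 ?exprn_ge0 ?(ltW (cx x axb))//.

rewrite mulrBr; move: (d.+1%:R^-1 / cos a) (d.+1%:R^-1 / cos b) H => u v.
by lra.
Qed.

Lemma acos_invr_le (a b : R) : 1 <= a -> a <= b -> acos a^-1 <= acos b^-1.
Proof.
move=> a1 ab; have [a0 api ca _] := acos_invr a1.
have [b0 bpi cb _] := acos_invr (le_trans a1 ab); have pi0 := pi_gt0 R.
rewrite leNgt; apply/negP => H; have : cos (acos a^-1) < cos (acos b^-1).
  by rewrite ltr_cos// in_itv /=; apply/andP; split; lra.
by rewrite ca cb ltf_pV2 ?posrE; lra.
Qed.

(* The slope of the illumination function at [t] is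
   [(1 - t^-2)^((d-1)/2) / (d * wallis d)], which increases with [t]. *)
Lemma g_fun_incr d (a b : R) : 1 <= a -> a <= b ->
  (wallis d.+1 * d.+1%:R)^-1 * Num.sqrt (1 - a ^- 2) ^+ d * (b - a) <=
    @g_fun R d.+1 b - @g_fun R d.+1 a <=
  (wallis d.+1 * d.+1%:R)^-1 * (b - a).
Proof.
move=> a1 ab; have b1 := le_trans a1 ab.
have [a0 api ca sa] := acos_invr a1; have [b0 bpi cb _] := acos_invr b1.
have := ill_angle_incr d a0 (acos_invr_le a1 ab) bpi.
rewrite ca cb sa !invrK !g_fun_angle//.
have W := wallis_gt0 d.+1; set I := ill_angle d.+1 _; set J := ill_angle d.+1 _.
set Z := ill_angle d.+1 0; set S := Num.sqrt _ ^+ d => /andP[h1 h2].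
rewrite (_ : _ - (1 + _) = (wallis d.+1)^-1 * (I - J)); last by ring.
have Wi : 0 <= (wallis d.+1)^-1 :> R by rewrite invr_ge0 ltW.
rewrite invfM; apply/andP; split.
  by apply: le_trans (ler_wpM2l Wi h1); rewrite le_eqVlt; apply/orP; left; apply/eqP; ring.
by apply: le_trans (ler_wpM2l Wi h2) _; rewrite mulrA.
Qed.

Lemma g_fun_le d (a b : R) : 1 <= a -> a <= b -> @g_fun R d.+1 a <= @g_fun R d.+1 b.
Proof.
move=> a1 ab; have /andP[h _] := g_fun_incr d a1 ab; rewrite -subr_ge0.
apply: le_trans h; rewrite !mulr_ge0 ?subr_ge0 ?invr_ge0 ?exprn_ge0 ?sqrtr_ge0//.
by rewrite mulr_ge0// ltW// wallis_gt0.
Qed.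

(** The slope may vanish at 1, so the first half of the step is given away: beyond
    [a + e / 2 >= 1 + e / 2] the slope has a lower bound independent of [a]. *)
Lemma g_fun_slope d (e a b : R) : 0 < e -> 1 <= a -> a + e <= b ->
  (wallis d.+1 * d.+1%:R)^-1 * Num.sqrt (1 - (1 + e / 2) ^- 2) ^+ d * (e / 2) <=
  @g_fun R d.+1 b - @g_fun R d.+1 a.
Proof.
move=> e0 a1 aeb; have ae1 : 1 <= a + e / 2 by lra.
have /andP[h _] := @g_fun_incr d (a + e / 2) b ae1 ltac:(lra).
have h' := @g_fun_le d a (a + e / 2) a1 ltac:(lra).
apply: le_trans (_ : _ <= @g_fun R d.+1 b - @g_fun R d.+1 (a + e / 2)) _; last by lra.
apply: le_trans h.
have W : 0 <= (wallis d.+1 * d.+1%:R)^-1 :> R.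
  by rewrite invr_ge0 mulr_ge0// ltW// wallis_gt0.
apply: ler_pM; rewrite ?mulr_ge0 ?exprn_ge0 ?sqrtr_ge0//; try lra.
apply: ler_wpM2l => //; apply: lerXn2r; rewrite ?nnegrE ?sqrtr_ge0// ler_wsqrtr//.
rewrite lerD2l lerN2 lef_pV2 ?posrE ?exprn_gt0//; try lra.
by apply: lerXn2r; rewrite ?nnegrE; lra.
Qed.

Lemma g_fun_slope_gt0 d (e : R) : 0 < e ->
  0 < (wallis d.+1 * d.+1%:R)^-1 * Num.sqrt (1 - (1 + e / 2) ^- 2) ^+ d * (e / 2).
Proof.
move=> e0; rewrite !mulr_gt0 ?invr_gt0 ?mulr_gt0 ?wallis_gt0 ?ltr0n// ?divr_gt0//.
rewrite exprn_gt0// sqrtr_gt0 subr_gt0 invf_lt1 ?exprn_gt0; try lra.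
by rewrite exprn_egt1//; lra.
Qed.

Lemma g_fun_stable d (e : R) : 0 < e -> exists2 k : R, 0 < k &
  forall s t : R, 1 <= s -> 1 <= t ->
  `|@g_fun R d.+1 t - @g_fun R d.+1 s| < k -> `|t - s| <= e.
Proof.
move=> e0.
have [k k0 kP] : exists2 k : R, 0 < k & forall a b : R, 1 <= a -> a + e <= b ->
    k <= @g_fun R d.+1 b - @g_fun R d.+1 a.
  eexists; first exact: (g_fun_slope_gt0 d e0).
  by move=> a b; exact: g_fun_slope.
exists k => // s t s1 t1; rewrite ltr_norml => /andP[h1 h2].
rewrite ler_norml; apply/andP; split; rewrite leNgt; apply/negP => H.
  by have := kP t s t1 ltac:(lra); lra.
by have := kP s t s1 ltac:(lra); lra.
Qed.

Lemma g_fun_surj d (y : R) : 1 <= y -> exists t : R, 1 <= t /\ @g_fun R d.+1 t = y.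
Proof.
move=> y1.
pose k := (wallis d.+1 * d.+1%:R)^-1 * Num.sqrt (1 - 2 ^- 2) ^+ d : R.
have k0 : 0 < k.
  rewrite mulr_gt0 ?invr_gt0 ?mulr_gt0 ?wallis_gt0 ?ltr0n// exprn_gt0// sqrtr_gt0.
  by rewrite subr_gt0 invf_lt1 ?exprn_gt0// exprn_egt1// ltr1n.
(* [k] bounds the slope from below beyond 2, and [g_fun] is at least 1 at 2; hence [y] is reached by
   [T] at the latest. *)
pose T := 2 + (y - 1) / k : R.
have T2 : 2 <= T by rewrite lerDl divr_ge0 ?(ltW k0)// subr_ge0.
have gT : y <= @g_fun R d.+1 T.
  have /andP[h _] := @g_fun_incr d 2 T ltac:(lra) T2.
  have := @g_fun_le d 1 2 (lexx _) ltac:(lra); rewrite g_fun1.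
  move: h; rewrite -/k {1}/T addrAC subrr add0r mulrC divfK ?gt_eqF//; lra.
have T1 : 1 <= T by lra.
have [th0 thpi cT _] := acos_invr T1.
(* The intermediate value theorem is applied in the angle, where continuity follows from
   differentiability; the solution is then [1 / cos th]. *)
pose G th : R := 1 + (wallis d.+1)^-1 * (ill_angle d.+1 th - ill_angle d.+1 0).
have pi0 := pi_gt0 R.
have cG : {within `[0, acos T^-1], continuous G}.
  apply: within_itv_continuous => x /andP[x0 xT]; apply: cvgD; first exact: cvg_cst.
  apply: cvgMr; apply: cvgB; last exact: cvg_cst.
  have cx : cos x != 0 by rewrite lt0r_neq0// cos_gt0_pihalf//; apply/andP; split; lra.
  exact: is_derive_continuous (is_derive_ill_angle d cx).
have [|th thin Gth] := @IVT _ G 0 (acos T^-1) y th0 cG.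
  rewrite ge_min le_max {1}/G subrr mulr0 addr0 y1 /=.
  by rewrite /G -g_fun_angle// gT orbT.
move: thin; rewrite in_itv /= => /andP[t0 tT].
have cth : 0 < cos th by apply: cos_gt0_pihalf; apply/andP; split; lra.
exists (cos th)^-1.
have c1 : 1 <= (cos th)^-1 by rewrite invf_ge1// cos_le1.
split => //; rewrite g_fun_angle// invrK cosK// in_itv /=.
by apply/andP; split; lra.
Qed.

Lemma g_inv_spec d (y : R) : 1 <= y ->
  1 <= @g_inv R d.+1 y /\ @g_fun R d.+1 (@g_inv R d.+1 y) = y.
Proof.
move=> /(g_fun_surj d)[t tP]; rewrite /g_inv; case: xgetP => [x -> //|/(_ t)].
by move=> /(_ tP).
Qed.

End illumination_profile.

(** * Upper and lower volume bounds for bodies of revolution *)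

Section ball_volume.
Context {R : realType}.
Notation mu := (@lebesgue_measure R).

Definition eball d (r : R) : set 'rV[R]_d := [set x | nrm x <= r].

Lemma dotv_consv d (s t : R) (x y : 'rV[R]_d) :
  dotv (consv s x) (consv t y) = s * t + dotv x y.
Proof.
rewrite /dotv big_ord_recl !consv0; congr (_ + _).
by apply: eq_bigr => k _; rewrite !consvS.
Qed.

Lemma nrm_consv_sqr d (s : R) (x : 'rV[R]_d) :
  nrm (consv s x) ^+ 2 = s ^+ 2 + nrm x ^+ 2.
Proof. by rewrite !nrm_sqr dotv_consv expr2. Qed.

Lemma nrm_le_sqr d (x : 'rV[R]_d) (r : R) : 0 <= r -> (nrm x <= r) = (nrm x ^+ 2 <= r ^+ 2).
Proof. by move=> r0; rewrite ler_pXn2r// nnegrE nrm_ge0. Qed.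

(* A monotone right Riemann sum exceeds the integral by at most one cell. *)
Lemma cvol_le_primitive d (A : set 'rV[R]_d) (piece : R -> R -> set 'rV[R]_d)
    (F f : R -> R) (a b k : R) : a < b -> 0 <= k ->
  (forall x, a <= x <= b -> is_derive x 1 F (f x)) ->
  (forall x y, a <= x -> x <= y -> y <= b -> f x <= f y) ->
  (forall N : nat, A `<=` \bigcup_(m in [set: 'I_N.+1])
     piece (a + m%:R * ((b - a) / N.+1%:R)) (a + m.+1%:R * ((b - a) / N.+1%:R))) ->
  (forall x y, a <= x -> x < y -> y <= b ->
     (cvol (piece x y) <= (k * ((y - x) * f y))%:E)%E) ->
  (cvol A <= (k * (F b - F a))%:E)%E.
Proof.
move=> ab k0 dF fle cov pc.
apply: (@lee_addinvnP _ _ _ (k * ((b - a) * (f b - f a)))).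
  by rewrite !mulr_ge0 ?subr_ge0 ?(ltW ab)// fle// ltW.
move=> N; set h := (b - a) / N.+1%:R.
have h0 : 0 < h by rewrite divr_gt0 ?subr_gt0.
pose s m := a + m%:R * h.
have sS m : s m.+1 = s m + h by rewrite /s -natr1 mulrDl mul1r addrA.
have s0 : s 0%N = a by rewrite /s mul0r addr0.
have sN : s N.+1 = b by rewrite /s /h mulrC divfK ?pnatr_eq0// addrC subrK.
have sle m n : (m <= n)%N -> s m <= s n.
  by move=> mn; rewrite lerD2l ler_wpM2r ?ler_nat// ltW.
apply: le_trans (le_cvol (cov N)) _; apply: le_trans (cvol_bigcup _ _) _.
rewrite esum_ord; last by move=> i; exact: cvol_ge0.
apply: (@le_trans _ _ (\sum_(m < N.+1) (k * (h * f (s m.+1)))%:E)%E).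
  apply: lee_sum => m _; apply: le_trans (pc _ _ _ _ _) _.
  - by rewrite -/h -/(s m) -s0 sle.
  - by rewrite -/h -/(s m) -/(s m.+1) sS ltrDl.
  - by rewrite -/h -/(s m.+1) -sN sle.
  - by rewrite -/h -/(s m) -/(s m.+1) {1}sS addrAC subrr add0r.
rewrite sumEFin -EFinD lee_fin -mulr_sumr -mulr_sumr.
have key n : (n <= N.+1)%N -> h * \sum_(m < n) f (s m.+1) <=
    F (s n) - F (s 0%N) + h * (f (s n) - f (s 0%N)).
  elim: n => [_|n IH nN]; first by rewrite big_ord0 !subrr mulr0 addr0.
  rewrite big_ord_recr /= mulrDr.
  have {}IH := IH (ltnW nN).
  have snn : s n <= s n.+1 by exact: sle.
  have FF : F (s n) - f (s n) * s n <= F (s n.+1) - f (s n) * s n.+1.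
    apply: (@derive_ge0_le _ (fun x => F x - f (s n) * x) (fun x => f x - f (s n))) => //.
      move=> x /andP[x1 x2].
      have dFx : is_derive x 1 F (f x).
        by apply: dF; rewrite -s0 -sN (le_trans (sle _ _ (leq0n n)) x1) (le_trans x2)// sle.
      by apply: is_derive_eq; rewrite /GRing.scale /=; ring.
    move=> x /andP[x1 x2]; rewrite subr_ge0 fle//.
      by rewrite -s0 sle.
    by rewrite -sN (le_trans x2)// sle.
  have e1 : f (s n) * s n.+1 = f (s n) * s n + h * f (s n) by rewrite sS; ring.
  move: FF IH; rewrite e1.
  move: (\sum_(m < n) _) (f (s n) * s n) (f (s n)) (f (s n.+1)) (F (s n)) (F (s n.+1)) (F (s 0%N)) (f (s 0%N)).
  move: h {e1 h0 cov sS s0 sN sle snn} @s => h s u u' v w x y z z'; lra.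
have := key N.+1 (leqnn _); rewrite s0 sN => H.
apply: le_trans (ler_wpM2l k0 H) _.
rewrite mulrDr lerD2l /h le_eqVlt; apply/orP; left; apply/eqP.
by field; rewrite nat1r pnatr_eq0.
Qed.

Lemma grid_bounds N (m : 'I_N.+1) (a b : R) : a <= b ->
  a <= a + m%:R * ((b - a) / N.+1%:R) /\ a + m.+1%:R * ((b - a) / N.+1%:R) <= b.
Proof.
move=> ab; split; first by rewrite lerDl mulr_ge0// divr_ge0// subr_ge0.
rewrite -lerBrDl mulrCA -[leRHS]mulr1 ler_wpM2l ?subr_ge0//.
by rewrite ler_pdivrMr ?ltr0n// mul1r ler_nat.
Qed.

(** * Bodies in dimension [d.+1], given the volumes of balls in dimension [d] *)

Section body.
Variables (d : nat) (k : R).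
Hypothesis k0 : 0 <= k.
Hypothesis ballE : forall r, 0 <= r -> cvol (@eball d r) = (k * r ^+ d)%:E.

Lemma cvol_cylinder_eball (a b r : R) : a < b -> 0 <= r ->
  (cvol (cylinder a b (@eball d r)) <= (k * ((b - a) * r ^+ d))%:E)%E.
Proof.
move=> ab r0; apply: le_trans (cvol_cylinder_le _ ab) _.
by rewrite ballE// -EFinM lee_fin mulrCA.
Qed.

Definition ball_zone (c : R) : set 'rV[R]_d.+1 :=
  [set x : 'rV[R]_d.+1 | 0 <= x ord0 ord0 <= c /\ nrm x <= 1].

Lemma nrm_tail_le (x : 'rV[R]_d.+1) : nrm x <= 1 ->
  nrm (tailv x) ^+ 2 <= 1 - x ord0 ord0 ^+ 2.
Proof.
rewrite nrm_le_sqr// expr1n -{1}(consv_head_tail x) nrm_consv_sqr; lra.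
Qed.

(* The slabs are bounded by equally spaced angles. *)
Lemma cvol_ball_zone (th : R) : 0 <= th -> th < pi / 2 ->
  (cvol (ball_zone (cos th)) <=
   (k * (sin_prim d.+1 (pi / 2) - sin_prim d.+1 th))%:E)%E.
Proof.
move=> th0 thpi; have pi0 := pi_gt0 R.
have sin0pi (x : R) : th <= x -> x <= pi / 2 -> 0 <= sin x.
  by move=> ? ?; apply: sin_ge0_pi; apply/andP; split; lra.
have sinle (x y : R) : th <= x -> x <= y -> y <= pi / 2 -> sin x <= sin y.
  move=> tx; rewrite le_eqVlt => /predU1P[-> //|xy yp].
  by apply: ltW; rewrite ltr_sin// in_itv /=; apply/andP; split; lra.
have coslt (x y : R) : th <= x -> x < y -> y <= pi / 2 -> cos y < cos x.
  by move=> ? ? ?; rewrite ltr_cos// in_itv /=; apply/andP; split; lra.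
have cosle (x y : R) : th <= x -> x <= y -> y <= pi / 2 -> cos y <= cos x.
  by move=> tx; rewrite le_eqVlt => /predU1P[-> //|xy yp]; apply: ltW; exact: coslt.
apply: (@cvol_le_primitive _ _ (fun x y => cylinder (cos y) (cos x) (@eball d (sin y)))
   _ (fun x => sin x ^+ d.+1)) => //.
- by move=> x _; exact: is_derive_sin_prim.
- move=> x y tx xy yp; apply: lerXn2r; rewrite ?nnegrE ?sin0pi//; try lra.
  by apply: sinle.
- move=> N x [/andP[x0 xc] nx].
  have c1 := cos_le1 th.
  have ix : -1 <= x ord0 ord0 <= 1 by apply/andP; split; lra.
  have [/andP[a0 api] ca] := acos_def ix.
  set ax := acos (x ord0 ord0) in a0 api ca.
  have axth : th <= ax.
    rewrite leNgt; apply/negP => H.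
    have : cos th < cos ax by rewrite ltr_cos// in_itv /=; apply/andP; split; lra.
    by rewrite ca; lra.
  have axpi : ax <= pi / 2.
    rewrite leNgt; apply/negP => H.
    have : cos ax < cos (pi / 2) by rewrite ltr_cos// in_itv /=; apply/andP; split; lra.
    by rewrite ca cos_pihalf; lra.
  have [m /andP[m1 m2]] := @grid_cell R N th (pi / 2) ax ltac:(by rewrite axth axpi).
  have [thu vpi] := grid_bounds m (ltW thpi).
  exists m => //; move: (th + m%:R * _) (th + m.+1%:R * _) m1 m2 thu vpi => u v m1 m2 thu vpi.
  split; first by rewrite -ca !cosle//; lra.
  have sv : 0 <= sin v by apply: sin0pi; lra.
  rewrite /eball /= nrm_le_sqr//; apply: le_trans (nrm_tail_le nx) _.
  rewrite -ca (_ : 1 - _ = sin ax ^+ 2); last by have := cos2Dsin2 ax; lra.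
  have sax : 0 <= sin ax by apply: sin0pi.
  by rewrite ler_pXn2r ?nnegrE//; apply: sinle.
- move=> x y tx xy yp; apply: le_trans (cvol_cylinder_eball _ _) _.
  + by apply: coslt.
  + by apply: sin0pi; lra.
  have sy : 0 <= sin y by apply: sin0pi => //; lra.
  rewrite lee_fin ler_wpM2l// exprS mulrA ler_wpM2r ?exprn_ge0//.
  (* The slab between the angles [x] and [y] has thickness [cos x - cos y], at most
     [(y - x) * sin y] because [sin] increases up to [pi / 2]. *)
  have : cos x + sin y * x <= cos y + sin y * y.
    apply: (@derive_ge0_le _ (fun z => cos z + sin y * z) (fun z => sin y - sin z)); first exact: ltW.
      by move=> z _; apply: is_derive_eq; rewrite /GRing.scale /=; ring.
    by move=> z /andP[xz zy]; rewrite subr_ge0; apply: sinle; lra.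
  by lra.
Qed.

(** The section at distance [y] below the apex is a ball of radius [y / q]. With [w = t - t^-1] and
    [q = sqrt (t ^ 2 - 1)] it is the tangent cone to the unit ball, truncated at the sphere of
    tangency. *)
Definition cone_body (t w q : R) : set 'rV[R]_d.+1 :=
  [set x : 'rV[R]_d.+1 | t - w <= x ord0 ord0 <= t /\
     q * nrm (tailv x) <= t - x ord0 ord0].

Lemma cvol_cone_body (t w q : R) : 0 < w -> 0 < q ->
  (cvol (cone_body t w q) <= (k * (w ^+ d.+1 / (d.+1%:R * q ^+ d)))%:E)%E.
Proof.
move=> w0 q0; have d0 : d.+1%:R != 0 :> R by rewrite pnatr_eq0.
rewrite (_ : w ^+ d.+1 / _ = w ^+ d.+1 / (d.+1%:R * q ^+ d) - 0 ^+ d.+1 / (d.+1%:R * q ^+ d)); last first.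
  by rewrite expr0n mul0r subr0.
apply: (@cvol_le_primitive _ (cone_body t w q)
  (fun x y => cylinder (t - y) (t - x) (@eball d (y / q)))
  (fun x => x ^+ d.+1 * (d.+1%:R * q ^+ d)^-1) (fun x => (x / q) ^+ d) 0 w k w0 k0).
- move=> x _; apply: is_derive_eq; rewrite /GRing.scale /= expr_div_n.
  by field; rewrite ?nat1r d0 andbT expf_neq0// gt_eqF.
- move=> x y x0 xy yw; apply: lerXn2r; rewrite ?nnegrE ?divr_ge0 ?(ltW q0) ?(le_trans x0)//.
  by rewrite ler_wpM2r// invr_ge0 ltW.
- move=> N x [/andP[x1 x2] x3].
  have [m /andP[m1 m2]] := @grid_cell R N 0 w (t - x ord0 ord0) ltac:(apply/andP; split; lra).
  exists m => //; move: (0 + m%:R * _) (0 + m.+1%:R * _) m1 m2 => u v m1 m2.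
  split; first by apply/andP; split; lra.
  by rewrite /eball /= ler_pdivlMr// mulrC; lra.
- move=> x y x0 xy yw; apply: le_trans (cvol_cylinder_eball _ _) _; first by lra.
    by rewrite divr_ge0 ?(ltW q0)//; lra.
  by rewrite lee_fin ler_wpM2l// ler_wpM2r ?exprn_ge0 ?divr_ge0 ?(ltW q0)//; lra.
Qed.

Lemma continuous_circle : continuous (fun s : R => Num.sqrt (1 - s ^+ 2) ^+ d).
Proof.
move=> s.
have c1 : {for s, continuous (fun s : R => 1 - s ^+ 2)}.
  by apply: cvgB; [exact: cvg_cst|exact: exprn_continuous].
have c2 := continuous_comp c1 (@sqrt_continuous R _).
exact: (continuous_comp c2 (@exprn_continuous R d _)).
Qed.

(** The substitution [s = cos x] turns the slice radius into [sin x] and supplies one more factor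
    [sin x]. *)
Lemma integral_circle (c : R) : -1 <= c <= 1 ->
  (\int[mu]_(s in `[(-1)%R, c]) (Num.sqrt (1 - s ^+ 2) ^+ d)%:E =
   (sin_prim d.+1 pi - sin_prim d.+1 (acos c))%:E)%E.
Proof.
move=> ic; have [/andP[a0 api] ca] := acos_def ic.
pose G (s : R) := Num.sqrt (1 - s ^+ 2) ^+ d.
have cG : continuous G by exact: continuous_circle.
have dcos (x : R) := is_derive_cos x : is_derive x 1 (@cos R) (- sin x).
have c'E : derive1 (@cos R) = fun x => - sin x.
  by apply/funext => x; exact: is_derive1E.
have cs : continuous (fun x : R => - sin x) by move=> x; apply: cvgN; exact: continuous_sin.
have := @integration_by_substitution_decreasing R cos G (acos c) pi api.
rewrite cospi ca c'E => ->.
- rewrite -Rintegral_sinX// fineK; last first.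
    apply: integrable_fin_num => //.
    by apply: itv_continuous_integrable => x _; exact: continuous_sinX.
  apply: eq_integral => x; rewrite inE /= in_itv /= => /andP[x1 x2]; congr EFin.
  change (G (cos x) * - - sin x = sin x ^+ d.+1).
  have s0 : 0 <= sin x by apply: sin_ge0_pi; rewrite (le_trans a0 x1).
  rewrite opprK /G (_ : 1 - _ = sin x ^+ 2); last by have := cos2Dsin2 x; lra.
  by rewrite sqrtr_sqr ger0_norm// exprSr.
- move=> x y; rewrite !in_itv /= => /andP[x1 x2] /andP[y1 y2] xy.
  by rewrite ltr_cos// in_itv /= ?(le_trans a0 x1) ?(le_trans a0 y1).
- by move=> x _; exact: cs.
- by apply: cvgP; apply: cvg_at_right_filter; exact: cs.
- by apply: cvgP; apply: cvg_at_left_filter; exact: cs.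
- split.
  + by move=> x _; have [] := dcos x.
  + by apply: cvg_at_right_filter; exact: continuous_cos.
  + by apply: cvg_at_left_filter; exact: continuous_cos.
- exact: continuous_subspaceT.
Qed.

Lemma integral_cone (c t q : R) : c <= t ->
  (\int[mu]_(s in `[c, t]) (((t - s) / q) ^+ d)%:E =
   ((t - c) ^+ d.+1 / (d.+1%:R * q ^+ d))%:E)%E.
Proof.
move=> ct.
have cf (x : R) : {for x, continuous (fun s : R => ((t - s) / q) ^+ d)}.
  have : is_derive x 1 (fun s : R => ((t - s) / q) ^+ d) (d%:R * ((t - x) / q) ^+ d.-1 * (- q^-1)).
    by apply: is_derive_eq; rewrite /GRing.scale /=; ring.
  exact: is_derive_continuous.
have dF (x : R) : is_derive x 1 (fun s => - ((t - s) ^+ d.+1 * (d.+1%:R * q ^+ d)^-1))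
    (((t - x) / q) ^+ d).
  apply: is_derive_eq; rewrite /GRing.scale /= expr_div_n invfM.
  have d0 : d.+1%:R != 0 :> R by rewrite pnatr_eq0.
  move: (q ^+ d)^-1 => iq; by field; rewrite ?nat1r.
rewrite -[LHS]fineK; last first.
  by apply: integrable_fin_num => //; exact: itv_continuous_integrable.
congr EFin; have := Rintegral_derive ct (fun x _ => dF x) (fun x _ => cf x).
by rewrite /Rintegral => ->; rewrite subrr expr0n /= mul0r oppr0 sub0r opprK.
Qed.

(** The slices of [A] contain balls of radius [sqrt (1 - s ^ 2)] up to height [c] and of radius
    [(t - s) / q] above it, and these are integrated. The statement serves the ball, with
    [c = t = 1], as well as the hull, with [c = t^-1]. *)
Lemma cvol_body_ge (A : set 'rV[R]_d.+1) (c t q : R) :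
  -1 <= c <= 1 -> c <= t -> 0 <= q ->
  (forall s y, -1 <= s <= c -> s ^+ 2 + nrm y ^+ 2 <= 1 -> A (consv s y)) ->
  (forall s y, c <= s <= t -> q * nrm y <= t - s -> A (consv s y)) ->
  ((k * (sin_prim d.+1 pi - sin_prim d.+1 (acos c) +
         (t - c) ^+ d.+1 / (d.+1%:R * q ^+ d)))%:E <= cvol A)%E.
Proof.
move=> ic ct q0 A1 A2.
pose f1 (s : R) : R := k * Num.sqrt (1 - s ^+ 2) ^+ d.
pose f2 (s : R) : R := k * ((t - s) / q) ^+ d.
(* [I2] is open at [c], so that for each [s] at most one of the two summands of [f] is nonzero and a
   single slice has to dominate it. *)
pose I1 : set R := `[(-1)%R, c]%classic. pose I2 : set R := `]c, t]%classic.
have cf1 : continuous f1 by move=> s; apply: cvgMr; exact: continuous_circle.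
have cf2 : continuous f2.
  move=> x; have : is_derive x 1 f2 (k * (d%:R * ((t - x) / q) ^+ d.-1 * (- q^-1))).
    by rewrite /f2; apply: is_derive_eq; rewrite /GRing.scale /=; ring.
  exact: is_derive_continuous.
have mcone : measurable_fun setT (fun s : R => ((t - s) / q) ^+ d).
  apply: continuous_measurable_fun => x.
  have : is_derive x 1 (fun s : R => ((t - s) / q) ^+ d) (d%:R * ((t - x) / q) ^+ d.-1 * (- q^-1)).
    by apply: is_derive_eq; rewrite /GRing.scale /=; ring.
  exact: is_derive_continuous.
have f10 s : 0 <= f1 s by rewrite mulr_ge0 ?exprn_ge0 ?sqrtr_ge0.
have mf1 : measurable_fun setT f1 by exact: continuous_measurable_fun.
have mf2 : measurable_fun setT f2 by exact: continuous_measurable_fun.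
have mI1 : measurable I1 by exact: measurable_itv.
have mI2 : measurable I2 by exact: measurable_itv.
pose f s : \bar R := (((EFin \o f1) \_ I1) s + ((EFin \o f2) \_ I2) s)%E.
have g10 s : (0 <= ((EFin \o f1) \_ I1) s)%E.
  by rewrite patchE; case: ifP => // _; rewrite lee_fin.
have g20 s : (0 <= ((EFin \o f2) \_ I2) s)%E.
  rewrite patchE; case: ifPn => //; rewrite inE /I2 /= in_itv /= => /andP[cs st].
  by rewrite lee_fin mulr_ge0 ?exprn_ge0 ?divr_ge0 ?subr_ge0.
have mg1 : measurable_fun setT ((EFin \o f1) \_ I1).
  by apply/(measurable_restrictT _ mI1); apply/measurable_EFinP; exact: measurable_funTS.
have mg2 : measurable_fun setT ((EFin \o f2) \_ I2).
  by apply/(measurable_restrictT _ mI2); apply/measurable_EFinP; exact: measurable_funTS.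
have fA s : (f s <= cvol [set y | A (consv s y)])%E.
  rewrite /f !patchE; case: ifPn; rewrite ?inE ?notin_setE /I1 /= in_itv /= => s1.
    rewrite ifN ?adde0; last first.
      rewrite notin_setE /I2 /= in_itv /=; move/andP: s1 => [_ sc].
      by rewrite ltNge sc.
    have r0 := sqrtr_ge0 (1 - s ^+ 2); rewrite -ballE//; apply: le_cvol => y.
    rewrite /eball /= nrm_le_sqr// => ny; apply: A1 => //.
    have s2 : 0 <= 1 - s ^+ 2.
      have /andP[h1 h2] := s1; have /andP[h3 h4] := ic; nra.
    by move: ny; rewrite (sqr_sqrtr s2); lra.
  have -> : (point : \bar R) = 0%E by [].
  rewrite add0e; case: ifPn => [|_]; last exact: cvol_ge0.
  rewrite inE /I2 /= in_itv /= => /andP[cs st].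
  have r0 : 0 <= (t - s) / q by rewrite divr_ge0 ?subr_ge0.
  rewrite -ballE//; apply: le_cvol => y; rewrite /eball /= => ny.
  apply: A2; first by rewrite (ltW cs).
  move: q0; rewrite le_eqVlt => /predU1P[<-|q0]; first by rewrite mul0r subr_ge0.
  by move: ny; rewrite ler_pdivlMr// mulrC.
have mf : measurable_fun setT f by exact: emeasurable_funD.
have := @integral_slices_le_cvol R d A f mf (fun s => adde_ge0 (g10 s) (g20 s)) fA.
apply: le_trans.
rewrite /f ge0_integralD// -!integral_mkcond.
rewrite [X in (_ <= _ + X)%E](@integral_itv_obnd_cbnd _ c (BRight t) (EFin \o f2)); last first.
  by apply/measurable_EFinP; exact: measurable_funTS.
rewrite mulrDr EFinD (EFinM k (sin_prim _ _ - _)) (EFinM k (_ / _)) -integral_circle// -(integral_cone q ct).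
have m1 : measurable_fun I1 (fun s : R => (Num.sqrt (1 - s ^+ 2) ^+ d)%:E).
  apply/measurable_EFinP; apply: measurable_funTS.
  exact: (continuous_measurable_fun continuous_circle).
have m2 : measurable_fun (`[c, t]%classic : set R) (fun s : R => (((t - s) / q) ^+ d)%:E).
  by apply/measurable_EFinP; exact: measurable_funTS.
apply: leeD; rewrite -ge0_integralZl//=.
move=> s; rewrite in_itv /= => /andP[_ st].
by rewrite lee_fin exprn_ge0// divr_ge0// subr_ge0.
Qed.

End body.
End ball_volume.

Arguments sin_prim : simpl never.

(** * Volume of the ball and of the hull of a ball and a point *)

Section illumination_volume.
Context {R : realType}.

(** By [sin (pi - x) = sin x] the sum [sin_prim d (pi - x) + sin_prim d x] has derivative 0; it is
    compared at 0 and [pi / 2]. This makes two half balls add up to the full Wallis integral. *)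
Lemma sin_prim_sym d : sin_prim d pi + sin_prim d 0 = 2 * sin_prim d (pi / 2) :> R.
Proof.
have pi0 := pi_gt0 R.
have dS (x : R) : is_derive x 1 (fun x => sin_prim d (pi - x) + sin_prim d x) 0.
  have d1 := is_derive_sin_prim d x; have d2 := is_derive_sin_prim d (pi - x).
  have d3 : is_derive x 1 (fun x => sin_prim d (pi - x)) (sin x ^+ d * -1).
    rewrite -(_ : sin (pi - x) = sin x).
      have dl : is_derive x 1 (fun y : R => pi - y) (- 1).
        have := is_deriveB (is_derive_cst (pi : R) x 1) (is_derive_id x 1).
        by rewrite sub0r.
      exact: (@is_derive1_comp R (sin_prim d) (fun y : R => pi - y) x _ _ d2 dl).
    by rewrite sinB sinpi cospi mul0r sub0r mulN1r opprK.
  by apply: is_derive_eq; ring.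
have dN (x : R) : is_derive x 1 (fun x => - (sin_prim d (pi - x) + sin_prim d x)) 0.
  by have := dS x => ds; apply: is_derive_eq; rewrite oppr0.
have h : 0 <= pi / 2 :> R by lra.
have := derive_ge0_le h (fun x _ => dS x) (fun=> fun=> lexx 0).
have := derive_ge0_le h (fun x _ => dN x) (fun=> fun=> lexx 0).
rewrite subr0 (_ : pi - pi / 2 = pi / 2); lra.
Qed.

Definition mirror d (x : 'rV[R]_d.+1) : 'rV[R]_d.+1 := consv (- x ord0 ord0) (tailv x).

Lemma mirrorK d (x : 'rV[R]_d.+1) : mirror (mirror x) = x.
Proof. by rewrite /mirror consv0 tail_consv opprK consv_head_tail. Qed.

Lemma nrm_mirror d (x : 'rV[R]_d.+1) : nrm (mirror x) = nrm x.
Proof.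
by rewrite /nrm -[in RHS](consv_head_tail x) !dotv_consv mulrNN.
Qed.

Lemma cvol_mirror_le d (S : set 'rV[R]_d.+1) : (cvol (@mirror d @` S) <= cvol S)%E.
Proof.
have -> : @mirror d = fun x => x *m elem_mx ord0 ord0 (- 2).
  apply/funext => x; apply/rowP => k; rewrite mul_elem_mx.
  case: (unliftP ord0 k) => [j ->|->]; first by rewrite consvS tailvE addr0.
  by rewrite consv0 eqxx mulr1n; ring.
have det1 : `|\det (@elem_mx R d.+1 ord0 ord0 (- 2))| = 1.
  by rewrite det_elem_mx eqxx mulr1n (_ : 1 - 2 = -1) ?normrN1//; ring.
have uE : @elem_mx R d.+1 ord0 ord0 (- 2) \in unitmx.
  by rewrite unitmxE unitfE -normr_gt0 det1.
by have := cvol_mulmx_le uE S; rewrite det1 mul1e.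
Qed.

(** The volume of the unit ball, in the recursive form that slicing gives. *)
Fixpoint kappa (d : nat) : R :=
  if d is d'.+1 then kappa d' * wallis d else 1.

Lemma kappa_gt0 d : 0 < kappa d.
Proof. by elim: d => //= d IH; rewrite mulr_gt0// wallis_gt0. Qed.

Lemma cvol_eball0 (r : R) : 0 <= r -> cvol (@eball R 0 r) = 1%E.
Proof.
move=> r0; have bv (a b : 'rV[R]_0) : boxvol a b = 1 by rewrite /boxvol big_ord0.
apply/eqP; rewrite eq_le; apply/andP; split.
  apply: le_trans (le_cvol (_ : _ `<=` box 0 0)) _; first by move=> x _ [].
  by apply: le_trans (cvol_box_le _ _) _; rewrite bv.
apply: le_ereal_inf_tmp => _ [D [a [b [BD ->]]]].
have [n Dn _] : (\bigcup_(n in D) box (a n) (b n)) 0.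
  by apply: BD; rewrite /eball /= /nrm /dotv big_ord0 sqrtr0.
apply: esum_ge; exists [set n]; last by rewrite fsbig_set1 bv.
by split; [exact: finite_set1|move=> _ ->].
Qed.

Lemma cvol_scale d (r : R) (S : set 'rV[R]_d) : 0 < r ->
  cvol ((fun x => r *: x) @` S) = ((r ^+ d)%:E * cvol S)%E.
Proof.
move=> r0; have ur : r%:M \in @unitmx R d.
  by rewrite unitmxE det_scalar unitfE expf_neq0// gt_eqF.
have := cvol_mulmx S ur; rewrite det_scalar ger0_norm ?exprn_ge0 ?(ltW r0)// => <-.
by congr cvol; apply: eq_imagel => x _; rewrite mul_mx_scalar.
Qed.

Lemma eball_scale d (r s : R) : 0 < r ->
  @eball R d (r * s) = (fun x => r *: x) @` eball s.
Proof.
move=> r0; apply/seteqP; split => [x xr|_ [x xs <-]].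
  exists (r^-1 *: x); last by rewrite scalerA mulfV ?scale1r ?gt_eqF.
  by rewrite /eball /= nrmZ ger0_norm ?invr_ge0 ?(ltW r0)// ler_pdivrMl.
by rewrite /eball /= nrmZ ger0_norm ?(ltW r0)// ler_pM2l.
Qed.

(** Induction on the dimension at radius 1: two mirror half balls from above, slices from below.
    Other positive radii follow by scaling, and radius 0 by a degenerate box. *)
Lemma cvol_eball d (r : R) : 0 <= r -> cvol (@eball R d r) = (kappa d * r ^+ d)%:E.
Proof.
elim: d r => [|d IH] r r0; first by rewrite cvol_eball0// expr0 mulr1.
have k0 := ltW (kappa_gt0 d); have pi0 := pi_gt0 R.
have B1 : cvol (@eball R d.+1 1) = (kappa d.+1)%:E.
  apply/eqP; rewrite eq_le; apply/andP; split.
    have : @eball R d.+1 1 `<=` @ball_zone R d (cos 0) `|` @mirror d @` @ball_zone R d (cos 0).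
      move=> x xB; rewrite cos0.
      have x2 := nrm_tail_le xB; have n2 := sqr_ge0 (nrm (tailv x)).
      have [x0|x0] := lerP 0 (x ord0 ord0).
        by left; split => //; apply/andP; split => //; nra.
      right; exists (mirror x); last exact: mirrorK.
      split; last by rewrite nrm_mirror.
      by rewrite consv0; apply/andP; split; nra.
    move/le_cvol/le_trans; apply; apply: le_trans (cvol_setU _ _) _.
    apply: le_trans (leeD2l _ (cvol_mirror_le _)) _.
    have Z : (cvol (@ball_zone R d (cos 0)) <= _)%E :=
      cvol_ball_zone k0 IH (lexx 0) ltac:(lra).
    apply: le_trans (leeD Z Z) _; rewrite -EFinD lee_fin /= /wallis.
    rewrite Rintegral_sinX ?pi_ge0// -mulrDr ler_wpM2l//.
    by have := sin_prim_sym d.+1; lra.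
  (* With [c = t = 1] the cone is reduced to its apex and its term vanishes. *)
  have := @cvol_body_ge R d (kappa d) k0 IH (@eball R d.+1 1) 1 1 1.
  rewrite acos1 subrr expr0n /= mul0r addr0 /wallis Rintegral_sinX ?pi_ge0//; apply => //.
  - by rewrite lexx andbT; lra.
  - by move=> s y _ sy; rewrite /eball /= nrm_le_sqr// expr1n nrm_consv_sqr.
  - move=> s y s1; rewrite mul1r => ny.
    have {}s1 : s = 1 by apply/le_anti; rewrite andbC.
    rewrite /eball /= nrm_le_sqr// expr1n nrm_consv_sqr s1.
    by have := nrm_ge0 y; nra.
move: r0; rewrite le_eqVlt => /predU1P[<-|r0]; last first.
  by rewrite -[X in eball X]mulr1 eball_scale// cvol_scale// B1 -EFinM mulrC.
rewrite expr0n mulr0; apply/eqP; rewrite eq_le cvol_ge0 andbT.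
have : @eball R d.+1 0 `<=` box 0 0.
  move=> x; rewrite /eball /= => nx k.
  have /eqP -> : x == 0 by rewrite -nrm_eq0 eq_le nx nrm_ge0.
  by rewrite lexx.
move/le_cvol/le_trans; apply; apply: le_trans (cvol_box_le _ _) _.
by rewrite lee_fin /boxvol big_ord_recl subrr maxxx mul0r.
Qed.

Lemma nrm_sum d (I : finType) (P : pred I) (f : I -> 'rV[R]_d) :
  nrm (\sum_(i | P i) f i) <= \sum_(i | P i) nrm (f i).
Proof.
apply: (big_ind2 (fun x y => nrm x <= y)) => //.
  by rewrite /nrm (_ : dotv 0 0 = 0) ?sqrtr0//; apply/eqP; rewrite dotvv_eq0.
by move=> x1 x2 y1 y2 h1 h2; apply: le_trans (nrmD _ _) _; exact: lerD.
Qed.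

(** The weights carried by [x] add up to [l]; the remaining points lie in the ball, so their part of
    the combination has norm at most [(1 - l) * r]. *)
Lemma conv_hull_eball_point d (r : R) (x y : 'rV[R]_d) :
  conv_hull (eball r `|` [set x]) y ->
  exists (l : R) (v : 'rV[R]_d), [/\ 0 <= l <= 1, nrm v <= (1 - l) * r & y = l *: x + v].
Proof.
move=> [n [w [p [w0 w1 pS ->]]]].
exists (\sum_(i < n | p i == x) w i), (\sum_(i < n | p i != x) w i *: p i).
have w1' : 1 - \sum_(i < n | p i == x) w i = \sum_(i < n | p i != x) w i.
  by rewrite -w1 (bigID (fun i => p i == x)) /= addrC addrK.
split.
- rewrite sumr_ge0//= -subr_ge0 w1'; exact: sumr_ge0.
- rewrite w1' mulr_suml; apply: le_trans (nrm_sum _ _) _; apply: ler_sum => i pix.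
  rewrite nrmZ ger0_norm// ler_wpM2l//.
  by have [//|/= pE] := pS i; rewrite pE eqxx in pix.
- rewrite (bigID (fun i => p i == x)) /=; congr (_ + _).
  by rewrite scaler_suml; apply: eq_bigr => i /eqP ->.
Qed.

Lemma conv_hull_sub d (S : set 'rV[R]_d) : S `<=` conv_hull S.
Proof.
move=> x Sx; exists 1%N, (fun=> 1), (fun=> x); split => //.
- by rewrite big_ord1.
- by rewrite big_ord1 scale1r.
Qed.

Lemma conv_hull2 d (S : set 'rV[R]_d) (a b : 'rV[R]_d) (l : R) :
  0 <= l <= 1 -> S a -> S b -> conv_hull S (l *: a + (1 - l) *: b).
Proof.
move=> /andP[l0 l1] Sa Sb.
exists 2%N, (fun i => if i == ord0 then l else 1 - l), (fun i => if i == ord0 then a else b).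
split.
- by move=> i; case: ifP => // _; rewrite subr_ge0.
- by rewrite big_ord_recl big_ord1 /= addrC subrK.
- by move=> i; case: ifP.
- by rewrite big_ord_recl big_ord1.
Qed.

Lemma nrm_consv0 d (t : R) : nrm (consv t (0 : 'rV[R]_d)) = `|t|.
Proof.
rewrite /nrm dotv_consv (_ : dotv 0 0 = 0) ?addr0 -?expr2 ?sqrtr_sqr//.
by apply/eqP; rewrite dotvv_eq0.
Qed.

(** The geometric reading of [g_fun]: the difference of sine primitives measures the ball below the
    tangency height [t^-1], the last term the tangent cone above it. The angle enters only through
    [cos = 1 / t] and [sin = q / t]. *)
Lemma g_funE_prim d (t : R) : 1 < t ->
  kappa d.+1 * @g_fun R d.+1 t =
  kappa d * (sin_prim d.+1 pi - sin_prim d.+1 (acos t^-1) +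
    (t - t^-1) ^+ d.+1 / (d.+1%:R * Num.sqrt (t ^+ 2 - 1) ^+ d)).
Proof.
move=> t1; have t0 : 0 < t by lra.
have [th0 thpi ct st] := acos_invr (ltW t1).
have W := @wallis_gt0 R d.+1; have d0 : d.+1%:R != 0 :> R by rewrite pnatr_eq0.
have tt : 0 < t ^+ 2 - 1 by rewrite subr_gt0 exprn_egt1.
set q := Num.sqrt (t ^+ 2 - 1).
have q0 : 0 < q by rewrite sqrtr_gt0.
have q2 : q ^+ 2 = t ^+ 2 - 1 by rewrite sqr_sqrtr// ltW.
have sq : sin (acos t^-1) = q / t.
  rewrite st (_ : 1 - t ^- 2 = (t ^+ 2 - 1) / t ^+ 2); last by field; rewrite gt_eqF.
  by rewrite sqrtrM ?(ltW tt)// -exprVn sqrtr_sqr ger0_norm// invr_ge0 ltW.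
rewrite g_fun_angle ?(ltW t1)// [kappa d.+1]/= -mulrA; congr (_ * _).
rewrite mulrDr mulr1 mulrA mulfV ?gt_eqF// mul1r.
rewrite {1}/wallis Rintegral_sinX ?pi_ge0// /ill_angle sin0 expr0n /= mul0r sub0r opprK ct sq.
have -> : (t - t^-1) ^+ d.+1 = (q ^+ 2 / t) ^+ d.+1.
  by congr (_ ^+ _); rewrite q2; field; rewrite gt_eqF.
rewrite !expr_div_n -!exprM mulnC !exprM !exprS.
have qd : q ^+ d != 0 by rewrite expf_neq0// gt_eqF.
have td : t ^+ d != 0 by rewrite expf_neq0// gt_eqF.
by rewrite exprMn; field; rewrite ?nat1r d0 qd td !gt_eqF.
Qed.

(** Below the tangency height [t^-1] the hull coincides with the ball, above it with the tangent
    cone; the two pieces match the terms of [g_funE_prim]. *)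
Lemma cvol_conv_eball d (t : R) : 1 < t ->
  cvol (conv_hull (@eball R d.+1 1 `|` [set consv t 0])) = (kappa d.+1 * @g_fun R d.+1 t)%:E.
Proof.
move=> t1; have t0 : 0 < t by lra.
have k0 := ltW (kappa_gt0 d); have pi0 := pi_gt0 R.
have [th0 thpi ct st] := acos_invr (ltW t1).
have tt : 0 < t ^+ 2 - 1 by rewrite subr_gt0 exprn_egt1.
rewrite g_funE_prim//; set q := Num.sqrt (t ^+ 2 - 1).
have q0 : 0 < q by rewrite sqrtr_gt0.
have q2 : q ^+ 2 = t ^+ 2 - 1 by rewrite sqr_sqrtr// ltW.
have ti1 : t^-1 < 1 by rewrite invf_lt1.
have ti0 : 0 < t^-1 by rewrite invr_gt0.
have tti : t * t^-1 = 1 by rewrite mulfV// gt_eqF.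
have IH r : 0 <= r -> cvol (@eball R d r) = (kappa d * r ^+ d)%:E by exact: cvol_eball.
set A := conv_hull _.
apply/eqP; rewrite eq_le; apply/andP; split.
  have : A `<=` (@ball_zone R d (cos (acos t^-1)) `|` @mirror d @` @ball_zone R d (cos 0)) `|`
      @cone_body R d t (t - t^-1) q.
    move=> y /conv_hull_eball_point[l [v [/andP[l0 l1]]]]; rewrite mulr1 => nv yE.
    have y0E : y ord0 ord0 = l * t + v ord0 ord0 by rewrite yE mxE mxE consv0.
    have ytE : tailv y = tailv v.
      by apply/rowP => i; rewrite !tailvE yE mxE mxE consvS mxE mulr0 add0r.
    have v2 : v ord0 ord0 ^+ 2 + nrm (tailv v) ^+ 2 <= (1 - l) ^+ 2.
      by rewrite -nrm_consv_sqr consv_head_tail -nrm_le_sqr// subr_ge0.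
    have nt := nrm_ge0 (tailv v).
    rewrite ct cos0; have [yt|yt] := lerP (y ord0 ord0) t^-1.
      (* Writing [y0] for the first coordinate of [y], [nrm y ^ 2 <= (1 - l) ^ 2 + 2 * l * t * y0 -
         l ^ 2 * t ^ 2]. As [t * y0 <= 1], this is at most [1 + l ^ 2 * (1 - t ^ 2) <= 1]. *)
      left; have ny : nrm y <= 1.
        rewrite nrm_le_sqr// -{1}(consv_head_tail y) nrm_consv_sqr ytE expr1n.
        have e1 : t * y ord0 ord0 <= 1 by rewrite -tti ler_pM2l.
        have e2 : v ord0 ord0 = y ord0 ord0 - l * t by rewrite y0E addrC addKr.
        have e3 : l * (t * y ord0 ord0) <= l by rewrite -[leRHS]mulr1 ler_wpM2l.
        have e4 : 0 <= l ^+ 2 * (t ^+ 2 - 1) by rewrite mulr_ge0 ?sqr_ge0 ?ltW.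
        move: v2; rewrite e2; nra.
      have y2 := nrm_tail_le ny; have n2 := sqr_ge0 (nrm (tailv y)).
      have [y0|y0] := lerP 0 (y ord0 ord0); [left|right].
        by split => //; rewrite y0 yt.
      exists (mirror y); last exact: mirrorK.
      split; last by rewrite nrm_mirror.
      by rewrite consv0; apply/andP; split; nra.
    right; rewrite /cone_body /= subKr (ltW yt) ytE /=.
    (* Cauchy-Schwarz against the normal [(1, q)] of the cone, whose norm is [t]. *)
    have CS : q * nrm (tailv v) + v ord0 ord0 <= t * (1 - l).
      have : (q * nrm (tailv v) + v ord0 ord0) ^+ 2 <= (t * (1 - l)) ^+ 2.
        rewrite exprMn (_ : t ^+ 2 = q ^+ 2 + 1); last by rewrite q2 subrK.
        have := sqr_ge0 (q * v ord0 ord0 - nrm (tailv v)).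
        have : (q ^+ 2 + 1) * (v ord0 ord0 ^+ 2 + nrm (tailv v) ^+ 2) <= (q ^+ 2 + 1) * (1 - l) ^+ 2.
          by rewrite ler_wpM2l// addr_ge0// sqr_ge0.
        nra.
      have tl : 0 <= t * (1 - l) by rewrite mulr_ge0 ?(ltW t0)// subr_ge0.
      move=> /(ler_wsqrtr); rewrite !sqrtr_sqr (ger0_norm tl); exact: le_trans (ler_norm _).
    have qn : 0 <= q * nrm (tailv v) by rewrite mulr_ge0// ltW.
    by rewrite y0E; split; lra.
  move/le_cvol/le_trans; apply.
  apply: le_trans (cvol_setU _ _) _; apply: le_trans (leeD2r _ (cvol_setU _ _)) _.
  apply: le_trans (leeD2r _ (leeD2l _ (cvol_mirror_le _))) _.
  have Z1 := cvol_ball_zone k0 IH th0 thpi.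
  have Z2 : (cvol (@ball_zone R d (cos 0)) <= _)%E :=
      cvol_ball_zone k0 IH (lexx 0) ltac:(lra).
  have w0 : 0 < t - t^-1 by lra.
  have Z3 := cvol_cone_body k0 IH t w0 q0.
  apply: le_trans (leeD (leeD Z1 Z2) Z3) _; rewrite -!EFinD lee_fin -!mulrDr ler_wpM2l//.
  by rewrite lerD2r; have := sin_prim_sym d.+1; lra.
have := @cvol_body_ge R d (kappa d) k0 IH A t^-1 t q; apply.
- by apply/andP; split; lra.
- by lra.
- exact: ltW.
- move=> s y _ sy; apply: conv_hull_sub; left.
  by rewrite /eball /= nrm_le_sqr// expr1n nrm_consv_sqr.
- move=> s y /andP[ts st'] qy; move: st'; rewrite le_eqVlt => /predU1P[sE|st'].
    have y0 : y = 0.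
      apply/eqP; rewrite -nrm_eq0 eq_le nrm_ge0 andbT.
      by move: qy; rewrite sE subrr pmulr_rle0.
    by apply: conv_hull_sub; right; rewrite sE y0.
  (* The ray from the apex through the point is followed down to height [t^-1]. There the cone has
     radius [q / t], and [t^-2 + q ^ 2 / t ^ 2 = 1] places the end of the segment in the ball. *)
  pose l := (s - t^-1) / (t - t^-1).
  have w0 : 0 < t - t^-1 by lra.
  have l01 : 0 <= l <= 1.
    apply/andP; split; first by rewrite /l divr_ge0; lra.
    by rewrite /l ler_pdivrMr// mul1r; lra.
  have l1 : 1 - l = (t - s) / (t - t^-1) by rewrite /l; move: (t^-1) w0 => c w0; field; rewrite gt_eqF.
  have -> : consv s y = l *: consv t 0 + (1 - l) *: consv t^-1 ((1 - l)^-1 *: y).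
    have l1n : 1 - l != 0 by rewrite l1 mulf_neq0 ?invr_eq0 ?gt_eqF// subr_gt0.
    apply/rowP => i; rewrite !mxE; case: unliftP => [j _|_] /=.
      by rewrite !mxE mulr0 add0r mulrA mulfV// mul1r.
    by rewrite /l; move: (t^-1) w0 => c w0; field; rewrite gt_eqF.
  apply: conv_hull2 => //; first by right.
  left; rewrite /eball /= nrm_le_sqr// expr1n nrm_consv_sqr nrmZ exprMn real_normK ?num_real//.
  rewrite l1 invf_div.
  have qy2 : (q * nrm y) ^+ 2 <= (t - s) ^+ 2.
    by apply: lerXn2r; rewrite ?nnegrE ?mulr_ge0 ?nrm_ge0 ?(ltW q0)// subr_ge0 ltW.
  have ts0 : 0 < t - s by lra.
  have wE : t - t^-1 = q ^+ 2 / t by rewrite q2; field; rewrite gt_eqF.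
  rewrite expr_div_n.
  have E1 : ((t - t^-1) ^+ 2 / (t - s) ^+ 2) * nrm y ^+ 2 <= q ^+ 2 / t ^+ 2.
    rewrite mulrAC ler_pdivrMr ?exprn_gt0// wE.
    rewrite (_ : (q ^+ 2 / t) ^+ 2 * nrm y ^+ 2 = (q ^+ 2 / t ^+ 2) * (q * nrm y) ^+ 2); last first.
      by field; rewrite gt_eqF.
    by rewrite ler_wpM2l// divr_ge0 ?sqr_ge0.
  have E2 : t^-1 ^+ 2 + q ^+ 2 / t ^+ 2 = 1 by rewrite q2 exprVn; field; rewrite gt_eqF.
  by rewrite -[leRHS]E2 lerD2l.
Qed.

End illumination_volume.

(** * Ellipsoids as affine images of the ball *)

Section ellipsoid.
Context {R : realType}.

Lemma conv_hull_affine d (A : 'M[R]_d) (mu : 'rV[R]_d) (S : set 'rV[R]_d) :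
  conv_hull ((fun z => z *m A + mu) @` S) = (fun z => z *m A + mu) @` conv_hull S.
Proof.
have aff n (w : 'I_n -> R) (p : 'I_n -> 'rV[R]_d) : \sum_(i < n) w i = 1 ->
    \sum_(i < n) w i *: (p i *m A + mu) = (\sum_(i < n) w i *: p i) *m A + mu.
  move=> w1; rewrite mulmx_suml -[X in _ + X]scale1r -w1 scaler_suml -big_split /=.
  by apply: eq_bigr => i _; rewrite scalerDr scalemxAl.
apply/seteqP; split => [y [n [w [p [w0 w1 pS ->]]]]|_ [_ [n [w [p [w0 w1 pS ->]]]] <-]].
  have [z zP] : {z : 'I_n -> 'rV[R]_d & forall i, S (z i) /\ z i *m A + mu = p i}.
    apply: (@choice _ _ (fun i z => S z /\ z *m A + mu = p i)) => i.
    by have [z Sz zp] := pS i; exists z.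
  exists (\sum_(i < n) w i *: z i).
    by exists n, w, z; split => // i; exact: (zP i).1.
  by rewrite -aff//; apply: eq_bigr => i _; rewrite (zP i).2.
exists n, w, (fun i => p i *m A + mu); split => // [i|]; first by exists (p i).
by rewrite aff.
Qed.

Lemma le_conv_hull d (S T : set 'rV[R]_d) : S `<=` T -> conv_hull S `<=` conv_hull T.
Proof.
by move=> ST y [n [w [p [w0 w1 pS yE]]]]; exists n, w, p; split => // i; exact: ST.
Qed.

Lemma cvol_affine d (A : 'M[R]_d) (mu : 'rV[R]_d) (S : set 'rV[R]_d) :
  A \in unitmx ->
  cvol ((fun z => z *m A + mu) @` S) = (`|\det A|%:E * cvol S)%E.
Proof.
by move=> uA; rewrite -cvol_mulmx// -[RHS](cvol_translate mu) image_comp.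
Qed.

Definition ellipsoid d (S : 'M[R]_d) (mu : 'rV[R]_d) (s : R) : set 'rV[R]_d :=
  [set x | mahal S x mu <= s].

Lemma ellipsoid_factor d (L : 'M[R]_d) (mu : 'rV[R]_d) (s : R) :
  L \in unitmx -> 0 < s ->
  ellipsoid (L^T *m L) mu s = (fun z => z *m (s *: L) + mu) @` eball 1.
Proof.
move=> uL s0; apply/seteqP; split => [x|_ [z z1 <-]].
  rewrite /ellipsoid /= mahal_factor// => xs.
  exists (s^-1 *: ((x - mu) *m invmx L)).
    by rewrite /eball /= nrmZ ger0_norm ?invr_ge0 ?(ltW s0)// ler_pdivrMl// mulr1.
  by rewrite -scalemxAl -scalemxAr scalerA mulVf ?gt_eqF// scale1r mulmxKV// subrK.
rewrite /ellipsoid /= mahal_factor// addrK -scalemxAr -scalemxAl mulmxK//.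
by rewrite nrmZ ger0_norm ?(ltW s0)// -[leRHS]mulr1 ler_pM2l.
Qed.

Lemma det_factor d (L : 'M[R]_d) : Num.sqrt (\det (L^T *m L)) = `|\det L|.
Proof. by rewrite det_mulmx det_tr -expr2 sqrtr_sqr. Qed.

Lemma unitmx_scale d (s : R) (L : 'M[R]_d) : 0 < s -> L \in unitmx -> s *: L \in unitmx.
Proof. by move=> s0 uL; rewrite unitmxE detZ unitrM -unitmxE uL unitfE expf_neq0// gt_eqF. Qed.

Lemma cvol_ellipsoid d (S : 'M[R]_d) (mu : 'rV[R]_d) (s : R) : posdef S -> 0 < s ->
  cvol (ellipsoid S mu s) = (Num.sqrt (\det S) * kappa d * s ^+ d)%:E.
Proof.
move=> /cholesky[L uL ->] s0; rewrite ellipsoid_factor// cvol_affine; last exact: unitmx_scale.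
rewrite cvol_eball// det_factor detZ normrM ger0_norm ?exprn_ge0 ?(ltW s0)// -EFinM.
by rewrite expr1n mulr1; congr EFin; ring.
Qed.

Lemma conv_hull_eball_inner d (x : 'rV[R]_d) (r : R) : nrm x <= r ->
  conv_hull (eball r `|` [set x]) = eball r.
Proof.
move=> xr; apply/seteqP; split; last by move=> y yr; apply: conv_hull_sub; left.
move=> y /conv_hull_eball_point[l [v [/andP[l0 l1] nv ->]]].
rewrite /eball /=; apply: le_trans (nrmD _ _) _.
have lx : l * nrm x <= l * r by rewrite ler_wpM2l.
by rewrite nrmZ ger0_norm//; lra.
Qed.

(** The factor [L] is chosen so that [x] is the image of the axis point at height [mahal / s]. The
    maximum with 1 covers a point inside the ellipsoid, where the hull adds nothing and [g_fun]
    takes the value 1. *)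
Lemma cvol_conv_ellipsoid d (S : 'M[R]_d.+1) (mu x : 'rV[R]_d.+1) (s : R) :
  posdef S -> 0 < s ->
  cvol (conv_hull (ellipsoid S mu s `|` [set x])) =
  (Num.sqrt (\det S) * kappa d.+1 * s ^+ d.+1 *
   @g_fun R d.+1 (Num.max 1 (mahal S x mu / s)))%:E.
Proof.
move=> pS s0; have [L [uL SE vE]] := posdef_factor (x - mu) pS.
rewrite SE ellipsoid_factor// mahal_factor//.
set m := nrm ((x - mu) *m invmx L) in vE *.
have m0 : 0 <= m by exact: nrm_ge0.
set f := fun z : 'rV[R]_d.+1 => z *m (s *: L) + mu.
have xE : x = f (consv (m / s) 0).
  rewrite /f -scalemxAr scalemxAl.
  have -> : s *: consv (m / s) 0 = m *: (delta_mx ord0 ord0 : 'rV[R]_d.+1).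
    apply/rowP => k; rewrite !mxE; case: unliftP => [j ->|->] /=; rewrite ?mxE.
      by rewrite !mulr0.
    by rewrite mulr1 mulrC divfK// gt_eqF.
  by rewrite -vE subrK.
have -> : f @` eball 1 `|` [set x] = f @` (eball 1 `|` [set consv (m / s) 0]).
  by rewrite image_setU image_set1 -xE.
rewrite conv_hull_affine cvol_affine; last exact: unitmx_scale.
rewrite det_factor detZ normrM ger0_norm ?exprn_ge0 ?(ltW s0)//.
have -> : cvol (conv_hull (@eball R d.+1 1 `|` [set consv (m / s) 0])) =
    (kappa d.+1 * @g_fun R d.+1 (Num.max 1 (m / s)))%:E.
  have [ms|ms] := lerP (m / s) 1; last by rewrite cvol_conv_eball.
  rewrite conv_hull_eball_inner; last by rewrite nrm_consv0 ger0_norm// divr_ge0// ltW.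
  by rewrite cvol_eball// expr1n g_fun1.
by rewrite -EFinM; congr EFin; ring.
Qed.

End ellipsoid.

(** * The normal distribution function and its slope *)

Section standard_normal.
Context {R : realType}.
Notation mu := (@lebesgue_measure R).

Lemma normal_pdf_affine (m s x : R) : 0 < s ->
  normal_pdf m s (s * x + m) * s = normal_pdf 0 1 x.
Proof.
move=> s0; have sn : s != 0 by rewrite gt_eqF.
rewrite !normal_pdfE ?oner_eq0//= /normal_peak /normal_fun.
rewrite addrK subr0 expr1n mul1r.
have -> : Num.sqrt (s ^+ 2 * pi *+ 2) = s * Num.sqrt (pi *+ 2).
  by rewrite -mulrnAr sqrtrM ?sqr_ge0// sqrtr_sqr ger0_norm ?(ltW s0).
have -> : - (s * x) ^+ 2 / (s ^+ 2 *+ 2) = - x ^+ 2 / (1 *+ 2).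
  by rewrite -(mulr_natr (s ^+ 2)); field.
by rewrite invfM mulrC -mulrA mulVKf.
Qed.

Lemma normal_prob_itvNy (m s a : R) : 0 < s ->
  normal_prob m s `]-oo, a] = normal_prob 0 1 `]-oo, (a - m) / s].
Proof.
move=> s0; have sn : s != 0 by rewrite gt_eqF.
pose F (x : R) := s * x + m.
have dF (x : R) : is_derive x 1 F s.
  by rewrite /F; apply: is_derive_eq; rewrite /GRing.scale /=; ring.
have F'E : derive1 F = cst s by apply/funext => x; exact: is_derive1E.
have FbE : F ((a - m) / s) = a by rewrite /F mulrC divfK// subrK.
rewrite /normal_prob -[in LHS]FbE.
have := @increasing_ge0_integration_by_substitutionNy R F (normal_pdf m s) ((a - m) / s).
rewrite F'E => ->.
- apply: eq_integral => x _; congr EFin.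
  by rewrite -(normal_pdf_affine m x s0).
- by move=> x y _ _ xy; rewrite /F ltrD2r ltr_pM2l.
- by move=> x _; exact: cvg_cst.
- exact: is_cvg_cst.
- exact: cvg_cst.
- split; first by move=> x _; have [] := dF x.
  by apply: cvg_at_left_filter; exact: is_derive_continuous (dF _).
- have -> : F = fun x => s * (x + m / s).
    by apply/funext => x; rewrite mulrDr [s * (m / s)]mulrC divfK.
  exact: gt0_cvgMrNy s0 (cvg_addrr_Ny _).
- by apply: continuous_subspaceT; exact: continuous_normal_pdf.
- by move=> x _; exact: normal_pdf_ge0.
Qed.

Lemma fin_num_normal_prob (m s : R) (A : set R) : measurable A ->
  normal_prob m s A \is a fin_num.
Proof. by move=> mA; exact: fin_num_measure. Qed.

Lemma PhiE (t : R) : normal_prob 0 1 `]-oo, t] = (Phi t)%:E.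
Proof. by rewrite /Phi fineK//; apply: fin_num_normal_prob; exact: measurable_itv. Qed.

Lemma normal_prob_itvoc (m s a b : R) : a <= b ->
  (normal_prob m s `]-oo, b] = normal_prob m s `]-oo, a] + normal_prob m s `]a, b])%E.
Proof.
move=> ab.
have -> : `]-oo, b]%classic = `]-oo, a]%classic `|` `]a, b]%classic :> set R.
  apply/seteqP; split => x /=; rewrite !in_itv /=.
    by move=> xb; have [xa|ax] := lerP x a; [left|right; rewrite xb].
  by case=> [/le_trans|/andP[]//]; apply.
rewrite measureU//.
apply/seteqP; split => // x [] /=; rewrite !in_itv /= => xa /andP[ax _].
by have := lt_le_trans ax xa; rewrite ltxx.
Qed.

Lemma normal_prob_itv_le (m s a b : R) : s != 0 -> a <= b ->
  (normal_prob m s `]a, b] <= (normal_peak s * (b - a))%:E)%E.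
Proof.
move=> s0 ab; apply: (@le_trans _ _ (\int[mu]_(x in `]a, b]) (cst (normal_peak s)%:E) x)%E).
  apply: ge0_le_integral => //.
  - by move=> x _; rewrite lee_fin normal_pdf_ge0.
  - by apply/measurable_EFinP; apply: measurable_funTS; exact: measurable_normal_pdf.
  - by move=> x _; rewrite lee_fin normal_pdf_ub.
rewrite integral_cst//= [X in (_ * X)%E](lebesgue_measure_itv `]a, b]) /= lte_fin.
move: ab; rewrite le_eqVlt => /predU1P[->|->].
  by rewrite ltxx mule0 subrr mulr0.
by rewrite -EFinD -EFinM.
Qed.

Lemma normal_pdf_std (x : R) : normal_pdf 0 1 x = normal_peak 1 * expR (- x ^+ 2 / 2).
Proof. by rewrite normal_pdfE ?oner_eq0//= /normal_fun subr0 expr1n. Qed.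

Lemma normal_pdf_std_gt0 (x : R) : 0 < normal_pdf 0 1 x.
Proof. by rewrite normal_pdf_std mulr_gt0 ?expR_gt0// normal_peak_gt0 ?oner_eq0. Qed.

Lemma normal_prob_itv_ge (M a b : R) : - M <= a -> a <= b -> b <= M ->
  ((normal_pdf 0 1 M * (b - a))%:E <= normal_prob 0 1 `]a, b])%E.
Proof.
move=> Ma ab bM.
apply: (@le_trans _ _ (\int[mu]_(x in `]a, b]) (cst (normal_pdf 0 1 M)%:E) x)%E).
  rewrite integral_cst//= [X in (_ <= _ * X)%E](lebesgue_measure_itv `]a, b]) /= lte_fin.
  move: ab; rewrite le_eqVlt => /predU1P[->|->].
    by rewrite ltxx mule0 subrr mulr0.
  by rewrite -EFinD -EFinM.
apply: ge0_le_integral => //.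
- by move=> x _; rewrite lee_fin normal_pdf_ge0.
- by apply/measurable_EFinP; apply: measurable_funTS; exact: measurable_normal_pdf.
- move=> x /=; rewrite in_itv /= => /andP[ax xb]; rewrite lee_fin !normal_pdf_std.
  rewrite ler_wpM2l ?normal_peak_ge0// ler_expR ler_wpM2r//.
  by rewrite lerN2; nra.
Qed.

Lemma Phi_diff (a b : R) : a <= b -> normal_prob 0 1 `]a, b] = (Phi b - Phi a)%:E.
Proof.
move=> ab; have := normal_prob_itvoc 0 1 ab; rewrite !PhiE EFinB => ->.
by rewrite addeAC subee// add0e.
Qed.

Lemma Phi_incr_le (a b : R) : a <= b -> Phi b - Phi a <= normal_peak 1 * (b - a).
Proof.
by move=> ab; rewrite -lee_fin -Phi_diff//; apply: normal_prob_itv_le; rewrite ?oner_eq0.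
Qed.

(** On [[-M, M]] the density is at least its value at [M]. This quantitative strict monotonicity
    converts depth errors into radial errors. *)
Lemma Phi_incr_ge (M a b : R) : - M <= a -> a <= b -> b <= M ->
  normal_pdf 0 1 M * (b - a) <= Phi b - Phi a.
Proof. by move=> Ma ab bM; rewrite -lee_fin -Phi_diff//; exact: normal_prob_itv_ge. Qed.

Lemma Phi_lt (a b : R) : a < b -> Phi a < Phi b.
Proof.
move=> ab; pose M := Num.max `|a| `|b|.
have := @Phi_incr_ge M a b; rewrite -subr_gt0 => H.
apply: lt_le_trans (H _ (ltW ab) _).
- by rewrite mulr_gt0 ?normal_pdf_std_gt0// subr_gt0.
- by rewrite lerNl (le_trans (ler_norm _))// normrN le_max lexx.
- by rewrite (le_trans (ler_norm _))// le_max lexx orbT.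
Qed.

Lemma Phi_le (a b : R) : a <= b -> Phi a <= Phi b.
Proof. by rewrite le_eqVlt => /predU1P[->//|/Phi_lt/ltW]. Qed.

Lemma Phi_ltE (a b : R) : (Phi a < Phi b) = (a < b).
Proof.
apply/idP/idP; last exact: Phi_lt.
by apply: contraTT; rewrite -!leNgt; exact: Phi_le.
Qed.

Lemma Phi_leE (a b : R) : (Phi a <= Phi b) = (a <= b).
Proof. by rewrite !leNgt Phi_ltE. Qed.

Lemma Phi_lipschitz (x y : R) : `|Phi x - Phi y| <= normal_peak 1 * `|x - y|.
Proof.
wlog xy : x y / x <= y => [H|].
  by case/orP: (le_total x y) => xy; [exact: H|rewrite distrC (distrC x); exact: H].
rewrite distrC ger0_norm ?subr_ge0 ?Phi_le// distrC ger0_norm ?subr_ge0//.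
exact: Phi_incr_le.
Qed.

Lemma continuous_Phi : continuous (@Phi R).
Proof.
move=> x; apply/cvgrPdist_le => e e0.
have k0 : 0 < normal_peak 1 :> R by rewrite normal_peak_gt0// oner_eq0.
have [d d0 dE] : exists2 d : R, 0 < d & normal_peak 1 * d <= e.
  by exists (e / normal_peak 1); rewrite ?divr_gt0// mulrC divfK// gt_eqF.
near=> y; apply: le_trans dE.
apply: le_trans (Phi_lipschitz _ _) _; rewrite ler_pM2l//.
Unshelve. all: by end_near.
Qed.

Lemma PhiN (t : R) : Phi (- t) = 1 - Phi t.
Proof.
have T1 : normal_prob 0 1 [set: R] = 1%E by exact: probability_setT.
have E1 : normal_prob 0 1 `]-oo, - t] = normal_prob 0 1 `[t, +oo[.
  rewrite /normal_prob ge0_integration_by_substitutionNy.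
  - by apply: eq_integral => x _ /=; rewrite !normal_pdf_std sqrrN.
  - by apply: continuous_subspaceT; apply: continuous_normal_pdf; rewrite oner_eq0.
  - by move=> x _; exact: normal_pdf_ge0.
have E2 : normal_prob 0 1 `[t, +oo[ = normal_prob 0 1 `]t, +oo[.
  rewrite /normal_prob -integral_itv_obnd_cbnd//.
  by apply/measurable_EFinP; apply: measurable_funTS; exact: measurable_normal_pdf.
have U : (1 = (Phi t)%:E + normal_prob 0 1 `]t, +oo[)%E.
  rewrite -PhiE -T1.
  have -> : [set: R] = `]-oo, t]%classic `|` `]t, +oo[%classic.
    apply/seteqP; split => // x _ /=; rewrite !in_itv /= andbT.
    by have [|] := leP x t; [left|right].
  apply: measureU => //.
  apply/seteqP; split => // x [] /=; rewrite !in_itv /= andbT => xt tx.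
  by have := lt_le_trans tx xt; rewrite ltxx.
by apply/EFin_inj; rewrite -PhiE E1 E2 EFinB U addeAC subee// add0e.
Qed.

Lemma Phi0 : Phi 0 = 1 / 2 :> R.
Proof. by have := PhiN 0; rewrite oppr0; lra. Qed.

Lemma Phi_near1 (e : R) : 0 < e -> exists t, 1 - e < Phi t.
Proof.
move=> e0.
have cv : normal_prob 0 1 `]-oo, n%:R] @[n --> \oo] --> normal_prob 0 1 [set: R].
  have -> : [set: R] = \bigcup_n `]-oo, n%:R]%classic.
    apply/seteqP; split => // x _; have [n xn] := nat_ray_unbounded x.
    by exists n => //=; rewrite in_itv.
  apply: nondecreasing_cvg_mu => //.
    by apply: bigcupT_measurable => n; exact: measurable_itv.
  move=> n m nm; apply/subsetPset => x /=; rewrite !in_itv /= => /le_trans; apply.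
  by rewrite ler_nat.
have := cv; rewrite probability_setT; under eq_fun do rewrite PhiE.
move=> /fine_cvg /cvgrPdist_lt/(_ _ e0)[N _ /(_ N (leqnn _))] /=.
by rewrite ltr_norml => /andP[_ H]; exists N%:R; lra.
Qed.

Lemma Phi_surj (p : R) : 0 < p < 1 -> exists t, Phi t = p.
Proof.
move=> /andP[p0 p1].
have [a ap] := Phi_near1 p0; have [b bp] : exists b, 1 - (1 - p) < Phi b.
  by apply: Phi_near1; rewrite subr_gt0.
have ab : - a <= b by rewrite -Phi_leE PhiN; lra.
have [||t _ tp] := @IVT R (@Phi R) (- a) b p ab; last by exists t.
  by apply: continuous_subspaceT; exact: continuous_Phi.
by rewrite ge_min le_max PhiN; apply/andP; split; apply/orP; [left|right]; lra.
Qed.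

Lemma PhiK (p : R) : 0 < p < 1 -> Phi (Phi_inv p) = p.
Proof.
by move=> /Phi_surj[t tp]; rewrite /Phi_inv; case: xgetP => [x -> //|/(_ t)].
Qed.

End standard_normal.

(** * Weak law of large numbers for frequencies of events *)

Section weak_law.
Context {dT : measure_display} {T : measurableType dT} {R : realType}.
Variable P : probability T R.

(* Chebyshev's inequality.  Only nonnegative integrands occur: the variance is
   read off from [E (S - np)^2 + 2 np E S = E S^2 + (np)^2]. *)
Lemma weak_law_events (B : nat -> set T) (p : R) :
  (forall i, measurable (B i)) -> (forall i, P (B i) = p%:E) ->
  (forall i j, i != j -> P (B i `&` B j) = (p * p)%:E) ->
  forall (e : R) (n : nat), 0 < e -> (0 < n)%N ->
  let Bad := [set w | e < `|n%:R^-1 * \sum_(i < n) \1_(B i) w - p|] in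
  measurable Bad /\ (P Bad <= ((n%:R * e ^+ 2)^-1)%:E)%E.
Proof.
move=> mB pB pBB e n e0 n0 Bad.
have N0 : 0 < n%:R :> R by rewrite ltr0n.
have p01 : 0 <= p <= 1.
  by rewrite -!lee_fin -(pB 0%N) measure_ge0 probability_le1.
have /andP[p0 p1] := p01.
pose S (w : T) : R := \sum_(i < n) \1_(B i) w.
have mind (C : set T) : measurable C -> measurable_fun setT (\1_C : T -> R).
  by move=> mC; exact: measurable_indic.
have mS : measurable_fun setT S by apply: measurable_sum => i; exact: mind.
have S0 w : 0 <= S w by apply: sumr_ge0 => i _.
have mV : measurable_fun setT (fun w => (S w - n%:R * p) ^+ 2).
  by apply: measurable_funX; apply: measurable_funB.
have mBad : measurable Bad.
  rewrite -[Bad]setTI.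
  have -> : Bad = (fun w => `|n%:R^-1 * S w - p|) @^-1` `]e, +oo[%classic.
    by apply/seteqP; split => w /=; rewrite in_itv /= andbT.
  suff : measurable_fun setT (fun w => `|n%:R^-1 * S w - p|) by apply => //; exact: measurable_itv.
  apply: measurableT_comp => //; apply: measurable_funB => //.
  exact: measurable_funM.
split => //.
have ES : (\int[P]_w (S w)%:E = (n%:R * p)%:E)%E.
  under eq_integral do rewrite /S -sumEFin.
  rewrite ge0_integral_sum//; last first.
    by move=> i; apply/measurable_EFinP; exact: mind.
  rewrite (eq_bigr (fun=> p%:E)); last by move=> i _; rewrite integral_indic// setIT; exact: pB.
  by rewrite sumEFin sumr_const card_ord mulr_natl.
have ES2 : (\int[P]_w (S w ^+ 2)%:E <= (n%:R * p + (n%:R * p) ^+ 2)%:E)%E.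
  have SE w : (S w ^+ 2)%:E = (\sum_(i < n) \sum_(j < n) (\1_(B i `&` B j) w)%:E)%E.
    rewrite expr2 /S mulr_suml -sumEFin; apply: eq_bigr => i _.
    by rewrite mulr_sumr -sumEFin; apply: eq_bigr => j _; rewrite indicI.
  under eq_integral do rewrite SE.
  rewrite ge0_integral_sum//; last 2 first.
    move=> i; apply: emeasurable_sum => j.
    by apply/measurable_EFinP; apply: mind; exact: measurableI.
    by move=> i w _; apply: sume_ge0 => j _; rewrite lee_fin.
  (* In each row the diagonal term is [p]; the [n - 1] other terms are counted as [n], which still
     leaves a variance bound of [n * p]. *)
  apply: (@le_trans _ _ (\sum_(i < n) (p + n%:R * p ^+ 2)%:E)%E).
    apply: lee_sum => i _; rewrite ge0_integral_sum//; last first.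
      by move=> j; apply/measurable_EFinP; apply: mind; exact: measurableI.
    rewrite (bigD1 i)//= EFinD; apply: leeD.
      rewrite integral_indic//; last exact: measurableI.
      by rewrite setIT setIid le_eqVlt; apply/orP; left; apply/eqP; exact: pB.
    apply: (@le_trans _ _ (\sum_(j < n | j != i) (p ^+ 2)%:E)%E).
      apply: lee_sum => j ji; rewrite integral_indic//; last exact: measurableI.
      rewrite setIT le_eqVlt; apply/orP; left; apply/eqP; rewrite expr2.
      by apply: pBB; rewrite eq_sym.
    rewrite sumEFin lee_fin sumr_const -[leLHS]mulr_natl ler_wpM2r ?sqr_ge0// ler_nat.
    by rewrite -[leqRHS]card_ord max_card.
  rewrite sumEFin lee_fin sumr_const card_ord -[leLHS]mulr_natl mulrDr.
  by rewrite lerD2l exprMn [n%:R ^+ 2]expr2 mulrA.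
have EV : (\int[P]_w ((S w - n%:R * p) ^+ 2)%:E <= (n%:R)%:E)%E.
  have key : (\int[P]_w ((S w - n%:R * p) ^+ 2)%:E + (2 * (n%:R * p) * (n%:R * p))%:E <=
      (n%:R * p + (n%:R * p) ^+ 2)%:E + ((n%:R * p) ^+ 2)%:E)%E.
    apply: (@le_trans _ _ (\int[P]_w (S w ^+ 2)%:E + ((n%:R * p) ^+ 2)%:E)%E); last exact: leeD2r.
    have mSE : measurable_fun setT (fun w => (S w)%:E) by exact/measurable_EFinP.
    have SE0 w : setT w -> (0 <= (S w)%:E)%E by rewrite lee_fin.
    have np0 : (0 <= (2 * (n%:R * p))%:E)%E by rewrite lee_fin !mulr_ge0.
    have -> : ((2 * (n%:R * p) * (n%:R * p))%:E = \int[P]_w ((2 * (n%:R * p))%:E * (S w)%:E))%E.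
      by rewrite (ge0_integralZl P measurableT mSE SE0 np0) ES -EFinM.
    have -> : (((n%:R * p) ^+ 2)%:E = \int[P]_w (cst ((n%:R * p) ^+ 2)%:E) w)%E.
      by rewrite integral_cst// [X in (_ * X)%E]probability_setT mule1.
    have V0 w : setT w -> (0 <= ((S w - n%:R * p) ^+ 2)%:E)%E by rewrite lee_fin sqr_ge0.
    have mVE : measurable_fun setT (fun w => ((S w - n%:R * p) ^+ 2)%:E) by exact/measurable_EFinP.
    have C0 w : setT w -> (0 <= (2 * (n%:R * p))%:E * (S w)%:E)%E by move=> /SE0 ?; exact: mule_ge0.
    have mC : measurable_fun setT (fun w => (2 * (n%:R * p))%:E * (S w)%:E)%E.
      exact: measurable_funeM.
    have Q0 w : setT w -> (0 <= (S w ^+ 2)%:E)%E by rewrite lee_fin sqr_ge0.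
    have mQ : measurable_fun setT (fun w => (S w ^+ 2)%:E).
      by apply/measurable_EFinP; exact: measurable_funX.
    have K0 w : setT w -> (0 <= (cst ((n%:R * p) ^+ 2)%:E : T -> \bar R) w)%E by rewrite lee_fin sqr_ge0.
    have mK : measurable_fun setT (cst ((n%:R * p) ^+ 2)%:E : T -> \bar R) by exact: measurable_cst.
    rewrite -(ge0_integralD P measurableT V0 mVE C0 mC) -(ge0_integralD P measurableT Q0 mQ K0 mK).
    rewrite le_eqVlt; apply/orP; left; apply/eqP; apply: eq_integral => w _.
    by rewrite /= -EFinM -!EFinD; congr EFin; ring.
  move: key; rewrite -leeBrDr// => /le_trans; apply.
  rewrite -!EFinD lee_fin (_ : _ - _ = n%:R * p); last by ring.
  by rewrite -[leRHS]mulr1 ler_wpM2l// ltW.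
have ne0 : 0 < (n%:R * e) ^+ 2 by rewrite exprn_gt0// mulr_gt0.
have : (((n%:R * e) ^+ 2)%:E * P Bad <= n%:R%:E)%E.
  apply: le_trans EV.
  have mI : measurable_fun setT (fun w => (\1_Bad w)%:E : \bar R).
    by apply/measurable_EFinP; exact: mind.
  have I0 w : setT w -> (0 <= (\1_Bad w)%:E :> \bar R)%E by rewrite lee_fin.
  have ne0E : (0 <= ((n%:R * e) ^+ 2)%:E)%E by rewrite lee_fin ltW.
  have -> : P Bad = (\int[P]_w (\1_Bad w)%:E)%E by rewrite integral_indic// setIT.
  rewrite -(ge0_integralZl P measurableT mI I0 ne0E).
  apply: ge0_le_integral => //.
  - by move=> w /I0 ?; exact: mule_ge0.
  - exact: measurable_funeM.
  - exact/measurable_EFinP.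
  - move=> w _; rewrite -EFinM lee_fin indicE.
    have [|_] := boolP (w \in Bad); last by rewrite mulr0 sqr_ge0.
    rewrite inE mulr1 => wB.
    have -> : S w - n%:R * p = n%:R * (n%:R^-1 * S w - p).
      by rewrite mulrBr mulVKf ?gt_eqF.
    rewrite !exprMn ler_wpM2l ?sqr_ge0// -[leRHS]real_normK ?num_real//.
    by apply: lerXn2r; rewrite ?nnegrE ?(ltW e0)// ltW.
rewrite muleC -lee_pdivlMr// => /le_trans; apply.
rewrite lee_fin le_eqVlt; apply/orP; left; apply/eqP.
by field; rewrite !gt_eqF.
Qed.

End weak_law.

(** * Whitened halfspaces and the union bound *)

Section halfspaces.
Context {R : realType} {d : nat}.

Lemma measurable_dotv {dT : measure_display} {T : measurableType dT}
    (X : T -> 'rV[R]_d) (u : 'rV[R]_d) : random_vector X ->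
  measurable_fun setT (fun x => dotv u (X x)).
Proof. by move=> rX; apply: measurable_sum => k; apply: measurable_funM. Qed.

(** [borel_rV] is generated by the coordinates, so the identity on that space is a random vector and
    [measurable_dotv] applies to it. *)
Lemma borel_halfspace (u : 'rV[R]_d) (c : R) : borel_rV [set y | dotv u y <= c].
Proof.
pose G := \big[setU/set0]_(k < d)
  preimage_set_system setT (fun v : 'rV[R]_d => v ord0 k) measurable.
have rid : random_vector (id : g_sigma_algebraType G -> 'rV[R]_d).
  move=> k _ A mA; apply: sub_sigma_algebra; rewrite /G (bigD1 k)//=.
  by left; exists A.
have mu := measurable_dotv u rid.
have := mu measurableT _ (measurable_itv `]-oo, c]).
by rewrite setTI; congr (measurable _).
Qed.

Variables (L : 'M[R]_d) (mu : 'rV[R]_d).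
Hypothesis uL : L \in unitmx.

(* With [S = L^T L], the vector [(y - mu) L^-1] is standard normal, so that these
   halfspaces have mass [Phi (c / nrm w)] when [w != 0]. *)
Definition HS (w : 'rV[R]_d) (c : R) : set 'rV[R]_d :=
  [set y | dotv w ((y - mu) *m invmx L) <= c].

Lemma dotv_whiten (u y : 'rV[R]_d) :
  dotv u (y - mu) = dotv (u *m L^T) ((y - mu) *m invmx L).
Proof. by rewrite dotv_mulmx trmxK mulmxKV. Qed.

Lemma HSE w c : let u := w *m (invmx L)^T in
  HS w c = [set y | dotv u y <= c + dotv u mu].
Proof.
move=> u; apply/seteqP; split => y; rewrite /HS /=.
  by rewrite -lerBlDr -dotvNr -dotvDr /u dotv_mulmx trmxK.
by rewrite -lerBlDr -dotvNr -dotvDr /u dotv_mulmx trmxK.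
Qed.

Lemma borel_HS w c : borel_rV (HS w c).
Proof. by rewrite HSE; exact: borel_halfspace. Qed.

Lemma HSZ a w c : 0 < a -> HS (a *: w) (a * c) = HS w c.
Proof. by move=> a0; apply/seteqP; split => y; rewrite /HS /= dotvZl ler_pM2l. Qed.

Lemma HS0 c : 0 <= c -> HS 0 c = setT.
Proof.
by move=> c0; apply/seteqP; split => y // _; rewrite /HS /= /dotv big1 // => k _; rewrite mxE mul0r.
Qed.

(** The union bound in the form that bracketing uses. Stated for a bare set function, it covers the
    law and the empirical measure alike. *)
Definition halfspace_subadditive (Q : set 'rV[R]_d -> R) :=
  forall (J : finType) (v : J -> 'rV[R]_d) (c : J -> R) w t w' t',
    (forall y, HS w t y -> HS w' t' y \/ exists j, ~ HS (v j) (c j) y) ->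
    Q (HS w t) <= Q (HS w' t') + \sum_j (1 - Q (HS (v j) (c j))).

Lemma empirical_subadditive n (X : nat -> 'rV[R]_d) : (0 < n)%N ->
  halfspace_subadditive (empirical n X).
Proof.
move=> n0 J v c w t w' t' cov; rewrite /empirical.
have N0 : n%:R != 0 :> R by rewrite pnatr_eq0 -lt0n.
have E1 j : 1 - n%:R^-1 * \sum_(i < n) \1_(HS (v j) (c j)) (X i) =
    n%:R^-1 * \sum_(i < n) (1 - \1_(HS (v j) (c j)) (X i)) :> R.
  by rewrite sumrB sumr_const card_ord mulrBr mulVf.
rewrite (eq_bigr _ (fun j _ => E1 j)) -mulr_sumr -mulrDr ler_wpM2l ?invr_ge0// exchange_big -big_split ler_sum//= => i _.
have ge01 j : 0 <= 1 - \1_(HS (v j) (c j)) (X i) :> R.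
  by rewrite subr_ge0 indicE lern1 leq_b1.
have [H|/negP H] := boolP (X i \in HS w t); rewrite {1}indicE; last first.
  rewrite (negbTE (introN idP H)) addr_ge0 ?sumr_ge0//.
rewrite H; move: H; rewrite inE => /cov[H|[j H]].
  by rewrite indicE mem_set//= lerDl sumr_ge0.
rewrite (bigD1 j)//= addrA [\1_(HS (v j) _) _]indicE memNset// subr0 addrAC lerDr.
by rewrite addr_ge0 ?sumr_ge0// indicE.
Qed.

End halfspaces.

(** * Finite grids of halfspaces *)

Section bracketing.
Context {R : realType} {d : nat}.

Lemma dotv_le_bounds (a b : 'rV[R]_d) (A B : R) :
  (forall k, `|a ord0 k| <= A) -> (forall k, `|b ord0 k| <= B) ->
  `|dotv a b| <= d%:R * (A * B).
Proof.
move=> aA bB; apply: (le_trans (ler_norm_sum _ _ _)).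
apply: (@le_trans _ _ (\sum_(k < d) A * B)); last by rewrite sumr_const card_ord mulr_natl.
by apply: ler_sum => k _; rewrite normrM ler_pM.
Qed.

Lemma nrm1_coord_le (w : 'rV[R]_d) k : nrm w = 1 -> `|w ord0 k| <= 1.
Proof.
move=> w1; rewrite -w1 -(ler_pXn2r (ltn0Sn 1))// ?nnegrE ?nrm_ge0//.
rewrite nrm_sqr real_normK ?num_real// /dotv (bigD1 k)//=.
by rewrite expr2 lerDl sumr_ge0// => i _; rewrite -expr2 sqr_ge0.
Qed.

Variable N : nat.

Definition grid_dir (m : {ffun 'I_d -> 'I_N.+1}) : 'rV[R]_d :=
  \row_k (-1 + (m k)%:R * (2 / N.+1%:R)).

Definition grid_thr (T0 : R) (j : 'I_N.+1) : R := - T0 + j%:R * (2 * T0 / N.+1%:R).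

(** On the cube [|z_k| <= R0], moving every coordinate of the direction by at most [h] changes
    [dotv w z] by at most [eta]. The threshold grid also has mesh [eta], whence the total slack of
    [2 * eta]. *)
Lemma halfspace_bracket (R0 : R) (w : 'rV[R]_d) (t : R) :
  (0 < d)%N -> 0 < R0 -> nrm w = 1 ->
  let h := 2 / N.+1%:R in let eta := d%:R * (h * R0) in
  exists (m : {ffun 'I_d -> 'I_N.+1}) (j : 'I_N.+1),
    let w' := grid_dir m in let tau := grid_thr (d%:R * R0) j in
    (forall k, `|(w' - w) ord0 k| <= h) /\
    forall z : 'rV[R]_d, (forall k, `|z ord0 k| <= R0) ->
      (dotv w' z <= tau - eta *+ 2 -> dotv w z <= t) /\
      (dotv w z <= t -> dotv w' z <= tau + eta *+ 2).
Proof.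
move=> d0 R00 w1 h eta.
have D0 : 0 < d%:R :> R by rewrite ltr0n.
have N0 : 0 < N.+1%:R :> R by rewrite ltr0n.
have h0 : 0 < h by rewrite divr_gt0.
have eta0 : 0 < eta by rewrite !mulr_gt0.
have /choice[m mP] k : exists m : 'I_N.+1,
    -1 + m%:R * h <= w ord0 k <= -1 + m.+1%:R * h.
  have := nrm1_coord_le k w1; rewrite ler_norml => /(grid_cell N)[m].
  by rewrite opprK -/h; exists m.
pose T0 := d%:R * R0.
have T00 : 0 < T0 by rewrite mulr_gt0.
(* Inside the cube [|dotv w z| <= T0], so clipping the threshold to [[-T0, T0]] is harmless up to a
   boundary case that the slack absorbs. *)
pose t' : R := Num.max (- T0) (Num.min T0 t).
have t'T : - T0 <= t' <= T0.
  by rewrite /t' le_max lexx/= ge_max ge_min lexx/= andbT -subr_ge0 opprK addr_ge0// ltW.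
have [j jP] := grid_cell N t'T.
exists (finfun m), j => w' tau.
have ww' k : `|(w' - w) ord0 k| <= h.
  rewrite !mxE ffunE ler_norml; have /andP[] := mP k; rewrite -/h -natr1; lra.
split => // z zR.
have := dotv_le_bounds ww' zR; rewrite -/eta dotvDl dotvNl ler_norml => /andP[z1 z2].
have := dotv_le_bounds (fun k => nrm1_coord_le k w1) zR; rewrite mul1r -/T0 ler_norml => /andP[z3 z4].
have etaE : 2 * T0 / N.+1%:R = eta by rewrite /eta /T0 /h; field; rewrite gt_eqF.
have /andP[j1 j2] : tau <= t' <= tau + eta.
  move: jP; rewrite (_ : T0 - - T0 = 2 * T0); last by ring.
  by rewrite /tau /grid_thr -/T0 etaE -natr1 mulrDl mul1r addrA.
have [t'E|t'E] : t' = - T0 /\ t < - T0 \/ (- T0 <= t /\ t' = Num.min T0 t).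
  rewrite /t'; have [H|H] := ltP t (- T0).
    left; split => //; apply/max_idPl; rewrite ge_min; apply/orP; right; exact: ltW.
  right; split => //; apply/max_idPr; rewrite le_min H andbT; lra.
  case: t'E => t'E tT; split => H; lra.
case: t'E => tT; have [H|H] := leP T0 t => t'E; split => ?; lra.
Qed.

(** The inner product of the grid direction with [w] is at least [1 / 2], and Cauchy-Schwarz passes
    this to its norm. Dividing thresholds by that norm then at most doubles them. *)
Lemma grid_dir_nrm_ge (w : 'rV[R]_d) (m : {ffun 'I_d -> 'I_N.+1}) :
  nrm w = 1 -> (forall k, `|(grid_dir m - w) ord0 k| <= 2 / N.+1%:R) ->
  d%:R * (2 / N.+1%:R) <= 1 / 2 :> R -> 1 / 2 <= nrm (grid_dir m).
Proof.
move=> w1 mw dh.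
have := dotv_le_bounds (fun k => nrm1_coord_le k w1) mw.
rewrite [1 * (2 / _)]mul1r dotvDr dotvNr -nrm_sqr w1 expr1n ler_norml => /andP[H _].
have := dotv_cauchy_schwarz w (grid_dir m); rewrite w1 [1 * nrm _]mul1r ler_norml => /andP[_ H2].
move: H H2 dh; move: (dotv _ _) (nrm _) (d%:R * _) => a b c; lra.
Qed.

End bracketing.

Section uniform.
Context {R : realType} {d : nat}.
Variables (L : 'M[R]_d) (mu : 'rV[R]_d).
Hypothesis d0 : (0 < d)%N.
Local Notation HS := (HS L mu).
Variable Q0 : set 'rV[R]_d -> R.
Hypothesis subQ0 : halfspace_subadditive L mu Q0.
Hypothesis Q0E : forall (w : 'rV[R]_d) c, w != 0 -> Q0 (HS w c) = Phi (c / nrm w).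

(** These [2 * d] directions cut out a cube by halfspaces, so leaving the cube, where bracketing
    fails, is itself an event about halfspaces. *)
Definition coord_dir (p : 'I_d * bool) : 'rV[R]_d := (-1) ^+ p.2 *: delta_mx ord0 p.1.

Lemma dotv_coord_dir p z : dotv (coord_dir p) z = (-1) ^+ p.2 * z ord0 p.1.
Proof.
rewrite /coord_dir dotvZl; congr (_ * _); rewrite /dotv (bigD1 p.1)//= mxE !eqxx mul1r big1 ?addr0//.
by move=> k kp; rewrite mxE (negbTE kp) andbF mul0r.
Qed.

Lemma nrm_coord_dir p : nrm (coord_dir p) = 1.
Proof.
rewrite /nrm dotv_coord_dir !mxE !eqxx mulr1 -expr2 -exprM mulnC exprM sqrrN expr1n expr1n.
by rewrite sqrtr1.
Qed.

(* The law [Q0] itself controls the effect of moving a halfspace to a nearby grid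
   halfspace, so closeness of [Q] to [Q0] on finitely many halfspaces suffices. *)
Lemma uniform_halfspaces (eps : R) : 0 < eps ->
  exists (I : finType) (W : I -> 'rV[R]_d) (C : I -> R) (e : R), 0 < e /\
    forall Q, halfspace_subadditive L mu Q ->
    (forall i, W i != 0 -> `|Q (HS (W i) (C i)) - Phi (C i / nrm (W i))| <= e) ->
    forall w t, nrm w = 1 -> `|Q (HS w t) - Phi t| <= eps.
Proof.
move=> eps0.
have D1 : 1 <= d%:R :> R by rewrite ler1n.
have D0 : 0 < d%:R :> R by rewrite ltr0n.
(* Each of the [2 * d] cube faces loses mass [1 - Phi R0], once for [Q] and once for [Q0]; the
   factor 16 makes the total at most [eps / 4]. *)
have [R0 [R00 PR0]] : exists R0 : R, 0 < R0 /\ 1 - Phi R0 < eps / (16 * d%:R).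
  have /Phi_near1[t Ht] : 0 < eps / (16 * d%:R) by rewrite divr_gt0// mulr_gt0.
  exists (Num.max t 1); split; first by rewrite lt_max ltr01 orbT.
  have : Phi t <= Phi (Num.max t 1) by rewrite Phi_le// le_max lexx.
  lra.
have pk0 : 0 < normal_peak 1 :> R by rewrite normal_peak_gt0// oner_neq0.
(* The first summand makes the variation of [Phi] across a bracket at most [eps / 4]; the second
   gives [d * h <= 1 / 2], hence grid directions of norm at least [1 / 2]. *)
pose B := 64 * normal_peak 1 * d%:R * R0 / eps + 4 * d%:R.
have [N NB] : exists N : nat, B < N.+1%:R.
  exists (Num.truncn B); exact: truncnS_gt.
have N0 : 0 < N.+1%:R :> R by rewrite ltr0n.
pose h := 2 / N.+1%:R : R; pose eta := d%:R * (h * R0).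
have B1 : 0 <= 64 * normal_peak 1 * d%:R * R0 / eps.
  by rewrite divr_ge0 ?(ltW eps0)// !mulr_ge0// ltW.
have dh : d%:R * (2 / N.+1%:R) <= 1 / 2 :> R.
  by rewrite mulrA ler_pdivrMr//; move: NB; rewrite /B; lra.
have etaP : 8 * normal_peak 1 * eta <= eps / 4.
  have -> : 8 * normal_peak 1 * eta = (16 * normal_peak 1 * d%:R * R0) / N.+1%:R.
    by rewrite /eta /h; ring.
  rewrite ler_pdivrMr//.
  have : 64 * normal_peak 1 * d%:R * R0 / eps <= N.+1%:R by move: NB; rewrite /B; lra.
  rewrite ler_pdivrMr//; lra.
(* One grid halfspace and the [2 * d] cube faces contribute an error [e] each, together
   [eps / 4]. *)
pose e := eps / (4 * (1 + 2 * d%:R)).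
have eP : (1 + 2 * d%:R) * e = eps / 4 by rewrite /e; field; apply: lt0r_neq0; lra.
have e0 : 0 < e by rewrite divr_gt0//; lra.
pose T0 := d%:R * R0.
pose W (i : {ffun 'I_d -> 'I_N.+1} * 'I_N.+1 * bool + 'I_d * bool) : 'rV[R]_d :=
  match i with inl (m, j, b) => grid_dir m | inr p => coord_dir p end.
pose C (i : {ffun 'I_d -> 'I_N.+1} * 'I_N.+1 * bool + 'I_d * bool) : R :=
  match i with inl (m, j, b) => grid_thr T0 j + (-1) ^+ b * (eta *+ 2) | inr p => R0 end.
exists _, W, C, e; split => // Q subQ QW w t w1.
have [m [j [mw br]]] := halfspace_bracket N t d0 R00 w1.
have nw' := grid_dir_nrm_ge w1 mw dh.
set w' := grid_dir m in mw br nw'; set tau := grid_thr _ j in br.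
rewrite -/h -/eta in br.
have w'0 : w' != 0 by rewrite -nrm_eq0 gt_eqF//; lra.
have w0 : w != 0 by rewrite -nrm_eq0 w1 oner_neq0.
have box_or y : (forall k, `|((y - mu) *m invmx L) ord0 k| <= R0) \/
    exists p, ~ HS (coord_dir p) R0 y.
  have [H|/existsNP H] := pselect (forall p, HS (coord_dir p) R0 y); last by right.
  left => k; have := H (k, false); have := H (k, true).
  rewrite /HS /= !dotv_coord_dir/= expr0 expr1 ler_norml; lra.
have cov1 y : HS w t y -> HS w' (tau + eta *+ 2) y \/ exists p, ~ HS (coord_dir p) R0 y.
  by move=> wt; case: (box_or y) => [/br[_ H]|]; [left; exact: H | right].
have cov2 y : HS w' (tau - eta *+ 2) y -> HS w t y \/ exists p, ~ HS (coord_dir p) R0 y.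
  by move=> wt; case: (box_or y) => [/br[H _]|]; [left; exact: H | right].
have cd0 p : coord_dir p != 0 by rewrite -nrm_eq0 nrm_coord_dir oner_neq0.
have tail (Q' : set 'rV[R]_d -> R) (b : R) : (forall p, 1 - Q' (HS (coord_dir p) R0) <= b) ->
    \sum_p (1 - Q' (HS (coord_dir p) R0)) <= 2 * d%:R * b.
  move=> H; apply: (@le_trans _ _ (\sum_(p : 'I_d * bool) b)); first exact: ler_sum.
  by rewrite sumr_const card_prod card_ord card_bool -[leLHS]mulr_natl natrM [_ * 2]mulrC.
have tail0 : \sum_p (1 - Q0 (HS (coord_dir p) R0)) <= 2 * d%:R * (1 - Phi R0).
  by apply: tail => p; rewrite Q0E// nrm_coord_dir divr1.
have tailQ : \sum_p (1 - Q (HS (coord_dir p) R0)) <= 2 * d%:R * (1 - Phi R0 + e).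
  apply: tail => p; have := QW (inr p) (cd0 p); rewrite /= nrm_coord_dir divr1 ler_norml; lra.
have small : 4 * d%:R * (1 - Phi R0) <= eps / 4.
  have -> : eps / 4 = 4 * d%:R * (eps / (16 * d%:R)) by field; rewrite gt_eqF.
  by rewrite ler_pM2l ?mulr_gt0// ltW.
have gap : Phi ((tau + eta *+ 2) / nrm w') - Phi ((tau - eta *+ 2) / nrm w') <= eps / 4.
  have eta0 : 0 < eta by rewrite !mulr_gt0// invr_gt0.
  apply: (le_trans (Phi_incr_le _)).
    by rewrite ler_pM2r ?invr_gt0; lra.
  apply: le_trans etaP.
  have -> : 8 * normal_peak 1 * eta = normal_peak 1 * (8 * eta) by ring.
  rewrite ler_pM2l// -mulrBl ler_pdivrMr; last lra.
  have : eta * (1 / 2) <= eta * nrm w' by rewrite ler_pM2l.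
  lra.
have Qp := QW (inl (m, j, false)) w'0; have Qm := QW (inl (m, j, true)) w'0.
rewrite /= expr0 mul1r -/w' -/tau ler_norml in Qp.
rewrite /= expr1 mulN1r -/w' -/tau ler_norml in Qm.
have := subQ _ _ _ _ _ _ _ cov1; have := subQ _ _ _ _ _ _ _ cov2.
have := subQ0 cov1; have := subQ0 cov2.
rewrite !Q0E// w1 divr1 ler_norml; lra.
Qed.

End uniform.

(** * Gaussian vectors and uniform convergence over halfspaces *)

Section gaussian_sample.
Context {dT : measure_display} {T : measurableType dT} {R : realType} {d : nat}.
Variable P : probability T R.
Variables (L : 'M[R]_d) (mu : 'rV[R]_d).
Hypothesis uL : L \in unitmx.

Lemma measure_bigsetU_le (J : finType) (B : J -> set T) :
  (forall j, measurable (B j)) -> (P (\big[setU/set0]_j B j) <= \sum_j P (B j))%E.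
Proof.
move=> mB; elim: (index_enum J) => [|j s IH]; first by rewrite !big_nil measure0.
rewrite !big_cons; apply: le_trans (leeD2l _ IH).
by apply: measureU2 => //; apply: bigsetU_measurable.
Qed.

Section one_vector.
Variable Y : T -> 'rV[R]_d.
Hypothesis gY : gaussian_rv P Y mu (L^T *m L).

Lemma measurable_HS_preimage w c : measurable (Y @^-1` HS L mu w c).
Proof.
rewrite HSE//; set u := w *m _.
have := measurable_dotv u gY.1 measurableT (measurable_itv `]-oo, c + dotv u mu]).
by rewrite setTI; congr (measurable _).
Qed.

Lemma gaussian_HS w c : w != 0 -> P (Y @^-1` HS L mu w c) = (Phi (c / nrm w))%:E.
Proof.
move=> w0; rewrite HSE//; set u := w *m _.
have wE : w = u *m L^T by rewrite /u -mulmxA -trmx_mul mulmxV// trmx1 mulmx1.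
have u0 : u != 0 by apply: contra_neq w0 => u0; rewrite wE u0 mul0mx.
have -> : Y @^-1` [set y | dotv u y <= c + dotv u mu] =
    Y @^-1` [set y | `]-oo, c + dotv u mu]%classic (dotv u y)].
  by apply/seteqP; split => y /=; rewrite in_itv.
rewrite gY.2//.
have -> : Num.sqrt (qform (L^T *m L) u) = nrm w.
  by rewrite -{2}[L]trmxK qform_gram -wE.
have nw : 0 < nrm w by rewrite lt_def nrm_eq0 w0 nrm_ge0.
by rewrite normal_prob_itvNy// addrK PhiE.
Qed.

Lemma law_subadditive : halfspace_subadditive L mu (law P Y).
Proof.
move=> J v c w t w' t' cov; rewrite -lee_fin EFinD -sumEFin /law.
have fP A : measurable A -> (fine (P A))%:E = P A.
  by move=> mA; rewrite fineK//; exact: fin_num_measure.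
have mH := measurable_HS_preimage.
rewrite !fP//.
have -> : (\sum_j (1 - fine (P (Y @^-1` HS L mu (v j) (c j))))%:E =
    \sum_j P (~` (Y @^-1` HS L mu (v j) (c j))))%E.
  by apply: eq_bigr => j _; rewrite EFinB fP// probability_setC.
pose U := \big[setU/set0]_j (~` (Y @^-1` HS L mu (v j) (c j))).
have mU : measurable U by apply: bigsetU_measurable => j _; exact: measurableC.
apply: (@le_trans _ _ (P (Y @^-1` HS L mu w' t' `|` U))).
  apply: le_measure; rewrite ?inE//; first exact: measurableU.
  move=> x /cov[H|[j H]]; first by left.
  by right; rewrite /U (bigD1 j)//=; left.
apply: (le_trans (measureU2 _ _ _)) => //.
by apply: leeD2l; apply: measure_bigsetU_le => j; exact: measurableC.
Qed.

End one_vector.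
End gaussian_sample.

Section glivenko_cantelli.
Context {dT : measure_display} {T : measurableType dT} {R : realType} {d : nat}.
Variable P : probability T R.
Variables (L : 'M[R]_d) (mu : 'rV[R]_d).
Hypothesis uL : L \in unitmx.
Variable X : nat -> T -> 'rV[R]_d.
Hypothesis gX : forall n, gaussian_rv P (X n) mu (L^T *m L).
Hypothesis iX : mutually_independent P X.
Local Notation HS := (HS L mu).

Lemma halfspace_weak_law (w : 'rV[R]_d) (c e : R) (n : nat) : w != 0 -> 0 < e -> (0 < n)%N ->
  let Bad := [set x | e < `|empirical n (X ^~ x) (HS w c) - Phi (c / nrm w)|] in
  measurable Bad /\ (P Bad <= ((n%:R * e ^+ 2)^-1)%:E)%E.
Proof.
move=> w0 e0 n0.
have mB i := measurable_HS_preimage (gX i) w c.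
have pB i := gaussian_HS uL (gX i) c w0.
apply: (weak_law_events mB pB) => // i j ij.
have := @iX [:: i; j] (fun=> HS w c); rewrite !big_cons !big_nil setIT mule1 !pB => -> //=.
  by rewrite inE andbT.
by move=> _; exact: borel_HS.
Qed.

(** [F n] is the union of the measurable bad events of finitely many grid halfspaces; off it the
    bound holds for all halfspaces at once. It later serves as the measurable cover demanded by
    outer probability. *)
Lemma glivenko_cantelli (eps : R) : (0 < d)%N -> 0 < eps ->
  exists F : nat -> set T, [/\ forall n, measurable (F n),
    (fun n => P (F n)) @ \oo --> 0%E &
    forall n x, ~ F n x -> (0 < n)%N /\
      forall w t, nrm w = 1 -> `|empirical n (X ^~ x) (HS w t) - Phi t| <= eps].
Proof.
move=> d0 eps0.
have Q0E (w : 'rV[R]_d) c : w != 0 -> law P (X 0%N) (HS w c) = Phi (c / nrm w).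
  by move=> w0; rewrite /law (gaussian_HS uL (gX 0%N)).
have [I [W [C [e [e0 unif]]]]] :=
  uniform_halfspaces d0 (law_subadditive (gX 0%N)) Q0E eps0.
(* A grid direction may be zero; such an index imposes no condition and gets an empty bad event. *)
pose Bad n i := if W i == 0 then set0 else
  [set x | e < `|empirical n (X ^~ x) (HS (W i) (C i)) - Phi (C i / nrm (W i))|].
have BadP n i : measurable (Bad n.+1 i) /\ (P (Bad n.+1 i) <= ((n.+1%:R * e ^+ 2)^-1)%:E)%E.
  rewrite /Bad; have [Wi|Wi] := eqVneq (W i) 0; last exact: halfspace_weak_law.
  by split => //; rewrite measure0 lee_fin invr_ge0 mulr_ge0// sqr_ge0.
(* With [n = 0] the empirical measure has total mass 0 instead of 1, so the whole space is declared
   bad. *)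
pose F n := if n is m.+1 then \big[setU/set0]_i Bad m.+1 i else setT.
exists F; split.
- case=> [|n]; first exact: measurableT.
  by apply: bigsetU_measurable => i _; exact: (BadP n i).1.
- suff : (fun n => P (F n.+1)) @ \oo --> 0%E by move=> H; rewrite -(cvg_shiftS (fun n => P (F n))).
  pose K : R := #|I|%:R * (e ^+ 2)^-1.
  apply: (@squeeze_cvge _ _ _ _ (cst 0%E) _ (fun n => (K * n.+1%:R^-1)%:E)).
  + apply: nearW => n /=; rewrite measure_ge0/=.
    apply: (le_trans (measure_bigsetU_le _ _)); first by move=> i; exact: (BadP n i).1.
    apply: (le_trans (lee_sum _ (fun i _ => (BadP n i).2))).
    rewrite sumEFin lee_fin sumr_const -[leLHS]mulr_natl le_eqVlt; apply/orP; left; apply/eqP.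
    by rewrite /K invfM; ring.
  + exact: cvg_cst.
  + apply: cvg_EFin; first exact: nearW.
    rewrite -(mulr0 K); apply: cvgMr; exact: cvg_harmonic.
- case=> [|n] x; first by move=> /(_ Logic.I).
  move=> Fx; split => // w t w1; apply: unif w1; first exact: empirical_subadditive.
  move=> i Wi; rewrite leNgt; apply/negP => H; apply: Fx.
  by rewrite /F (bigD1 i)//=; left; rewrite /Bad (negbTE Wi).
Qed.

End glivenko_cantelli.

(** * Halfspace depth, depth regions and the Gaussian score *)

Section depth.
Context {R : realType} {d : nat}.
Variables (L : 'M[R]_d) (mu : 'rV[R]_d).
Hypothesis uL : L \in unitmx.

(* The infimum over directions is attained at the one opposite to [z]; the zero
   direction contributes the total mass [1]. *)
Lemma HD_approx (Q : set 'rV[R]_d -> R) (e : R) (x : 'rV[R]_d) : (0 < d)%N -> 0 <= e ->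
  Q setT = 1 -> (forall A, 0 <= Q A) ->
  (forall w t, nrm w = 1 -> `|Q (HS L mu w t) - Phi t| <= e) ->
  `|HD x Q - Phi (- mahal (L^T *m L) x mu)| <= e.
Proof.
move=> d0 e0 QT Q0 QE; rewrite mahal_factor//; set z := (x - mu) *m invmx L.
have half u : [set y | dotv u y <= dotv u x] = HS L mu (u *m L^T) (dotv (u *m L^T) z).
  apply/seteqP; split => y; rewrite /HS /= /z -!dotv_whiten// !dotvDr lerD2r //.
have lbQ : has_lbound [set Q [set y | dotv u y <= dotv u x] | u in [set: 'rV[R]_d]].
  by exists 0 => _ [u _ <-].
rewrite ler_norml; apply/andP; split.
  rewrite lerBrDr addrC; apply: lb_le_inf; first by exists (Q [set y | dotv 0 y <= dotv 0 x]), 0.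
  move=> _ [u _ <-]; rewrite half; set w := u *m L^T.
  have [w0|w0] := eqVneq w 0.
    rewrite w0 HS0; last by rewrite /dotv sumr_ge0// => k _; rewrite mxE mul0r.
    have : Phi (- nrm z) <= Phi 0 by rewrite Phi_le// oppr_le0 nrm_ge0.
    rewrite Phi0 QT; lra.
  have nw : 0 < nrm w by rewrite lt_def nrm_eq0 w0 nrm_ge0.
  have iw : 0 < (nrm w)^-1 by rewrite invr_gt0.
  rewrite -(HSZ _ _ _ _ iw).
  have := QE ((nrm w)^-1 *: w) ((nrm w)^-1 * dotv w z).
  rewrite nrmZ gtr0_norm// mulVf ?gt_eqF// => /(_ erefl); rewrite ler_norml => /andP[H _].
  have : Phi (- nrm z) <= Phi ((nrm w)^-1 * dotv w z).
    apply: Phi_le; rewrite mulrC ler_pdivlMr// mulNr [nrm z * _]mulrC.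
    by have := dotv_cauchy_schwarz w z; rewrite ler_norml => /andP[].
  lra.
have [w w1 wz] : exists2 w : 'rV[R]_d, nrm w = 1 & dotv w z = - nrm z.
  have [z0|z0] := eqVneq z 0.
    exists (coord_dir (Ordinal d0, false)); first exact: nrm_coord_dir.
    by rewrite dotv_coord_dir z0 mxE mulr0; apply/eqP; rewrite eq_sym oppr_eq0 nrm_eq0.
  have nz : 0 < nrm z by rewrite lt_def nrm_eq0 z0 nrm_ge0.
  exists (- (nrm z)^-1 *: z).
    by rewrite nrmZ normrN gtr0_norm ?invr_gt0// mulVf ?gt_eqF.
  by rewrite dotvZl -nrm_sqr; field; rewrite gt_eqF.
have := QE w (dotv w z) w1; rewrite wz ler_norml => /andP[_ H].
apply: le_trans H; rewrite lerD2r; apply: ge_inf => //.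
exists (w *m (invmx L)^T) => //.
by rewrite half -mulmxA -trmx_mul mulmxV// trmx1 mulmx1 wz.
Qed.

End depth.

Section gaussian_depth.
Context {dT : measure_display} {T : measurableType dT} {R : realType} {d : nat}.
Variable P : probability T R.
Variables (S : 'M[R]_d) (mu : 'rV[R]_d).
Hypothesis (d0 : (0 < d)%N) (pS : posdef S).

Lemma HD_gaussian (Y : T -> 'rV[R]_d) (x : 'rV[R]_d) : gaussian_rv P Y mu S ->
  HD x (law P Y) = Phi (- mahal S x mu).
Proof.
have [L uL ->] := cholesky pS => gY.
apply/eqP; rewrite -subr_eq0 -normr_le0; apply: (HD_approx uL) => //.
- by rewrite /law preimage_setT probability_setT.
- by move=> A; rewrite /law fine_ge0.
- move=> w t w1; rewrite /law (gaussian_HS uL gY); last by rewrite -nrm_eq0 w1 oner_neq0.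
  by rewrite w1 divr1 subrr normr0.
Qed.

Lemma HD_empirical_cvg (X : nat -> T -> 'rV[R]_d) (eps : R) :
  (forall n, gaussian_rv P (X n) mu S) -> mutually_independent P X -> 0 < eps ->
  exists F : nat -> set T, [/\ forall n, measurable (F n),
    (fun n => P (F n)) @ \oo --> 0%E &
    forall n w, ~ F n w -> forall x,
      `|HD x (empirical n (X ^~ w)) - Phi (- mahal S x mu)| <= eps].
Proof.
have [L uL ->] := cholesky pS => gX iX eps0.
have [F [mF cF FP]] := glivenko_cantelli uL gX iX d0 eps0.
exists F; split => // n w /FP[n0 Fw] x; apply: (HD_approx uL) => //; first exact: ltW.
- rewrite /empirical (eq_bigr (fun=> 1)); last by move=> i _; rewrite indicT.
  by rewrite sumr_const card_ord mulVf// pnatr_eq0 -lt0n.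
- by move=> A; rewrite /empirical mulr_ge0 ?invr_ge0// sumr_ge0.
Qed.

End gaussian_depth.

Section discriminant.
Context {R : realType} {d : nat}.

Lemma mx_coord_le_norm (m n : nat) (A : 'M[R]_(m, n)) i j : `|A i j| <= `|A|.
Proof.
rewrite [leRHS]mx_normrE; exact: (le_bigmax _ (fun ij : 'I_m * 'I_n => `|A ij.1 ij.2|) (i, j)).
Qed.

Lemma mahal_bounded (S : 'M[R]_d) (mu : 'rV[R]_d) (K : set 'rV[R]_d) :
  posdef S -> bounded_set K -> exists2 B : R, 0 <= B & forall x, K x -> mahal S x mu <= B.
Proof.
move=> /cholesky[L uL ->] [M [_ KM]].
have {}KM x : K x -> `|x| <= M + 1 by apply: KM; rewrite ltrDl.
pose Z := d%:R * ((M + 1 + `|mu|) * `|invmx L|).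
pose B := d%:R * (Z * Z).
(* [nrm z ^ 2 <= B] gives [nrm z <= B + 1] without a square root, through
   [2 * nrm z <= nrm z ^ 2 + 1]. *)
exists (B + 1).
  by rewrite addr_ge0// /B mulr_ge0// -expr2 sqr_ge0.
move=> x Kx; rewrite mahal_factor//; set z := _ *m _.
have zZ k : `|z ord0 k| <= Z.
  have -> : z ord0 k = dotv (x - mu) (\row_i invmx L i k).
    by rewrite /z mxE /dotv; apply: eq_bigr => i _; rewrite !mxE.
  apply: dotv_le_bounds => i; last by rewrite mxE; exact: mx_coord_le_norm.
  apply: (le_trans (mx_coord_le_norm _ _ _)).
  by apply: (le_trans (ler_normB _ _)); rewrite lerD2r; exact: KM.
have : nrm z ^+ 2 <= B.
  by rewrite nrm_sqr; apply: le_trans (dotv_le_bounds zZ zZ); exact: ler_norm.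
have := sqr_ge0 (nrm z - 1); have := nrm_ge0 z.
nra.
Qed.

Lemma Phi_inv_gt0 (delta : R) : 0 < delta < 1 / 2 ->
  0 < Phi_inv (1 - delta) /\ Phi (Phi_inv (1 - delta)) = 1 - delta.
Proof.
move=> /andP[d0 d2].
have E : Phi (Phi_inv (1 - delta)) = 1 - delta by rewrite PhiK//; lra.
by split => //; rewrite -Phi_ltE E Phi0; lra.
Qed.

Lemma depth_region_gaussian (S : 'M[R]_d) (mu : 'rV[R]_d) (Q : set 'rV[R]_d -> R) (delta : R) :
  0 < delta < 1 / 2 -> (forall x, HD x Q = Phi (- mahal S x mu)) ->
  depth_region Q delta = ellipsoid S mu (Phi_inv (1 - delta)).
Proof.
move=> /Phi_inv_gt0[_ E] HE; apply/seteqP; split => x; rewrite /depth_region /ellipsoid /= HE.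
  by rewrite PhiN -[mahal _ _ _ <= _]Phi_leE E; lra.
by rewrite PhiN -[mahal _ _ _ <= _]Phi_leE E; lra.
Qed.

(** The factor [sqrt (det S)] of the volume is the one in the density. What remains in front of the
    exponential is free of [S], [mu] and [p], so comparing weighted densities amounts to comparing
    scores. *)
Lemma gauss_density_score (S : 'M[R]_d) (mu x : 'rV[R]_d) (p v : R) :
  posdef S -> 0 < p -> 0 < v ->
  p * gauss_density mu S x = v / Num.sqrt ((pi *+ 2) ^+ d) *
    expR ((2 * ln (p / (Num.sqrt (\det S) * v)) - mahal S x mu ^+ 2) / 2).
Proof.
move=> pS p0 v0; have dS := det_posdef_gt0 pS.
have sS : 0 < Num.sqrt (\det S) by rewrite sqrtr_gt0.
have pp : 0 < Num.sqrt ((pi *+ 2) ^+ d) :> R.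
  by rewrite sqrtr_gt0 exprn_gt0// pmulrn_lgt0// pi_gt0.
have E (A B : R) : (2 * A - B) / 2 = A + - B / 2 by field.
rewrite E expRD lnK ?posrE ?divr_gt0 ?mulr_gt0//.
rewrite /gauss_density sqrtrM; last by rewrite ltW// -sqrtr_gt0.
by field; rewrite !gt_eqF.
Qed.

End discriminant.

Lemma ratio_exp_ge1 (R : realType) (n : nat) (r rho : R) : 0 < rho -> rho < r ->
  1 <= ((r + rho) / (r - rho)) ^+ n.
Proof.
by move=> ? ?; rewrite exprn_ege1// ler_pdivlMr ?subr_gt0// mul1r; lra.
Qed.

(** * Deterministic consequences of a small depth error *)

Section stability.
Context {R : realType} {d : nat}.
Variables (S : 'M[R]_d.+1) (mu : 'rV[R]_d.+1) (delta : R).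
Hypothesis (pS : posdef S) (delta12 : 0 < delta < 1 / 2).
Variable r : R.
Hypothesis (r0 : 0 < r) (PhirE : Phi r = 1 - delta).
Let a : R := Num.sqrt (\det S) * kappa d.+1.
Local Notation g := (@g_fun R d.+1).

Let a0 : 0 < a. Proof. by rewrite mulr_gt0 ?kappa_gt0// sqrtr_gt0 det_posdef_gt0. Qed.

Lemma vol_ellipsoid s : 0 < s -> vol (ellipsoid S mu s) = (a * s ^+ d.+1)%:E.
Proof. by move=> s0; rewrite volE cvol_ellipsoid. Qed.

Section one_measure.
Variables (Q : set 'rV[R]_d.+1 -> R) (rho : R).
Hypothesis rho01 : 0 < rho <= 1.
Hypothesis rhor : rho < r.
Variable c : R.
Hypothesis c_gt0 : 0 < c.
Hypothesis Phi_incr : forall u v : R, - (r + 1) <= u -> u <= v -> v <= r + 1 ->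
  c * (v - u) <= Phi v - Phi u.
Hypothesis HDQ : forall x, `|HD x Q - Phi (- mahal S x mu)| <= c * rho / 2.
Let q := ((r + rho) / (r - rho)) ^+ d.+1.

Let rho0 : 0 < rho. Proof. by case/andP: rho01. Qed.
Let rho1 : rho <= 1. Proof. by case/andP: rho01. Qed.
Let c0 : 0 < c * rho. Proof. by rewrite mulr_gt0. Qed.
Let rm0 : 0 < r - rho. Proof. by rewrite subr_gt0. Qed.
Let rp0 : 0 < r + rho. Proof. by rewrite addr_gt0. Qed.

Let side : [/\ 0 < r, 0 < rho, rho <= 1, rho < r & 0 < c * rho] /\ Phi r = 1 - delta.
Proof. by []. Qed.

Lemma region_sandwich : ellipsoid S mu (r - rho) `<=` depth_region Q delta /\
  depth_region Q delta `<=` ellipsoid S mu (r + rho).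
Proof.
have [[? ? ? ? ?] ?] := side.
split => x; rewrite /ellipsoid /depth_region /= => H; have := HDQ x; rewrite ler_norml PhiN => /andP[H1 H2].
  have : Phi (mahal S x mu) <= Phi (r - rho) by rewrite Phi_le.
  have : c * (r - (r - rho)) <= Phi r - Phi (r - rho) by apply: Phi_incr; lra.
  rewrite opprB addrC subrK => ? ?; lra.
rewrite leNgt; apply/negP => m.
have : Phi (r + rho) <= Phi (mahal S x mu) by rewrite Phi_le// ltW.
have : c * (r + rho - r) <= Phi (r + rho) - Phi r by apply: Phi_incr; lra.
rewrite addrC addKr => ? ?; lra.
Qed.

(** Here [Mdelta] is a [t] with [Phi t = 1 - h], which differs from [Phi m] by at most
    [c * rho / 2]; a distance above [rho] between [t] and [m] would force a gap of at least
    [c * rho]. *)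
Lemma Mdelta_inner x : delta <= HD x Q -> `|Mdelta delta x Q - mahal S x mu| <= rho.
Proof.
have [[? ? ? ? ?] ?] := side.
move=> xD; rewrite /Mdelta xD; set h := HD x Q; set m := mahal S x mu; set t := Phi_inv _.
have m0 : 0 <= m by exact: sqrtr_ge0.
have := HDQ x; rewrite ler_norml PhiN -/h -/m => /andP[H1 H2].
have mr : m <= r + rho by exact: region_sandwich.2.
(* These bounds give [c * rho <= delta] and [h <= 1 / 2 + c * rho / 2], hence [h < 1], so that
   [Phi_inv] is a true inverse at [1 - h]. *)
have cr : c * (r + rho - r) <= Phi (r + rho) - Phi r by apply: Phi_incr; lra.
rewrite addrC addKr in cr.
have P1 : 0 <= Phi (- (r + rho)) by rewrite fine_ge0.
rewrite PhiN in P1.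
have P0 : Phi 0 <= Phi m by rewrite Phi_le.
rewrite Phi0 in P0.
have tE : Phi t = 1 - h.
  rewrite /t PhiK//; move/andP: delta12 => [? ?]; rewrite /h in xD *; lra.
have tr : t <= r by rewrite -Phi_leE tE PhirE; lra.
rewrite leNgt; apply/negP; rewrite ltr_normr => /orP[mt|mt].
  have : c * (m + rho - m) <= Phi (m + rho) - Phi m by apply: Phi_incr; lra.
  have : Phi (m + rho) <= Phi t by rewrite Phi_le//; lra.
  rewrite [m + rho]addrC addrK tE; lra.
have : c * (m - (m - rho)) <= Phi m - Phi (m - rho) by apply: Phi_incr; lra.
have : Phi t <= Phi (m - rho) by rewrite Phi_le//; lra.
rewrite subKr tE; lra.
Qed.

Lemma vol_region_bounds : exists V : R, vol (depth_region Q delta) = V%:E /\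
  a * (r - rho) ^+ d.+1 <= V <= a * (r + rho) ^+ d.+1.
Proof.
have [s1 s2] := region_sandwich.
have := le_cvol s1; have := le_cvol s2; rewrite -!volE !vol_ellipsoid//.
move: (vol _) => [V| |]//; rewrite !lee_fin => ? ?; exists V; split => //; exact/andP.
Qed.

Lemma Ill_region_bounds x : exists I : R, Ill x (depth_region Q delta) = I%:E /\
  a * (r - rho) ^+ d.+1 * g (Num.max 1 (mahal S x mu / (r - rho))) <= I <=
  a * (r + rho) ^+ d.+1 * g (Num.max 1 (mahal S x mu / (r + rho))).
Proof.
have [s1 s2] := region_sandwich.
have := le_cvol (le_conv_hull (@setSU _ [set x] _ _ s1)).
have := le_cvol (le_conv_hull (@setSU _ [set x] _ _ s2)).
rewrite !cvol_conv_ellipsoid// -!volE -/a -/(Ill _ _).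
move: (Ill _ _) => [V| |]//; rewrite !lee_fin => ? ?; exists V; split => //; exact/andP.
Qed.

Let q_ge1 : 1 <= q.
Proof. exact: ratio_exp_ge1. Qed.

(** The volume of the region and [a * r ^ d.+1] lie in one interval whose endpoints have ratio [q],
    and [ln q <= q - 1]. *)
Lemma ln_vol_region (p : R) : 0 < p ->
  `|ln (p / fine (vol (depth_region Q delta))) - ln (p / (a * r ^+ d.+1))| <= q - 1.
Proof.
have [[? ? ? ? _] _] := side.
move=> p0; have [V [-> /andP[V1 V2]]] := vol_region_bounds; rewrite /fine.
have am0 : 0 < a * (r - rho) ^+ d.+1 by rewrite mulr_gt0// exprn_gt0.
have ar0 : 0 < a * r ^+ d.+1 by rewrite mulr_gt0// exprn_gt0.
have V0 : 0 < V by exact: lt_le_trans V1.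
have q1 := q_ge1; have q0 : 0 < q by exact: lt_le_trans q1.
have ln_le u v : 0 < u -> 0 < v -> u <= q * v -> ln (p / v) - ln (p / u) <= q - 1.
  move=> u0 v0 uv; rewrite -ln_div ?posrE ?divr_gt0//.
  have -> : p / v / (p / u) = u / v by field; rewrite !gt_eqF.
  apply: (@le_trans _ _ (ln q)).
    by rewrite ler_ln ?posrE ?divr_gt0// ler_pdivrMr.
  by rewrite -{1}[q](subrKC 1); apply: le_ln1Dx; lra.
have qE : q * (a * (r - rho) ^+ d.+1) = a * (r + rho) ^+ d.+1.
  by rewrite /q expr_div_n; field; rewrite expf_neq0// gt_eqF.
rewrite ler_norml; apply/andP; split.
  rewrite lerNl opprB; apply: ln_le => //; apply: (le_trans V2).
  by rewrite -qE ler_pM2l// ler_pM2l// lerXn2r ?nnegrE ?(ltW r0) ?(ltW rm0)// gerBl ltW.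
apply: ln_le => //; apply: (@le_trans _ _ (a * (r + rho) ^+ d.+1)).
  by rewrite ler_pM2l// lerXn2r ?nnegrE ?(ltW r0) ?(ltW rp0)// lerDl ltW.
by rewrite -qE ler_pM2l.
Qed.

(** The value of [g] at [mahal] over the radius decreases with the radius, so bounding numerator and
    denominator separately costs one factor [q]: [g s / q <= y <= q * g s]. The bound [1 <= y] puts
    [y] where [g_inv] inverts [g]. *)
Lemma Ill_ratio x : let y := fine (Ill x (depth_region Q delta)) /
    fine (vol (depth_region Q delta)) in
  1 <= y /\ `|y - g (Num.max 1 (mahal S x mu / r))| <= (q - 1) * g (Num.max 1 (mahal S x mu / r)).
Proof.
move=> y; rewrite {}/y.
have : (vol (depth_region Q delta) <= Ill x (depth_region Q delta))%E.
  rewrite /Ill !volE; apply: le_cvol => z Dz; apply: conv_hull_sub; by left.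
have [V [-> /andP[V1 V2]]] := vol_region_bounds; have [I [-> /andP[I1 I2]]] := Ill_region_bounds x.
rewrite lee_fin /fine => VI; set y := I / V; have [[? ? ? ? _] _] := side.
set m := mahal S x mu in I1 I2 *; set s := Num.max 1 (m / r).
have m0 : 0 <= m by exact: sqrtr_ge0.
have am0 : 0 < a * (r - rho) ^+ d.+1 by rewrite mulr_gt0// exprn_gt0.
have ap0 : 0 < a * (r + rho) ^+ d.+1 by rewrite mulr_gt0// exprn_gt0.
have V0 : 0 < V by exact: lt_le_trans V1.
have q1 := q_ge1; have q0 : 0 < q by exact: lt_le_trans q1.
have qE : q * (a * (r - rho) ^+ d.+1) = a * (r + rho) ^+ d.+1.
  by rewrite /q expr_div_n; field; rewrite expf_neq0// gt_eqF.
have mono (u v : R) : 0 < u -> u <= v -> g (Num.max 1 (m / v)) <= g (Num.max 1 (m / u)).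
  move=> u0 uv; have v0 : 0 < v by exact: lt_le_trans uv.
  apply: g_fun_le; first by rewrite le_max lexx.
  rewrite ge_max le_max lexx/= le_max; apply/orP; right.
  by rewrite ler_wpM2l// lef_pV2// posrE.
have gs1 : 1 <= g s by rewrite -{1}(@g_fun1 R d) g_fun_le// le_max lexx.
have gs0 : 0 <= g s by exact: le_trans gs1.
have gm : g s <= g (Num.max 1 (m / (r - rho))) by apply: mono; rewrite // gerBl ltW.
have gp : g (Num.max 1 (m / (r + rho))) <= g s by apply: mono; rewrite // lerDl ltW.
split; first by rewrite /y ler_pdivlMr// mul1r.
have up : y <= q * g s.
  rewrite /y ler_pdivrMr//; apply: (le_trans I2); apply: (@le_trans _ _ (a * (r + rho) ^+ d.+1 * g s)).
    by rewrite ler_pM2l.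
  by rewrite -qE mulrAC ler_wpM2l// mulr_ge0// ltW.
have lo : g s <= q * y.
  rewrite /y mulrA ler_pdivlMr//.
  apply: (@le_trans _ _ (q * (a * (r - rho) ^+ d.+1 * g s))).
    by rewrite mulrA qE mulrC ler_wpM2r.
  by rewrite ler_pM2l//; apply: le_trans I1; rewrite ler_pM2l.
rewrite ler_norml; apply/andP; split; last by rewrite mulrBl mul1r lerD2r.
have q10 : 0 <= q - 1 by rewrite subr_ge0.
(* [g s <= q * y] bounds the defect [g s - y] by [(q - 1) * y], hence by [(q - 1) * g s] when
   [y <= g s]. *)
have [ys|ys] := leP y (g s).
  have : (q - 1) * y <= (q - 1) * g s by rewrite ler_wpM2l.
  lra.
have : 0 <= (q - 1) * g s by rewrite mulr_ge0.
lra.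
Qed.

End one_measure.

(** [r * (q - 1) / (q + 1)] solves [(r + rho) / (r - rho) = q] for [rho], with [q] the root of order
    [n.+1] of [1 + kap]. *)
Lemma small_ratio (n : nat) (kap b : R) : 0 < kap -> 0 < b ->
  exists rho, [/\ 0 < rho, rho <= b, rho < r & ((r + rho) / (r - rho)) ^+ n.+1 <= 1 + kap].
Proof.
move=> k0 b0; have r1 : 0 < r by [].
have l0 : 0 < ln (1 + kap) by rewrite ln_gt0// ltrDl.
pose q : R := expR (ln (1 + kap) / n.+1%:R).
have q1 : 1 < q by rewrite -expR0 ltr_expR divr_gt0.
have qE : q ^+ n.+1 = 1 + kap.
  by rewrite -expRM_natr mulfVK ?pnatr_eq0// lnK// posrE addr_gt0.
have f0 : 0 < r * (q - 1) / (q + 1) by rewrite divr_gt0 ?mulr_gt0//; lra.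
have fr : r * (q - 1) / (q + 1) < r.
  by rewrite ltr_pdivrMr ?ltr_pM2l//; lra.
exists (Num.min b (r * (q - 1) / (q + 1))); set rho := Num.min _ _.
have rf : rho <= r * (q - 1) / (q + 1) by rewrite ge_min lexx orbT.
have rr : rho < r by exact: le_lt_trans fr.
have rho0 : 0 < rho by rewrite lt_min b0 f0.
have D0 : 0 < r - rho by lra.
split => //; first by rewrite ge_min lexx.
rewrite -qE lerXn2r ?nnegrE ?divr_ge0 ?(ltW D0)//; try lra.
by rewrite ler_pdivrMr//; move: rf; rewrite ler_pdivlMr; lra.
Qed.

End stability.

Section score_stability.
Context {R : realType} {d : nat}.
Variables (S : 'M[R]_d.+1) (mu : 'rV[R]_d.+1) (delta : R).
Hypothesis (pS : posdef S) (delta12 : 0 < delta < 1 / 2).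

(** The tolerance [e] depends neither on [Q] nor on [x], so chance enters later only through the
    depth hypothesis. Half of [eps] is allotted to the logarithm of the volume, half to the square
    of [Mdelta]. *)
Lemma score_stable (p B eps : R) : 0 < p -> 0 <= B -> 0 < eps ->
  exists2 e : R, 0 < e & forall Q : set 'rV[R]_d.+1 -> R,
    (forall x, `|HD x Q - Phi (- mahal S x mu)| <= e) ->
    forall x, mahal S x mu <= B ->
    `|2 * ln (p / fine (vol (depth_region Q delta))) - Mdelta delta x Q ^+ 2
      - (2 * ln (p / fine (vol (ellipsoid S mu (Phi_inv (1 - delta))))) - mahal S x mu ^+ 2)|
      <= eps.
Proof.
move=> p0 B0 eps0; have [r0 PhirE] := Phi_inv_gt0 delta12.
have -> : fine (vol (ellipsoid S mu (Phi_inv (1 - delta)))) =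
  Num.sqrt (\det S) * kappa d.+1 * Phi_inv (1 - delta) ^+ d.+1 by rewrite volE cvol_ellipsoid.
have Mout (x : 'rV[R]_d.+1) Q : ~~ (delta <= HD x Q) -> Mdelta delta x Q = Phi_inv (1 - delta) *
    @g_inv R d.+1 (fine (Ill x (depth_region Q delta)) / fine (vol (depth_region Q delta))).
  by rewrite /Mdelta => /negbTE ->.
move: (Phi_inv (1 - delta)) => r in r0 PhirE Mout *.
(* With [M] for [Mdelta], [|M ^ 2 - m ^ 2| <= |M - m| * (|M - m| + 2 * m)], at most
   [eta * (1 + 2 * B) <= eps / 2]. *)
pose eta : R := Num.min 1 (eps / (2 * (1 + 2 * B))).
have B1 : 0 < 1 + 2 * B by lra.
have eta0 : 0 < eta by rewrite lt_min ltr01 divr_gt0// mulr_gt0.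
have eta1 : eta <= 1 by rewrite ge_min lexx.
have etaB : eta * (1 + 2 * B) <= eps / 2.
  have : eta <= eps / (2 * (1 + 2 * B)) by rewrite ge_min lexx orbT.
  by rewrite ler_pdivlMr ?mulr_gt0//; lra.
(* The inverse of [g_fun] is later multiplied by [r], which turns [eta / (2 * r)] into [eta / 2];
   the other half of [eta] is kept for the radial error [rho]. *)
have [k k0 kP] : exists2 k : R, 0 < k & forall s t : R, 1 <= s -> 1 <= t ->
  `|@g_fun R d.+1 t - @g_fun R d.+1 s| < k -> `|t - s| <= eta / (2 * r).
  by apply: g_fun_stable; rewrite divr_gt0// mulr_gt0.
pose G := @g_fun R d.+1 (Num.max 1 (B / r)).
have G1 : 1 <= G by rewrite -{1}(@g_fun1 R d) g_fun_le// le_max lexx.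
have G0 : 0 < G by lra.
(* [eps / 4] is for the logarithm, which the score doubles. [k / (2 * G)] keeps the error of the
   illumination ratio below [k], as [G] bounds [g_fun] over all points with [mahal <= B]. *)
pose kap : R := Num.min (eps / 4) (k / (2 * G)).
have kap0 : 0 < kap by rewrite lt_min !divr_gt0// mulr_gt0.
have b0 : 0 < Num.min 1 (eta / 2) :> R by rewrite lt_min ltr01 divr_gt0.
have [rho [rho0 rhob rhor qk]] := small_ratio r0 d kap0 b0.
have rho1 : rho <= 1 by apply: le_trans rhob _; rewrite ge_min lexx.
have rhoe : rho <= eta / 2 by apply: le_trans rhob _; rewrite ge_min lexx orbT.
have rho01 : 0 < rho <= 1 by rewrite rho0.
pose c : R := normal_pdf 0 1 (r + 1).
have c0 : 0 < c by exact: normal_pdf_std_gt0.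
exists (c * rho / 2); first by rewrite divr_gt0 ?mulr_gt0.
move=> Q HDQ x xB.
have incr u v : - (r + 1) <= u -> u <= v -> v <= r + 1 -> c * (v - u) <= Phi v - Phi u.
  exact: Phi_incr_ge.
have lnP := ln_vol_region pS r0 PhirE rho01 rhor c0 incr HDQ p0.
set m := mahal S x mu in xB *.
have m0 : 0 <= m by exact: sqrtr_ge0.
have MP : `|Mdelta delta x Q - m| <= eta.
  have [xD|xD] := boolP (delta <= HD x Q).
    have := Mdelta_inner delta12 r0 PhirE rho01 rhor c0 incr HDQ xD.
    by rewrite -/m => /le_trans; apply; lra.
  rewrite Mout//; set y := _ / _.
  have [y1] := Ill_ratio pS r0 PhirE rho01 rhor c0 incr HDQ x.
  rewrite -/y -/m; set s := Num.max 1 (m / r) => ys.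
  have [gy1 gyE] := g_inv_spec d y1.
  have s1 : 1 <= s by rewrite le_max lexx.
  have gsG : @g_fun R d.+1 s <= G.
    apply: g_fun_le => //; rewrite ge_max le_max lexx/= le_max; apply/orP; right.
    by rewrite ler_pM2r ?invr_gt0.
  have : `|@g_inv R d.+1 y - s| <= eta / (2 * r).
    apply: kP => //; rewrite gyE; apply: (le_lt_trans ys).
    apply: (@le_lt_trans _ _ (kap * G)).
      have gs1 : 1 <= @g_fun R d.+1 s by rewrite -{1}(@g_fun1 R d) g_fun_le.
      apply: ler_pM => //; try lra.
      by rewrite subr_ge0 ratio_exp_ge1.
    apply: (@le_lt_trans _ _ (k / (2 * G) * G)).
      by rewrite ler_pM2r// ge_min lexx orbT.
    have -> : k / (2 * G) * G = k / 2 by field; rewrite gt_eqF.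
    lra.
  rewrite -(ler_pM2l r0) (_ : r * (eta / (2 * r)) = eta / 2); last by field; rewrite gt_eqF.
  rewrite -{1}(gtr0_norm r0) -normrM mulrBr => H.
  (* A point outside the region has [m > r - rho] by the inner inclusion, so [r * s], the maximum of
     [r] and [m], is within [rho] of [m]. *)
  have : `|r * s - m| <= rho.
    have rm : r - rho < m.
      rewrite ltNge; apply: contra xD => H2.
      exact: (region_sandwich r0 PhirE rho01 rhor c0 incr HDQ).1.
    rewrite /s maxr_pMr ?(ltW r0)// mulr1 mulrCA mulfV ?gt_eqF// mulr1.
    by have [mr|mr] := leP m r; rewrite ler_norml; lra.
  move: H; rewrite !ler_norml; lra.
have M2 : `|Mdelta delta x Q ^+ 2 - m ^+ 2| <= eps / 2.
  apply: le_trans etaB; rewrite subr_sqr normrM ler_pM//.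
  have -> : Mdelta delta x Q + m = (Mdelta delta x Q - m) + 2 * m by ring.
  apply: (le_trans (ler_normD _ _)); rewrite [`|2 * m|]ger0_norm ?mulr_ge0//; lra.
have q4 : ((r + rho) / (r - rho)) ^+ d.+1 - 1 <= eps / 4.
  have : kap <= eps / 4 by rewrite ge_min lexx.
  lra.
move: lnP M2 q4; rewrite !ler_norml; lra.
Qed.

End score_stability.

Theorem theorem8 (R : realType) (d : nat)
  (mu : 'I_2 -> 'rV[R]_d) (Sigma : 'I_2 -> 'M[R]_d) (prior : 'I_2 -> R) (delta : R)
  (dT : measure_display) (T : measurableType dT) (P : probability T R)
  (X : 'I_2 -> nat -> T -> 'rV[R]_d) :
  (0 < d)%N ->
  (forall j, posdef (Sigma j)) ->
  (forall j, 0 < prior j) -> prior 0 + prior 1 = 1 ->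
  0 < delta < 1 / 2 ->
  (* for each j, X j 0, X j 1, ... is an i.i.d. sample from N_d(mu j, Sigma j) *)
  (forall j n, gaussian_rv P (X j n) (mu j) (Sigma j)) ->
  (forall j, mutually_independent P (X j)) ->
  (* population measure P^(j) = N_d(mu j, Sigma j), the common law of the X j n *)
  let Pop j := law P (X j 0%N) in
  let score j x := 2 * ln (prior j / fine (vol (depth_region (Pop j) delta)))
                   - mahal (Sigma j) x (mu j) ^+ 2 in
  (forall x : 'rV[R]_d,
     score 1 x < score 0 x <->
     prior 1 * gauss_density (mu 1) (Sigma 1) x < prior 0 * gauss_density (mu 0) (Sigma 0) x)
  /\
  (forall (j : 'I_2) (K : set 'rV[R]_d), bounded_set K ->
     cvg_in_outer_prob P (fun n eps =>
       [set w | exists2 x, K x &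
          let Pn := empirical n (fun i => X j i w) in
          eps < `| 2 * ln (prior j / fine (vol (depth_region Pn delta)))
                   - Mdelta delta x Pn ^+ 2 - score j x |])).
Proof.
case: d mu Sigma X => // d mu Sigma X d0 pS pi0 _ delta12 gX iX Pop score.
have [r0 _] := Phi_inv_gt0 delta12; set r := Phi_inv (1 - delta) in r0.
have PopE j : depth_region (Pop j) delta = ellipsoid (Sigma j) (mu j) r.
  by apply: depth_region_gaussian => // x; exact: HD_gaussian.
split=> [x|j K bK eps eps0].
  (* [v] is the part of the volume of the depth region that both populations share. *)
  pose v : R := kappa d.+1 * r ^+ d.+1.
  have v0 : 0 < v by rewrite mulr_gt0 ?kappa_gt0// exprn_gt0.
  have c0 : 0 < v / Num.sqrt ((pi *+ 2) ^+ d.+1).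
    by rewrite divr_gt0// sqrtr_gt0 exprn_gt0// pmulrn_lgt0// pi_gt0.
  have volv j : fine (vol (ellipsoid (Sigma j) (mu j) r)) = Num.sqrt (\det (Sigma j)) * v.
    by rewrite volE (cvol_ellipsoid _ (pS j) r0) /v [in RHS]mulrA.
  rewrite /score !PopE !volv !(gauss_density_score (mu _) x (pS _) (pi0 _) v0).
  by rewrite (ltr_pM2l c0) ltr_expR ltr_pM2r ?invr_gt0.
(* [B] bounds the Mahalanobis distance on [K] and fixes the tolerance [e]. Off [F n] every depth is
   within [e], so no point of [K] can violate the score bound and the outer event lies in [F n]. *)
have [B B0 KB] := mahal_bounded (mu j) (pS j) bK.
have [e e0 eP] := score_stable (mu j) (pS j) delta12 (pi0 j) B0 eps0.
have [F [mF cF FP]] := HD_empirical_cvg d0 (pS j) (gX j) (iX j) e0.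
exists F; split => // n; split=> // w [x Kx]; rewrite /= => H.
apply: contrapT => Fw; move: H; apply/negP; rewrite -leNgt /score PopE.
by apply: eP; [exact: FP | exact: KB].
Qed.
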